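(* Let $n\geq2$ and let $Z_n\subset\mathbb{R}^{n-1}\times\mathbb{R}=\mathbb{R}^n$ be the convex body with support function $$h_{Z_n}(x,t)=\mathbb{E}\,\bigl|\langle x,\Gamma_{n-1}\rangle+t\bigr|,$$ where $\Gamma_{n-1}$ is a centered Gaussian random vector in $\mathbb{R}^{n-1}$ with covariance matrix $(\pi/2)I_{n-1}$. Then the polar $Z_n^\circ$ is a zonoid. More precisely, let $\varphi^\circ(s):=h_{Z_n^\circ}(e_1,s)$, $s\in\mathbb{R}$, where $e_1\in\mathbb{R}^{n-1}$ is the first coordinate vector. If $\nu$ is a positive Borel measure on $(0,\infty)$ such that $$(\varphi^\circ)''(\sqrt u)=\int_{(0,\infty)}e^{-\lambda u}\,d\nu(\lambda),\qquad u\geq0,$$ then for all $(x,t)\in\mathbb{R}^{n-1}\times\mathbb{R}$ $$h_{Z_n^\circ}(x,t)=\int_{(0,\infty)}\int_{\mathbb{R}^{n-1}}\bigl|\langle x,z\rangle+t\bigr|\,d\gamma_{\lambda,n-1}(z)\,\frac{\sqrt\pi}{2\sqrt\lambda}\,d\nu(\lambda),$$ where $\gamma_{\lambda,n-1}$ is the centered Gaussian probability measure on $\mathbb{R}^{n-1}$ with density $z\mapsto(\lambda/\pi)^{(n-1)/2}e^{-\lambda|z|^2}$.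
   Context: Convex bodies in $\mathbb{R}^n$ are compact, convex, origin-symmetric sets with nonempty interior. The support function of $K$ is $h_K(u)=\max_{y\in K}\langle u,y\rangle$, and the polar body is $K^\circ=\{u\in\mathbb{R}^n: h_K(u)\leq 1\}$. A (centrally symmetric) zonotope is a set $\sum_{j=1}^N[-v_j,v_j]$ (Minkowski sum of segments, $v_j\in\mathbb{R}^n$). A zonoid is an origin-symmetric convex body that is a limit of zonotopes in the Hausdorff metric; equivalently, there is a finite even positive Borel measure $\mu$ on the unit sphere $\mathbb{S}^{n-1}$ with $h_Z(u)=\int_{\mathbb{S}^{n-1}}|\langle u,v\rangle|\,d\mu(v)$. The function $\varphi^\circ$ does not depend on $n$; explicitly $\varphi^\circ(s)=\sup_{q\in\mathbb{R}}\frac{1+sq}{\varphi(q)}$ with $\varphi(q)=e^{-q^2/\pi}+q\operatorname{erf}(q/\sqrt\pi)$ and $\operatorname{erf}(a)=\frac{2}{\sqrt\pi}\int_0^a e^{-r^2}\,dr$, and it is a smooth even function on $\mathbb{R}$. *)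

(* Defs.v *)
From HB Require Import structures.
From mathcomp Require Import all_boot all_order all_algebra.
From mathcomp Require Import all_classical all_reals all_analysis.
From mathcomp Require Import measurable_realfun.

Set Implicit Arguments.
Unset Strict Implicit.
Unset Printing Implicit Defensive.

Import Order.TTheory GRing.Theory Num.Theory.
Import numFieldNormedType.Exports.

Local Open Scope classical_set_scope.
Local Open Scope ring_scope.

Section convex_geometry.
Context {R : realType} {k : nat}.
Implicit Types (u v : 'rV[R]_k) (A B K Z W : set 'rV[R]_k).

Definition dot u v : R := \sum_(i < k) u 0 i * v 0 i.

(* The library norm on row vectors is the sup norm; metric notions below are
   Euclidean. *)
Definition enorm u : R := Num.sqrt (dot u u).

Definition convex_body K : Prop :=
  [/\ compact K, convex_set (K : set (convex_lmodType 'rV[R]_k)),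
      (forall y, K y -> K (- y)) & (interior K !=set0)].

(* A real supremum: it is the maximum when K is compact and nonempty. *)
Definition support_function K u : R := sup [set dot u y | y in K].

Definition polar K : set 'rV[R]_k := [set u | support_function K u <= 1].

Definition segment v : set 'rV[R]_k :=
  [set c *: v | c in [set c : R | -1 <= c <= 1]].

Definition zonotope W : Prop :=
  exists (N : nat) (v : 'I_N -> 'rV[R]_k),
    W = [set \sum_(j < N) w j |
           w in [set w : 'I_N -> 'rV[R]_k | forall j, segment (v j) (w j)]].

(* The least e such that A is in B + e D and B is in A + e D, with D the closed
   Euclidean unit ball (meaningful for nonempty bounded sets). *)
Definition hausdorff_dist A B : R :=
  inf [set e : R | [/\ 0 <= e,
    (forall a, A a -> exists2 b, B b & enorm (a - b) <= e) &
    (forall b, B b -> exists2 a, A a & enorm (b - a) <= e)]].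

Definition zonoid Z : Prop :=
  convex_body Z /\
  exists W : nat -> set 'rV[R]_k,
    (forall j, zonotope (W j)) /\
    hausdorff_dist (W j) Z @[j --> \oo] --> (0 : R).

End convex_geometry.

(* The library equips k-tuples, not row vectors, with the product
   sigma-algebra: measures on R^k live on tuples, and vec reads a tuple as a
   row vector. *)
Notation Rtuple R k := (k.-tuple (measurableTypeR R)).

Definition vec {R : realType} {k : nat} (z : Rtuple R k) : 'rV[R]_k :=
  \row_(i < k) tnth z i.

Section lebesgue_tuple.
Context {R : realType}.

Definition tuple_cons {k} (p : (measurableTypeR R * Rtuple R k)%type) : Rtuple R k.+1 :=
  [tuple of p.1 :: p.2].

Fixpoint lebesgue_tuple (k : nat) : set (Rtuple R k) -> \bar R :=
  match k with
  | 0 => dirac [tuple]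
  | k'.+1 => pushforward
      (product_measure1 (lebesgue_measure : set (measurableTypeR R) -> \bar R)
        (@lebesgue_tuple k')) tuple_cons
  end.

Lemma measurable_tuple_cons k : measurable_fun setT (@tuple_cons k).
Proof. by apply: measurable_cons. Qed.

(* Canonical inference does not find the library's sigma-finite instance of a
   product measure. *)
Lemma product_measure1_sigma_finite k
    (m1 : {sigma_finite_measure set (measurableTypeR R) -> \bar R})
    (m2 : {sigma_finite_measure set (Rtuple R k) -> \bar R}) :
  sigma_finite setT (product_measure1 m1 m2).
Proof.
have /sigma_finiteP[F [TF ndF Foo]] := sigma_finiteT m1.
have /sigma_finiteP[G [TG ndG Goo]] := sigma_finiteT m2.
exists (fun n => F n `*` G n) => [|n].
  rewrite -setXTT TF TG predeqE => -[x y]; split.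
    move=> [/= [n _ Fnx] [p _ Gpy]]; exists (maxn n p) => //; split.
    - by move: x Fnx; exact/subsetPset/ndF/leq_maxl.
    - by move: y Gpy; exact/subsetPset/ndG/leq_maxr.
  by move=> [n _ []/= ? ?]; split; exists n.
have [? ?] := Foo n; have [? ?] := Goo n.
split; first exact: measurableX.
by rewrite product_measure1E// lte_mul_pinfty// ge0_fin_numE.
Qed.

Lemma pushforward_tuple_cons_sigma_finite k
    (m : set (measurableTypeR R * Rtuple R k)%type -> \bar R) :
  sigma_finite setT m -> sigma_finite setT (pushforward m (@tuple_cons k)).
Proof.
move=> [F UF mF].
pose g (t : Rtuple R k.+1) : (measurableTypeR R * Rtuple R k)%type :=
  (tnth t ord0, [tuple of behead t]).
have mg : measurable_fun setT g.
  apply: measurable_fun_pair; first exact: measurable_tnth.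
  exact: measurable_behead.
have gK : cancel (@tuple_cons k) g.
  by case=> a t; congr pair; apply/val_inj.
exists (fun i => g @^-1` F i) => [|i].
  by rewrite -preimage_bigcup -UF preimage_setT.
have [mFi Foo] := mF i; split; first by rewrite -[_ @^-1` _]setTI; exact: mg.
rewrite /pushforward (_ : _ @^-1` _ = F i)//.
by apply/seteqP; split=> p /=; rewrite gK.
Qed.

Section sigma_finite_measure_of.
Context d (T : measurableType d) (m : {measure set T -> \bar R}).
Hypothesis mfin : sigma_finite setT m.

Let mu of sigma_finite setT m : set T -> \bar R := m.

HB.instance Definition _ := Measure.copy (mu mfin) m.
HB.instance Definition _ := Measure_isSigmaFinite.Build _ _ _ (mu mfin) mfin.

Lemma sigma_finite_measure_of : exists m' : {sigma_finite_measure set T -> \bar R},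
  (m' : set T -> \bar R) = m.
Proof. by exists (mu mfin). Qed.

End sigma_finite_measure_of.

Lemma lebesgue_tuple_measure k :
  exists m : {sigma_finite_measure set (Rtuple R k) -> \bar R},
    (m : set (Rtuple R k) -> \bar R) = @lebesgue_tuple k.
Proof.
elim: k => [|k [m mE]].
  by exists (dirac [tuple] : {sigma_finite_measure set (Rtuple R 0) -> \bar R}).
pose l : {sigma_finite_measure set (measurableTypeR R) -> \bar R} :=
  lebesgue_measure.
pose p : {measure set (measurableTypeR R * Rtuple R k)%type -> \bar R} :=
  product_measure1 l m.
pose q : {measure set (Rtuple R k.+1) -> \bar R} :=
  measure_function_pushforward__canonical__measure_function_Measure
    p (@measurable_tuple_cons k).
have [q' q'E] := sigma_finite_measure_of
  (pushforward_tuple_cons_sigma_finite (product_measure1_sigma_finite l m) :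
    sigma_finite setT q).
by exists q'; rewrite q'E /= -mE.
Qed.

Section lebesgue_tuple_instance.
Variable k : nat.

Let lebesgue_tuple0 : lebesgue_tuple (set0 : set (Rtuple R k)) = 0%E.
Proof. by have [m <-] := lebesgue_tuple_measure k. Qed.

Let lebesgue_tuple_ge0 (A : set (Rtuple R k)) : (0 <= lebesgue_tuple A)%E.
Proof. by have [m <-] := lebesgue_tuple_measure k. Qed.

Let lebesgue_tuple_sigma_additive : semi_sigma_additive (@lebesgue_tuple k).
Proof.
by have [m <-] := lebesgue_tuple_measure k; exact: measure_semi_sigma_additive.
Qed.

HB.instance Definition _ := isMeasure.Build _ _ _ (@lebesgue_tuple k)
  lebesgue_tuple0 lebesgue_tuple_ge0 lebesgue_tuple_sigma_additive.

Let lebesgue_tuple_sigma_finite : sigma_finite setT (@lebesgue_tuple k).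
Proof. by have [m <-] := lebesgue_tuple_measure k; exact: sigma_finiteT. Qed.

HB.instance Definition _ := Measure_isSigmaFinite.Build _ _ _ (@lebesgue_tuple k)
  lebesgue_tuple_sigma_finite.

End lebesgue_tuple_instance.

End lebesgue_tuple.

Section gaussian.
Context {R : realType}.

(* A normal law on the line may be degenerate, i.e. a point mass; the library
   gives normal_prob a different meaning at standard deviation 0. *)
Definition normal_law (m s : R) : set (measurableTypeR R) -> \bar R :=
  if s == 0 then dirac m else normal_prob m s.

Definition gaussian_vector d (T : measurableType d) (P : probability T R)
    k (X : {RV P >-> Rtuple R k}) : Prop :=
  forall a : 'rV[R]_k, exists m s : R, 0 <= s /\
    forall A : set (measurableTypeR R), measurable A ->
      P ((fun w => dot a (vec (X w))) @^-1` A) = normal_law m s A.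

Definition centered_vector d (T : measurableType d) (P : probability T R)
    k (X : {RV P >-> Rtuple R k}) : Prop :=
  forall i : 'I_k, ('E_P[fun w => tnth (X w) i] = 0)%E.

Definition has_covariance_matrix d (T : measurableType d) (P : probability T R)
    k (X : {RV P >-> Rtuple R k}) (S : 'M[R]_k) : Prop :=
  forall i j : 'I_k,
    covariance P (fun w => tnth (X w) i) (fun w => tnth (X w) j) = (S i j)%:E.

Definition gaussian_density (lambda : R) k (z : Rtuple R k) : R :=
  ((lambda / pi) `^ (k%:R / 2)) * expR (- (lambda * enorm (vec z) ^+ 2)).

Definition gaussian_measure (lambda : R) k (A : set (Rtuple R k)) : \bar R :=
  \int[@lebesgue_tuple R k]_(z in A) (gaussian_density lambda z)%:E.

Lemma gaussian_density_ge0 lambda k (z : Rtuple R k) :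
  0 <= gaussian_density lambda z.
Proof. by rewrite mulr_ge0 ?powR_ge0 ?expR_ge0. Qed.

Lemma measurable_gaussian_density lambda k :
  measurable_fun setT (@gaussian_density lambda k).
Proof.
apply: measurable_funM => //; apply: measurableT_comp => //.
apply: measurableT_comp => //; apply: measurable_funM => //.
rewrite (_ : (fun _ => _) =
    (fun z : Rtuple R k => \sum_(i < k) tnth z i * tnth z i)).
  by apply: measurable_sum => i; apply: measurable_funM; exact: measurable_tnth.
apply/funext => z; rewrite sqr_sqrtr; last first.
  by apply: sumr_ge0 => i _; rewrite -expr2 sqr_ge0.
by apply: eq_bigr => i _; rewrite mxE.
Qed.

Section gaussian_measure_instance.
Variables (lambda : R) (k : nat).

Let gaussian_measure0 : gaussian_measure lambda (set0 : set (Rtuple R k)) = 0%E.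
Proof. by rewrite /gaussian_measure integral_set0. Qed.

Let gaussian_measure_ge0 (A : set (Rtuple R k)) :
  (0 <= gaussian_measure lambda A)%E.
Proof. by apply: integral_ge0 => z _; rewrite lee_fin gaussian_density_ge0. Qed.

Let gaussian_measure_sigma_additive :
  semi_sigma_additive (@gaussian_measure lambda k).
Proof.
move=> /= A mA tA mUA; rewrite /gaussian_measure ge0_integral_bigcup//=.
- apply: is_cvg_ereal_nneg_natsum_cond => n _ _.
  by apply: integral_ge0 => z _; rewrite lee_fin gaussian_density_ge0.
- apply: measurable_funTS; apply/measurable_EFinP.
  exact: measurable_gaussian_density.
- by move=> z _; rewrite lee_fin gaussian_density_ge0.
Qed.

HB.instance Definition _ := isMeasure.Build _ _ _ (@gaussian_measure lambda k)
  gaussian_measure0 gaussian_measure_ge0 gaussian_measure_sigma_additive.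

End gaussian_measure_instance.

End gaussian.

(* Main.v *)
(* Write phi for [gauss_abs] and F = phi° for [polar_profile].  By homogeneity
   h_Z(x, t) = |x| phi(t / |x|) and h_{Z°}(x, t) = |x| F(t / |x|).  Parametrising F by the
   point p where the supremum is attained gives s = phi'(p) exp (p ^ 2 / pi) and
   F(s) = exp (p ^ 2 / pi).

   The function s |-> (2 l)^-1 phi (s sqrt (pi l)) has second derivative exp (- l s ^ 2),
   so everything rests on the complete monotonicity of G(u) = F''(sqrt u).  In place
   of Bernstein's theorem: with w(u) = 1 / F(sqrt u) and r(u) = 1 / phi(p), one has
   G = (pi / 2) r ^ 3 w ^ 2, the derivative of 1 / w at u is half the average over
   v in [0, 1] of G(u v ^ 2), and that of 1 / r is (pi / 4) r w ^ 2.  Solving this system by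
   iteration preserves uniform limits of positive exponential sums and contracts a
   weighted norm, so G is such a limit on every [0, U].  Integrating twice, F is a
   limit of functions k + sum c_i phi(l_i s).  Simple functions approximate each term by
   sums of |<u, v_j>|, and nearest points turn closeness of support functions into
   Hausdorff closeness.  The integral formula follows from Tonelli's theorem applied
   to F(s) - s = int_s^oo (r - s) F''(r) dr. *)
From HB Require Import structures.
Require Import Defs.
From mathcomp Require Import all_boot all_order all_algebra.
From mathcomp Require Import all_classical all_reals all_analysis.
From mathcomp Require Import measurable_realfun ring lra.

Set Implicit Arguments.
Unset Strict Implicit.
Unset Printing Implicit Defensive.

Import Order.TTheory GRing.Theory Num.Theory.
Import numFieldNormedType.Exports.

Local Open Scope classical_set_scope.
Local Open Scope ring_scope.

(** Positivity survives the iteration because a primitive of an exponential sum that equals 1 at 0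
    has the form C - h, with h again an exponential sum and h 0 < C; its reciprocal is then a
    geometric series with nonnegative terms. The right-hand sides of the system are products and
    averages of r and w with positive coefficients, which is why the unknowns are reciprocals rather
    than F and phi.

    The obstacle lies at infinity. G is approximated on bounded intervals only, and a term of tiny
    rate l, nearly invisible there, acquires the factor (2 l)^-1 after two integrations. Every rate
    is therefore raised by 1 / U: on the range that matters this multiplies the sum by a factor
    close to 1, and it bounds the value Q 0 of the approximant Q. Since Q - s Q' stays between 0 and
    Q 0, the slope of Q can then grow only little far out. Errors are measured relative to 1 + |s|,
    so at infinity only slopes have to match.

    The zonoid claim is thus reached without any representing measure; nu enters only in the
    integral formula. *)

(** * Pointwise derivatives and monotonicity *)

Section pointwise_derivatives.
Context {R : realType}.
Implicit Types (f g : R -> R) (x a b : R).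

Lemma is_derive_cast f x a b : is_derive x 1 f a -> a = b -> is_derive x 1 f b.
Proof. by move=> ? <-. Qed.

Lemma is_derive_add f g x a b : is_derive x 1 f a -> is_derive x 1 g b ->
  is_derive x 1 (fun y => f y + g y) (a + b).
Proof. exact: is_deriveD. Qed.

Lemma is_derive_sub f g x a b : is_derive x 1 f a -> is_derive x 1 g b ->
  is_derive x 1 (fun y => f y - g y) (a - b).
Proof. exact: is_deriveB. Qed.

Lemma is_derive_opp f x a : is_derive x 1 f a ->
  is_derive x 1 (fun y => - f y) (- a).
Proof. exact: is_deriveN. Qed.

Lemma is_derive_mul f g x a b : is_derive x 1 f a -> is_derive x 1 g b ->
  is_derive x 1 (fun y => f y * g y) (a * g x + f x * b).
Proof.
move=> fa gb; have := is_deriveM fa gb.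
by rewrite addrC /GRing.scale/= [g x * a]mulrC.
Qed.

Lemma is_derive_const x a : is_derive x 1 (fun=> a) (0 : R).
Proof. exact: is_derive_cst. Qed.

Lemma is_derive_idfun x : is_derive x 1 (fun y : R => y) (1 : R).
Proof. exact: is_derive_id. Qed.

Lemma is_derive_mull f x a b : is_derive x 1 f a ->
  is_derive x 1 (fun y => b * f y) (b * a).
Proof.
move=> fa; apply: (is_derive_cast (is_derive_mul (is_derive_const _ b) fa)).
by rewrite mul0r add0r.
Qed.

Lemma is_derive_compose f g x a b : is_derive (g x) 1 f a -> is_derive x 1 g b ->
  is_derive x 1 (fun y => f (g y)) (a * b).
Proof. exact: is_derive1_comp. Qed.

Lemma is_derive_inv f x a : f x != 0 -> is_derive x 1 f a ->
  is_derive x 1 (fun y => (f y)^-1) (- a / f x ^+ 2).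
Proof.
move=> fx fa; apply: (is_derive_cast (is_deriveV fx fa)).
by rewrite mulNr mulrC -mulNr.
Qed.

Lemma is_derive_exp f x a : is_derive x 1 f a ->
  is_derive x 1 (fun y => expR (f y)) (expR (f x) * a).
Proof. by move=> fa; exact: is_derive_compose. Qed.

Lemma is_derive_continuous f x a : is_derive x 1 f a -> {for x, continuous f}.
Proof. by move=> [fx _]; exact/differentiable_continuous/derivable1_diffP. Qed.

Lemma is_derive_sqrt x : 0 < x -> is_derive x 1 Num.sqrt (2 * Num.sqrt x)^-1.
Proof.
move=> x0; have s0 : 0 < Num.sqrt x by rewrite sqrtr_gt0.
rewrite -{1}(sqr_sqrtr (ltW x0)).
apply: (@is_derive_inverse _ (fun y => y ^+ 2) Num.sqrt).
- near=> y; rewrite sqrtr_sqr ger0_norm// ltW//; near: y.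
  exact: lt_nbhsr.
- near=> y; exact: exprn_continuous.
- apply: (is_derive_cast (is_derive_mul (is_derive_idfun _) (is_derive_idfun _))).
  by rewrite mul1r mulr1 mulr2n mulrDl mul1r.
- by rewrite mulf_neq0// gt_eqF.
Unshelve. all: end_near. Qed.

(* [f] need only be continuous at the end points. *)
Lemma ge0_is_derive_le f (df : R -> R) a b : a <= b ->
  (forall x, a < x < b -> is_derive x 1 f (df x)) ->
  {within `[a, b], continuous f} ->
  (forall x, a < x < b -> 0 <= df x) -> f a <= f b.
Proof.
move=> ab fdf cf df0; rewrite le_eqVlt in ab.
case/orP: ab => [/eqP->//|ab].
have fdf' x : x \in `]a, b[ -> is_derive x 1 f (df x) by rewrite in_itv; exact: fdf.
have [c cab e] := MVT ab fdf' cf.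
by rewrite -subr_ge0 e mulr_ge0 ?subr_ge0 ?(ltW ab)// df0.
Qed.

Lemma ge0_is_derive_le_everywhere f (df : R -> R) a b : a <= b ->
  (forall x, a <= x <= b -> is_derive x 1 f (df x)) ->
  (forall x, a < x < b -> 0 <= df x) -> f a <= f b.
Proof.
move=> ab fdf; apply: (ge0_is_derive_le ab).
  by move=> x /andP[ax xb]; apply: fdf; rewrite !ltW.
apply/continuous_in_subspaceT => x; rewrite inE/= in_itv/= => /fdf.
exact: is_derive_continuous.
Qed.

End pointwise_derivatives.

(** * The Gaussian exponential and its primitive *)

Section gaussian_primitive.
Context {R : realType}.
Implicit Types q p s : R.

Definition gauss_exp q : R := expR (- (q ^+ 2 / pi)).

Let sd : R := Num.sqrt (pi / 2).

Let sd_gt0 : 0 < sd. Proof. by rewrite sqrtr_gt0 divr_gt0 ?pi_gt0. Qed.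

Let sd_neq0 : sd != 0. Proof. exact: lt0r_neq0. Qed.

Let sd2 : sd ^+ 2 = pi / 2.
Proof. by rewrite sqr_sqrtr// divr_ge0 ?pi_ge0. Qed.

Lemma gauss_exp_gt0 q : 0 < gauss_exp q. Proof. exact: expR_gt0. Qed.

Lemma gauss_expN q : gauss_exp (- q) = gauss_exp q.
Proof. by rewrite /gauss_exp sqrrN. Qed.

Lemma gauss_exp0 : gauss_exp 0 = 1.
Proof. by rewrite /gauss_exp expr0n mul0r oppr0 expR0. Qed.

Lemma normal_pdf_gauss_exp q : normal_pdf 0 sd q = pi^-1 * gauss_exp q.
Proof.
have sd22 : sd ^+ 2 *+ 2 = pi by rewrite sd2 -mulrnAl -(mulr_natr pi) mulfK.
rewrite normal_pdfE// /normal_peak /normal_fun -mulrnAl sd22 subr0.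
by rewrite -expr2 sqrtr_sqr ger0_norm ?pi_ge0// /gauss_exp mulNr.
Qed.

Let cdf0 q : R := fine (normal_prob 0 sd `]-oo, q]).

Let is_derive_cdf0 q : is_derive q 1 cdf0 (pi^-1 * gauss_exp q).
Proof.
have [] := @continuous_FTC1 _ (normal_pdf 0 sd) -oo%O q (q + 1) _ _ _ _.
- by rewrite ltrDl.
- apply: (integrableS _ _ (subsetT _)) => //.
  exact: integrable_normal_pdf.
- by rewrite ltNyr.
- exact: continuous_normal_pdf.
- move=> dq eq; apply: DeriveDef => //.
  by rewrite -normal_pdf_gauss_exp -eq derive1E.
Qed.

(** This is erf (q / sqrt pi). Written through the distribution function of the centered normal law
    of variance pi / 2, it inherits its limit 1 at infinity from the limits of that function. *)
Definition gauss_erf q : R := cdf0 q - cdf0 (- q).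

Lemma is_derive_gauss_erf q :
  is_derive q 1 gauss_erf (2 / pi * gauss_exp q).
Proof.
have dN := is_derive_opp (is_derive_idfun q).
have d := is_derive_sub (is_derive_cdf0 q)
  (is_derive_compose (is_derive_cdf0 (- q)) dN).
apply: (is_derive_cast d).
by rewrite gauss_expN; ring.
Qed.

Lemma gauss_erfN q : gauss_erf (- q) = - gauss_erf q.
Proof. by rewrite /gauss_erf opprK opprB. Qed.

Lemma gauss_erf0 : gauss_erf 0 = 0.
Proof. by rewrite /gauss_erf oppr0 subrr. Qed.

(** The identity, viewed as a random variable under [normal_prob], turns [cdf0] into a [cdf], whose
    limits are known. *)
Let idR : measurableTypeR R -> R := idfun.

#[local] HB.instance Definition _ :=
  @isMeasurableFun.Build _ _ _ _ idR (@measurable_id _ _ setT).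

Let cdf0E q : (cdf0 q)%:E = cdf (idR : {RV normal_prob 0 sd >-> R}) q.
Proof. by rewrite fineK// fin_num_measure. Qed.

Let cvg_cdf0 : cdf0 q @[q --> +oo] --> (1 : R).
Proof.
have := cvg_cdfy1 (idR : {RV normal_prob 0 sd >-> R}).
rewrite (_ : cdf _ = EFin \o cdf0); last by apply/funext => q; rewrite /= cdf0E.
by move=> /fine_cvgP[_].
Qed.

Let cvg_cdf0N : cdf0 (- q) @[q --> +oo] --> (0 : R).
Proof.
have := cvg_cdfNy0 (idR : {RV normal_prob 0 sd >-> R}).
rewrite (_ : cdf _ = EFin \o cdf0); last by apply/funext => q; rewrite /= cdf0E.
by move=> /fine_cvgP[_]; rewrite cvgNy_compNP.
Qed.

Lemma gauss_erf_cvg : gauss_erf q @[q --> +oo] --> (1 : R).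
Proof. by rewrite -[1]subr0; exact: cvgB. Qed.

End gaussian_primitive.

(** * The function phi: convexity and growth *)

Section gaussian_absolute_value.
Context {R : realType}.
Implicit Types q p s : R.

Definition gauss_abs q : R := gauss_exp q + q * gauss_erf q.

Lemma is_derive_gauss_exp q :
  is_derive q 1 gauss_exp (- (2 / pi * q * gauss_exp q)).
Proof.
have d := is_derive_exp (is_derive_opp (is_derive_mull pi^-1
  (is_derive_mul (is_derive_idfun q) (is_derive_idfun q)))).
rewrite (_ : gauss_exp = fun y => expR (- (pi^-1 * (y * y)))).
  by apply: (is_derive_cast d); ring.
by apply/funext => y; rewrite /gauss_exp expr2 mulrC.
Qed.

(** The derivative of [gauss_exp] cancels the term q * erf' of the product rule. *)
Lemma is_derive_gauss_abs q : is_derive q 1 gauss_abs (gauss_erf q).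
Proof.
apply: (is_derive_cast (is_derive_add (is_derive_gauss_exp q)
  (is_derive_mul (is_derive_idfun q) (is_derive_gauss_erf q)))).
by ring.
Qed.

Lemma gauss_absN q : gauss_abs (- q) = gauss_abs q.
Proof. by rewrite /gauss_abs gauss_expN gauss_erfN mulrNN. Qed.

Lemma gauss_abs0 : gauss_abs 0 = 1.
Proof. by rewrite /gauss_abs gauss_exp0 mul0r addr0. Qed.

Let c_gt0 : 0 < 2 / pi :> R.
Proof. by rewrite divr_gt0 ?pi_gt0. Qed.

Lemma gauss_erf_le p q : p <= q -> gauss_erf p <= gauss_erf q.
Proof.
move=> pq; apply: (ge0_is_derive_le_everywhere pq) => x _.
  exact: is_derive_gauss_erf.
by rewrite mulr_ge0 ?ltW ?gauss_exp_gt0.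
Qed.

Lemma gauss_erf_ge0 q : 0 <= q -> 0 <= gauss_erf q.
Proof. by move=> q0; rewrite -(@gauss_erf0 R) gauss_erf_le. Qed.

Lemma gauss_erf_le1 q : gauss_erf q <= 1.
Proof.
have := @gauss_erf_cvg R; move=> /cvg_lim <- //.
apply: limr_ge; first by apply/cvg_ex; exists 1; exact: gauss_erf_cvg.
by near=> x; apply: gauss_erf_le; near: x; apply: nbhs_pinfty_ge; exact: num_real.
Unshelve. all: end_near. Qed.

(** Convexity: the derivative [gauss_erf] is nondecreasing. The tangent at p has intercept phi(p) -
    p phi'(p) = [gauss_exp p]. *)
Lemma gauss_abs_tangent p q : gauss_exp p + gauss_erf p * q <= gauss_abs q.
Proof.
pose D x := gauss_abs x - gauss_erf p * x.
have dD (x : R) : is_derive x 1 D (gauss_erf x - gauss_erf p).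
  apply: (is_derive_cast (is_derive_sub (is_derive_gauss_abs x)
    (is_derive_mull (gauss_erf p) (is_derive_idfun x)))).
  by rewrite mulr1.
rewrite -lerBrDr; have -> : gauss_exp p = D p by rewrite /D /gauss_abs; ring.
have [pq|/ltW qp] := leP p q.
  apply: (ge0_is_derive_le_everywhere pq) => // x /andP[px _].
  by rewrite subr_ge0 gauss_erf_le// ltW.
rewrite -lerN2; pose DN x := - D x.
apply: (@ge0_is_derive_le_everywhere _ DN _ _ _ qp).
by move=> x /andP[_ xp]; rewrite oppr_ge0 subr_le0 gauss_erf_le// ltW.
Qed.

Lemma gauss_abs_ge1 q : 1 <= gauss_abs q.
Proof.
by have := gauss_abs_tangent 0 q; rewrite gauss_exp0 gauss_erf0 mul0r addr0.
Qed.

Lemma gauss_abs_gt0 q : 0 < gauss_abs q.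
Proof. by rewrite (lt_le_trans ltr01)// gauss_abs_ge1. Qed.

(** Let the contact point of the tangent go to infinity: its slope tends to 1 and its intercept is
    positive. *)
Lemma gauss_abs_ge q : `|q| <= gauss_abs q.
Proof.
wlog q0 : q / 0 <= q => [H|].
  have [/H//|/ltW q0] := leP 0 q.
  by rewrite -gauss_absN -normrN H// oppr_ge0.
rewrite ger0_norm//.
have cq : gauss_erf x * q @[x --> +oo] --> q.
  by rewrite -[X in _ --> X]mul1r; apply: cvgMl; exact: gauss_erf_cvg.
rewrite -[leLHS](cvg_lim _ cq)//; apply: limr_le; first by apply/cvg_ex; exists q.
near=> x; apply: le_trans (gauss_abs_tangent x q).
by rewrite lerDr ltW// gauss_exp_gt0.
Unshelve. all: end_near. Qed.

Lemma gauss_exp_le1 q : gauss_exp q <= 1.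
Proof.
by rewrite -[leRHS]expR0 ler_expR oppr_le0 divr_ge0 ?sqr_ge0 ?pi_ge0.
Qed.

Lemma gauss_abs_le q : gauss_abs q <= 1 + `|q|.
Proof.
wlog q0 : q / 0 <= q => [H|].
  have [/H//|/ltW q0] := leP 0 q.
  by rewrite -gauss_absN -normrN H// oppr_ge0.
rewrite lerD ?gauss_exp_le1// ger0_norm// -[leRHS]mulr1 ler_wpM2l//.
exact: gauss_erf_le1.
Qed.

End gaussian_absolute_value.

(** * The polar profile F and its first two derivatives *)

Section polar_profile.
Context {R : realType}.
Implicit Types q p s : R.

(** The tangent to phi at p is [gauss_exp p] * (1 + s q) for exactly this s. Hence 1 + s q is the
    tangent multiplied by ([gauss_exp p])^-1, which makes that factor the supremum of (1 + s q) /
    phi(q), attained at p. *)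
Definition touching_slope p : R := gauss_erf p / gauss_exp p.

Let c_gt0 : 0 < 2 / pi :> R.
Proof. by rewrite divr_gt0 ?pi_gt0. Qed.

Let pi_neq0 : (pi : R) != 0. Proof. by rewrite gt_eqF// pi_gt0. Qed.

Lemma is_derive_touching_slope p :
  is_derive p 1 touching_slope (2 / pi * (gauss_abs p / gauss_exp p)).
Proof.
have e0 : gauss_exp p != 0 by rewrite gt_eqF// gauss_exp_gt0.
apply: (is_derive_cast (is_derive_mul (is_derive_gauss_erf p)
  (is_derive_inv e0 (is_derive_gauss_exp p)))).
by rewrite /gauss_abs; move: pi_neq0; move: pi => P P0; field; rewrite e0.
Qed.

Lemma touching_slopeN p : touching_slope (- p) = - touching_slope p.
Proof. by rewrite /touching_slope gauss_erfN gauss_expN mulNr. Qed.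

Lemma touching_slope_lt p q : p < q -> touching_slope p < touching_slope q.
Proof.
move=> pq; rewrite -subr_gt0.
have dS (x : R) : x \in `]p, q[ ->
    is_derive x 1 touching_slope (2 / pi * (gauss_abs x / gauss_exp x)).
  by move=> _; exact: is_derive_touching_slope.
have [|x _ ->] := MVT pq dS.
  apply: continuous_subspaceT => x.
  exact: is_derive_continuous (is_derive_touching_slope x).
by rewrite mulr_gt0 ?subr_gt0// mulr_gt0// divr_gt0// ?gauss_abs_gt0 ?gauss_exp_gt0.
Qed.

Lemma touching_slope_inj : injective touching_slope.
Proof.
move=> p q e; apply/eqP; case: ltgtP => // /touching_slope_lt; rewrite e ltxx//.
Qed.

(** The derivative 2 / pi * phi / [gauss_exp] is at least 2 / pi. The resulting growth is what makes
    [touching_slope] onto. *)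
Lemma touching_slope_ge p : 0 <= p -> 2 / pi * p <= touching_slope p.
Proof.
move=> p0; pose D x : R := touching_slope x - 2 / pi * x.
have -> : (2 / pi * p <= touching_slope p) = (D 0 <= D p).
  rewrite /D /touching_slope gauss_erf0 mul0r mulr0 subrr.
  by rewrite subr_ge0.
apply: (@ge0_is_derive_le_everywhere _ D
  (fun x => 2 / pi * (gauss_abs x / gauss_exp x) - 2 / pi) _ _ p0).
  move=> x _; apply: (is_derive_cast (is_derive_sub
    (is_derive_touching_slope x) (is_derive_mull (2 / pi) (is_derive_idfun x)))).
  by rewrite mulr1.
move=> x _; rewrite subr_ge0 -[leLHS]mulr1 ler_wpM2l ?(ltW c_gt0)//.
rewrite ler_pdivlMr ?gauss_exp_gt0// mul1r.
by rewrite (le_trans (gauss_exp_le1 x))// gauss_abs_ge1.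
Qed.

Lemma touching_slope_surj s : exists p, touching_slope p = s.
Proof.
wlog s0 : s / 0 <= s => [H|].
  have [/H//|/ltW s0] := leP 0 s.
  have [|p pE] := H (- s); first by rewrite oppr_ge0.
  by exists (- p); rewrite touching_slopeN pE opprK.
have p0 : 0 <= s / (2 / pi) by rewrite divr_ge0// ltW.
have S0 : touching_slope 0 = 0 by rewrite /touching_slope gauss_erf0 mul0r.
have Ss : s <= touching_slope (s / (2 / pi)).
  by rewrite (le_trans _ (touching_slope_ge p0))// mulrC divfK// gt_eqF.
have [||p _ pE] := @IVT _ touching_slope 0 (s / (2 / pi)) s p0.
- apply: continuous_subspaceT => x.
  exact: is_derive_continuous (is_derive_touching_slope x).
- by rewrite S0 ge_min s0 le_max Ss orbT.
- by exists p.
Qed.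

(** The inverse of [touching_slope]; the default 0 is never taken, as that function is onto. *)
Definition touching_point s : R := xget 0 [set p | touching_slope p = s].

Lemma touching_pointK : cancel touching_point touching_slope.
Proof.
move=> s; rewrite /touching_point; case: xgetP => [p _ //|noP].
by have [p /noP] := touching_slope_surj s.
Qed.

Lemma touching_slopeK : cancel touching_slope touching_point.
Proof. by move=> p; apply: touching_slope_inj; rewrite touching_pointK. Qed.

Lemma touching_pointN s : touching_point (- s) = - touching_point s.
Proof.
by apply: touching_slope_inj; rewrite touching_slopeN !touching_pointK.
Qed.

Lemma touching_point0 : touching_point 0 = 0.
Proof.
by apply: touching_slope_inj; rewrite touching_pointK /touching_slope gauss_erf0 mul0r.
Qed.

Lemma touching_point_lt s t : s < t -> touching_point s < touching_point t.
Proof.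
move=> st; rewrite ltNge; apply/negP; rewrite le_eqVlt.
case/predU1P=> [/(congr1 touching_slope)|/touching_slope_lt];
  rewrite !touching_pointK => h; first by rewrite h ltxx in st.
by have := lt_trans h st; rewrite ltxx.
Qed.

Lemma touching_point_ge0 s : 0 <= s -> 0 <= touching_point s.
Proof.
by rewrite le_eqVlt => /predU1P[<-|/touching_point_lt/ltW]; rewrite touching_point0.
Qed.

Lemma is_derive_touching_point s (p := touching_point s) :
  is_derive s 1 touching_point (pi / 2 * (gauss_exp p / gauss_abs p)).
Proof.
have dS := is_derive_touching_slope p.
have l0 : 2 / pi * (gauss_abs p / gauss_exp p) != 0.
  by rewrite gt_eqF// mulr_gt0// divr_gt0 ?gauss_abs_gt0 ?gauss_exp_gt0.
have := @is_derive_inverse _ touching_slope touching_point _ p _ _ dS l0.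
rewrite touching_pointK => H; apply: (is_derive_cast (H _ _)).
- by near=> x; exact: touching_slopeK.
- near=> x; exact: is_derive_continuous (is_derive_touching_slope x).
- by rewrite invfM !invf_div.
Unshelve. all: end_near. Qed.

Definition polar_profile s : R := (gauss_exp (touching_point s))^-1.

(** Envelope formula: only the explicit s of (1 + s q) / phi(q) contributes at the maximiser q =
    p. *)
Lemma is_derive_polar_profile s (p := touching_point s) :
  is_derive s 1 polar_profile (p / gauss_abs p).
Proof.
have e0 : gauss_exp p != 0 by rewrite gt_eqF// gauss_exp_gt0.
apply: (is_derive_cast (is_derive_compose
  (is_derive_inv e0 (is_derive_gauss_exp p)) (is_derive_touching_point s))).
rewrite -/p; have a0 : gauss_abs p != 0 by rewrite gt_eqF// gauss_abs_gt0.
by move: pi_neq0; move: pi => P P0; field; rewrite e0 a0.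
Qed.

Definition polar_curvature s : R :=
  let p := touching_point s in pi / 2 * (gauss_exp p ^+ 2 / gauss_abs p ^+ 3).

Definition polar_slope s : R := touching_point s / gauss_abs (touching_point s).

Lemma is_derive_polar_slope s : is_derive s 1 polar_slope (polar_curvature s).
Proof.
pose p := touching_point s.
have a0 : gauss_abs p != 0 by rewrite gt_eqF// gauss_abs_gt0.
apply: (is_derive_cast (is_derive_compose (is_derive_mul (is_derive_idfun p)
  (is_derive_inv a0 (is_derive_gauss_abs p))) (is_derive_touching_point s))).
rewrite /polar_curvature -/p.
have -> : gauss_exp p = gauss_abs p - p * gauss_erf p by rewrite addrK.
by move: pi_neq0; move: pi => P P0; field.
Qed.

Lemma polar_profileN s : polar_profile (- s) = polar_profile s.
Proof. by rewrite /polar_profile touching_pointN gauss_expN. Qed.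

Lemma polar_profile0 : polar_profile 0 = 1.
Proof. by rewrite /polar_profile touching_point0 gauss_exp0 invr1. Qed.

Lemma polar_slope0 : polar_slope 0 = 0.
Proof. by rewrite /polar_slope touching_point0 mul0r. Qed.

Lemma polar_curvatureN s : polar_curvature (- s) = polar_curvature s.
Proof. by rewrite /polar_curvature touching_pointN gauss_absN gauss_expN. Qed.

Lemma polar_profile_ge1 s : 1 <= polar_profile s.
Proof. by rewrite /polar_profile invf_ge1 ?gauss_exp_gt0// gauss_exp_le1. Qed.

Lemma polar_profile_gt0 s : 0 < polar_profile s.
Proof. by rewrite (lt_le_trans ltr01)// polar_profile_ge1. Qed.

(** F(s) = (1 + s p) / phi(p) and F'(s) = p / phi(p). The difference tends to 0 at infinity, as the
    tail integral of F'' requires. *)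
Lemma polar_profile_legendre s :
  polar_profile s - s * polar_slope s = (gauss_abs (touching_point s))^-1.
Proof.
rewrite -{2}[s]touching_pointK /polar_profile /polar_slope /touching_slope.
move: (touching_point s) => p.
have a0 : gauss_abs p != 0 by rewrite gt_eqF// gauss_abs_gt0.
have e0 : gauss_exp p != 0 by rewrite gt_eqF// gauss_exp_gt0.
have eE : gauss_exp p = gauss_abs p - p * gauss_erf p by rewrite addrK.
by rewrite eE in e0 *; field; rewrite a0.
Qed.

Lemma polar_profile_ge s : `|s| <= polar_profile s.
Proof.
rewrite -[s in X in X <= _]touching_pointK /touching_slope /polar_profile.
move: (touching_point s) => p.
rewrite normrM normfV (gtr0_norm (gauss_exp_gt0 p)).
rewrite ler_piMl ?invr_ge0 ?(ltW (gauss_exp_gt0 _))// ler_norml gauss_erf_le1.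
by rewrite lerNl -gauss_erfN gauss_erf_le1.
Qed.

(** Together with [polar_profile_touch], this identifies [polar_profile s] as the supremum over q of
    (1 + s q) / phi(q). *)
Lemma polar_profile_bound s q : 1 + s * q <= polar_profile s * gauss_abs q.
Proof.
have e0 := gauss_exp_gt0 (touching_point s).
rewrite [leRHS]mulrC /polar_profile ler_pdivlMr//; apply: le_trans (gauss_abs_tangent (touching_point s) q).
rewrite -{1}[s]touching_pointK /touching_slope mulrDl mul1r lerD2l.
by rewrite mulrAC divfK// gt_eqF.
Qed.

Lemma polar_profile_touch s (p := touching_point s) :
  1 + s * p = polar_profile s * gauss_abs p.
Proof.
rewrite -[s in LHS]touching_pointK -/p /polar_profile -/p /touching_slope /gauss_abs.
have e0 : gauss_exp p != 0 by rewrite gt_eqF// gauss_exp_gt0.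
by field.
Qed.

Lemma polar_slope_ge0 s : 0 <= s -> 0 <= polar_slope s.
Proof.
by move=> s0; rewrite divr_ge0 ?touching_point_ge0// ltW// gauss_abs_gt0.
Qed.

Lemma polar_slope_le1 s : polar_slope s <= 1.
Proof.
rewrite ler_pdivrMr ?gauss_abs_gt0// mul1r.
by rewrite (le_trans (ler_norm _))// gauss_abs_ge.
Qed.

(** By the Legendre relation s F'(s) = F(s) - 1 / phi(p), where F(s) >= s and phi >= 1. *)
Lemma polar_slope_ge s : 0 < s -> 1 - s^-1 <= polar_slope s.
Proof.
move=> s0; rewrite -(ler_pM2l s0) mulrBr mulr1 divff ?gt_eqF//.
rewrite lerBlDr -lerBlDl (le_trans _ (_ : (gauss_abs (touching_point s))^-1 <= _))//.
  rewrite -polar_profile_legendre lerD2r.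
  by rewrite (le_trans (ler_norm _))// polar_profile_ge.
by rewrite invf_le1 ?gauss_abs_gt0// gauss_abs_ge1.
Qed.

Lemma polar_curvature_ge0 s : 0 <= polar_curvature s.
Proof.
by rewrite mulr_ge0 ?divr_ge0 ?pi_ge0// exprn_ge0// ltW// ?gauss_exp_gt0 ?gauss_abs_gt0.
Qed.

Lemma polar_curvatureE s : polar_curvature s =
  pi / 2 * ((gauss_abs (touching_point s))^-1 ^+ 3 * (polar_profile s)^-1 ^+ 2).
Proof.
by rewrite /polar_curvature /polar_profile invrK exprVn [in RHS](mulrC (_ ^- 3)).
Qed.

Lemma polar_profile_le s t : 0 <= s -> s <= t -> polar_profile s <= polar_profile t.
Proof.
move=> s0 st; apply: (ge0_is_derive_le_everywhere st).
  by move=> x _; exact: is_derive_polar_profile.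
by move=> x /andP[sx _]; rewrite polar_slope_ge0// (le_trans s0)// ltW.
Qed.

Lemma gauss_abs_le_mono p q : 0 <= p -> p <= q -> gauss_abs p <= gauss_abs q.
Proof.
move=> p0 pq; apply: (ge0_is_derive_le_everywhere pq).
  by move=> x _; exact: is_derive_gauss_abs.
by move=> x /andP[sx _]; rewrite gauss_erf_ge0// (le_trans p0)// ltW.
Qed.

Lemma touching_point_le s t : s <= t -> touching_point s <= touching_point t.
Proof. by rewrite le_eqVlt => /predU1P[->//|/touching_point_lt/ltW]. Qed.

Lemma polar_curvature_le s t : 0 <= s -> s <= t ->
  polar_curvature t <= polar_curvature s.
Proof.
have k0 x : 0 <= (gauss_abs (touching_point x))^-1.
  by rewrite ltW// invr_gt0 gauss_abs_gt0.
have F0 x : 0 <= (polar_profile x)^-1 by rewrite ltW// invr_gt0 polar_profile_gt0.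
move=> s0 st; rewrite !polar_curvatureE ler_wpM2l ?divr_ge0 ?pi_ge0//.
rewrite ler_pM ?exprn_ge0//.
  rewrite lerXn2r ?nnegrE// lef_pV2 ?posrE ?gauss_abs_gt0// gauss_abs_le_mono//.
    exact: touching_point_ge0.
  exact: touching_point_le.
by rewrite lerXn2r ?nnegrE// lef_pV2 ?posrE ?polar_profile_gt0// polar_profile_le.
Qed.

Lemma polar_curvature0 : polar_curvature 0 = pi / 2.
Proof.
by rewrite /polar_curvature touching_point0 gauss_exp0 gauss_abs0 !expr1n divr1 mulr1.
Qed.

End polar_profile.

(** * Positive exponential sums and reciprocals of their primitives *)

Section exponential_sums.
Context {R : realType}.
Implicit Types (p q : seq (R * R)) (f g h : R -> R) (u c e l C U : R).

(** Rates are strictly positive, so that taking a primitive may divide by them; nonzero constants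
    are thereby excluded. *)
Definition exp_sum g : Prop := exists p : seq (R * R),
  (forall x, x \in p -> 0 <= x.1 /\ 0 < x.2) /\
  (forall u, g u = \sum_(x <- p) x.1 * expR (- (x.2 * u))).

Lemma exp_sum_exp c l : 0 <= c -> 0 < l ->
  exp_sum (fun u => c * expR (- (l * u))).
Proof.
move=> c0 l0; exists [:: (c, l)]; split=> [x|u]; last by rewrite big_seq1.
by rewrite inE => /eqP->.
Qed.

Lemma exp_sum0 : exp_sum (fun=> 0).
Proof. by exists [::]; split=> // u; rewrite big_nil. Qed.

Lemma exp_sum_add f g : exp_sum f -> exp_sum g -> exp_sum (fun u => f u + g u).
Proof.
move=> [p [p0 pE]] [q [q0 qE]]; exists (p ++ q); split=> [x|u].
  by rewrite mem_cat => /orP[/p0|/q0].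
by rewrite big_cat/= pE qE.
Qed.

Lemma exp_sum_scale c f : 0 <= c -> exp_sum f -> exp_sum (fun u => c * f u).
Proof.
move=> c0 [p [p0 pE]]; exists [seq (c * x.1, x.2) | x <- p]; split=> [y|u].
  by move=> /mapP[x /p0[x1 x2] ->]; split=> //=; rewrite mulr_ge0.
by rewrite big_map pE mulr_sumr; apply: eq_bigr => x _; rewrite mulrA.
Qed.

Lemma exp_sum_dilate c f : 0 < c -> exp_sum f -> exp_sum (fun u => f (u * c)).
Proof.
move=> c0 [p [p0 pE]]; exists [seq (x.1, c * x.2) | x <- p]; split=> [y|u].
  by move=> /mapP[x /p0[x1 x2] ->]; split=> //=; rewrite mulr_gt0.
rewrite big_map pE; apply: eq_bigr => x _ /=.
by rewrite (mulrC c) -mulrA (mulrC u).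
Qed.

Lemma exp_sum_mul f g : exp_sum f -> exp_sum g -> exp_sum (fun u => f u * g u).
Proof.
move=> [p [p0 pE]] [q [q0 qE]].
exists [seq (x.1 * y.1, x.2 + y.2) | x <- p, y <- q]; split=> [y|u].
  move=> /allpairsP[[x z]/= [/p0[x1 x2] /q0[y1 y2] ->]]/=.
  by rewrite mulr_ge0// addr_gt0.
rewrite big_allpairs_dep pE qE mulr_suml; apply: eq_bigr => x _.
rewrite mulr_sumr; apply: eq_bigr => y _ /=.
by rewrite mulrACA -expRD -opprD -mulrDl.
Qed.

Lemma exp_sum_exprn n f : exp_sum f -> exp_sum (fun u => f u ^+ n.+1).
Proof.
move=> hf; elim: n => [|n IH]; first by [].
have := exp_sum_mul hf IH.
by congr exp_sum; apply/funext => u; rewrite -exprS.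
Qed.

Lemma exp_sum_sum n (F : nat -> R -> R) : (forall i, exp_sum (F i)) ->
  exp_sum (fun u => \sum_(i < n) F i u).
Proof.
move=> hF; elim: n => [|n IH].
  by have := exp_sum0; congr exp_sum; apply/funext => u; rewrite big_ord0.
have := exp_sum_add IH (hF n).
by congr exp_sum; apply/funext => u; rewrite big_ord_recr.
Qed.

Lemma exp_sum_ge0 g u : exp_sum g -> 0 <= g u.
Proof.
move=> [p [p0 ->]]; rewrite big_seq; apply: sumr_ge0 => x /p0[x1 _].
by rewrite mulr_ge0// expR_ge0.
Qed.

Lemma exp_sum_le g u : exp_sum g -> 0 <= u -> g u <= g 0.
Proof.
move=> [p [p0 pE]] u0; rewrite !pE !big_seq; apply: ler_sum => x /p0[x1 x2].
by rewrite ler_wpM2l// ler_expR lerN2 mulr0 mulr_ge0// ltW.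
Qed.

(* Geometric series in [h / C]; the constant [1] is not an exponential sum and
   is replaced with [expR (- d u)] for a small rate [d]. *)
Lemma exp_sum_geometric h C U e : exp_sum h -> 0 < C -> h 0 < C -> 0 <= U ->
  0 < e -> exists2 g, exp_sum g &
    forall u, 0 <= u <= U -> `|g u - (C - h u)^-1| <= e.
Proof.
move=> hh C0 hC U0 e0.
pose c := C - h 0; have c0 : 0 < c by rewrite subr_gt0.
pose th := h 0 / C.
have th0 : 0 <= th by rewrite divr_ge0 ?(exp_sum_ge0 _ hh) ?ltW.
have th1 : th < 1 by rewrite ltr_pdivrMr// mul1r.
pose d := e * c / (2 * (U + 1)).
have U1 : 0 < U + 1 by rewrite ltr_wpDl.
have d0 : 0 < d by rewrite divr_gt0 ?mulr_gt0.
have dUc : 0 <= d * U / c.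
  by apply: divr_ge0; [apply: mulr_ge0 => //; exact: ltW|exact: ltW].
(* Iterates g -> C^-1 * (exp (- d u) + h g); for d = 0 the fixed point is (C - h)^-1. Each turn
   contracts the error by [th] and adds at most C^-1 * d U, which sums to d U / c because 1 - th = c
   / C. *)
have gex n : exists2 g, exp_sum g & forall u, 0 <= u <= U ->
    `|g u - (C - h u)^-1| <= th ^+ n * c^-1 + d * U / c.
  elim: n => [|n [g hg gE]].
    exists (fun=> 0); first exact: exp_sum0.
    move=> u /andP[u0 uU]; rewrite sub0r normrN expr0 mul1r.
    have hu := exp_sum_le hh u0.
    have cu : c <= C - h u by rewrite lerD2l lerN2.
    rewrite ger0_norm ?invr_ge0 ?(le_trans (ltW c0))//.
    rewrite ler_wpDr//.
    by rewrite lef_pV2 ?posrE// (lt_le_trans c0).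
  exists (fun u => C^-1 * expR (- (d * u)) + C^-1 * (h u * g u)).
    apply: exp_sum_add; first by apply: exp_sum_exp; rewrite ?invr_ge0 ?ltW.
    by apply: exp_sum_scale; [rewrite invr_ge0 ltW|exact: exp_sum_mul].
  move=> u uU; have /andP[u0 uU'] := uU.
  have hu0 := exp_sum_ge0 u hh.
  have hu := exp_sum_le hh u0.
  have cu : c <= C - h u by rewrite lerD2l lerN2.
  have Chu : 0 < C - h u by rewrite (lt_le_trans c0).
  have -> : C^-1 * expR (- (d * u)) + C^-1 * (h u * g u) - (C - h u)^-1 =
    - (C^-1 * (1 - expR (- (d * u)))) + h u / C * (g u - (C - h u)^-1).
    by field; rewrite !gt_eqF.
  rewrite (le_trans (ler_normD _ _))// normrN.
  have E1 : `|C^-1 * (1 - expR (- (d * u)))| <= C^-1 * (d * U).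
    rewrite normrM ger0_norm ?invr_ge0 ?(ltW C0)// ler_wpM2l ?invr_ge0 ?(ltW C0)//.
    have du : 0 <= d * u by rewrite mulr_ge0// ltW.
    rewrite ger0_norm; last by rewrite subr_ge0 -[leRHS]expR0 ler_expR oppr_le0.
    rewrite lerBlDr -lerBlDl (le_trans _ (expR_ge1Dx _))// lerD2l lerN2.
    by rewrite ler_wpM2l// ltW.
  have E2 : `|h u / C * (g u - (C - h u)^-1)| <= th * (th ^+ n * c^-1 + d * U / c).
    rewrite normrM ler_pM//; last exact: gE.
    by rewrite ger0_norm ?divr_ge0 ?(ltW C0)// ler_wpM2r ?invr_ge0 ?(ltW C0).
  apply: (le_trans (lerD E1 E2)).
  rewrite mulrDr mulrA -exprS addrCA lerD2l.
  suff -> : C^-1 * (d * U) + th * (d * U / c) = d * U / c by [].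
  have hCE : h 0 = C - c by rewrite /c; ring.
  rewrite /th hCE; move: (d) => d'.
  by field; rewrite !gt_eqF.
have [n nE] : exists n, th ^+ n * c^-1 <= e / 2.
  have := cvg_expr (R := R) (z := th); rewrite ger0_norm// => /(_ th1).
  move=> /cvgrPdist_le/(_ (e / 2 * c)); case; first by rewrite mulr_gt0// divr_gt0.
  move=> n _ /(_ n (leqnn n)) /=; rewrite sub0r normrN ger0_norm ?exprn_ge0// => H.
  by exists n; rewrite ler_pdivrMr.
have [g hg gE] := gex n; exists g => // u /gE/le_trans; apply.
rewrite [leRHS]splitr lerD//.
rewrite /d ler_pdivrMr// invfM mulrA.
have -> : e * c / 2 / (U + 1) * U = e / 2 * c * (U / (U + 1)).
  by field; rewrite gt_eqF.
by rewrite ler_piMr ?mulr_ge0 ?ltW ?divr_gt0// ltr_pdivrMr// mul1r ltrDl.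
Qed.

(** Termwise integration gives Phi = C - H, where H is the sum of the c / l * exp (- l u) and C = 1
    + H 0. As H 0 < C, the geometric series applies. This is how one equation of the system is
    solved for the next iterate. *)
Lemma exp_sum_inv_primitive g U e : exp_sum g -> 0 <= U -> 0 < e ->
  exists Phi h : R -> R, [/\ Phi 0 = 1, forall u : R, is_derive u 1 Phi (g u),
    exp_sum h & forall u, 0 <= u <= U -> `|h u - (Phi u)^-1| <= e].
Proof.
move=> [p [p0 pE]] U0 e0.
pose q := [seq (x.1 / x.2, x.2) | x <- p].
pose h u : R := \sum_(x <- q) x.1 * expR (- (x.2 * u)).
have hh : exp_sum h.
  exists q; split=> // y /mapP[x /p0[x1 x2] ->]/=.
  by rewrite divr_ge0// ltW.
have h00 := exp_sum_ge0 0 hh.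
have C0 : 0 < 1 + h 0 by rewrite ltr_wpDr.
have [|k hk kE] := exp_sum_geometric hh C0 _ U0 e0; first by rewrite ltrDr.
exists (fun u => (1 + h 0) - h u), k; split => //; first by rewrite addrK.
move=> u; rewrite pE.
have dh : is_derive u 1 h (\sum_(x <- p) - (x.1 * expR (- (x.2 * u)))).
  rewrite (_ : h = fun v => \sum_(x <- q) x.1 * expR (- (x.2 * v)))// /q.
  elim: p p0 {pE q h hh h00 C0 k hk kE} => [|x p IH] p0.
    rewrite (_ : (fun _ => _) = fun=> 0); last by apply/funext => v; rewrite /= big_nil.
    by rewrite big_nil; exact: is_derive_const.
  rewrite (_ : (fun _ => _) = fun v => x.1 / x.2 * expR (- (x.2 * v)) +
     \sum_(x <- [seq (x.1 / x.2, x.2) | x <- p]) x.1 * expR (- (x.2 * v))); last first.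
    by apply/funext => v; rewrite /= big_cons.
  rewrite big_cons; have [_ x2] := p0 x (mem_head _ _).
  apply: is_derive_add; last first.
    by apply: IH => y yp; apply: p0; rewrite inE yp orbT.
  apply: (is_derive_cast (is_derive_mull (x.1 / x.2) (is_derive_exp
    (is_derive_opp (is_derive_mull x.2 (is_derive_idfun u)))))).
  by field; rewrite gt_eqF.
apply: (is_derive_cast (is_derive_sub (is_derive_const u (1 + h 0)) dh)).
by rewrite sumrN opprK add0r.
Qed.

End exponential_sums.

(** * The differential system for r and w, and a weighted comparison *)

Section curvature_exponential_sums.
Context {R : realType}.
Implicit Types (a b s u v : R).

Lemma polar_slope_increment a b : 0 <= a -> a <= b ->
  (b - a) * polar_curvature b <= polar_slope b - polar_slope a <=
  (b - a) * polar_curvature a.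
Proof.
move=> a0 ab.
have dS (x : R) : x \in `]a, b[ -> is_derive x 1 polar_slope (polar_curvature x).
  by move=> _; exact: is_derive_polar_slope.
have [|c] := MVT_segment ab dS.
  apply: continuous_subspaceT => x.
  exact: is_derive_continuous (is_derive_polar_slope x).
rewrite in_itv/= => /andP[ac cb] ->; rewrite (mulrC _ (b - a)).
by apply/andP; split; apply: ler_wpM2l; rewrite ?subr_ge0// polar_curvature_le// (le_trans a0).
Qed.

(** A finite sum in place of the average over v in [0, 1] keeps the iterates exponential sums. F''
    is nonincreasing on [0, oo), so left and right sums bracket F'(s) and differ by at most s / N *
    F''(0), with F''(0) = pi / 2. *)
Lemma polar_slope_riemann (n : nat) s (N := n.+1) : 0 <= s ->
  `|polar_slope s - s / N%:R * \sum_(i < N) polar_curvature (s * (i.+1%:R / N%:R))|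
    <= s / N%:R * (pi / 2).
Proof.
move=> s0; have N0 : 0 < N%:R :> R by [].
have x0 i : 0 <= s * (i%:R / N%:R) by rewrite mulr_ge0// divr_ge0.
have H m : s / N%:R * \sum_(i < m) polar_curvature (s * (i.+1%:R / N%:R)) <=
    polar_slope (s * (m%:R / N%:R)) <=
    s / N%:R * \sum_(i < m) polar_curvature (s * (i%:R / N%:R)).
  elim: m => [|m /andP[IH1 IH2]].
    by rewrite !big_ord0 mul0r !mulr0 polar_slope0 lexx.
  rewrite !big_ord_recr/= !mulrDr.
  have sm : s * (m%:R / N%:R) <= s * (m.+1%:R / N%:R).
    by rewrite ler_wpM2l// ler_wpM2r ?invr_ge0 ?(ltW N0)// ler_nat.
  have := polar_slope_increment (x0 m) sm.
  have -> : s * (m.+1%:R / N%:R) - s * (m%:R / N%:R) = s / N%:R.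
    by rewrite -mulrBr -mulrBl -natrB// subSnn mul1r.
  move=> /andP[]; lra.
have /andP[] := H N; rewrite divff ?gt_eqF// mulr1 => H1 H2.
have : s / N%:R * \sum_(i < N) polar_curvature (s * (i%:R / N%:R)) <=
  s / N%:R * \sum_(i < N) polar_curvature (s * (i.+1%:R / N%:R)) + s / N%:R * (pi / 2).
  rewrite -mulrDr ler_wpM2l ?divr_ge0//.
  have E1 : \sum_(i < N.+1) polar_curvature (s * (i%:R / N%:R)) =
    pi / 2 + \sum_(i < N) polar_curvature (s * (i.+1%:R / N%:R)).
    rewrite big_ord_recl/= mul0r mulr0 polar_curvature0; congr (_ + _).
  have E2 : \sum_(i < N.+1) polar_curvature (s * (i%:R / N%:R)) =
    \sum_(i < N) polar_curvature (s * (i%:R / N%:R)) + polar_curvature (s * (N%:R / N%:R)).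
    by rewrite big_ord_recr.
  have := polar_curvature_ge0 (s * (N%:R / N%:R)); lra.
rewrite ler_norml; lra.
Qed.

(** With [profile_inv], the unknowns r and w of the system as functions of u = s ^ 2. *)
Definition conjugate_inv u : R := (gauss_abs (touching_point (Num.sqrt u)))^-1.
Definition profile_inv u : R := (polar_profile (Num.sqrt u))^-1.

Lemma conjugate_inv_bounds u : 0 < conjugate_inv u <= 1.
Proof.
rewrite invr_gt0 gauss_abs_gt0 invf_le1 ?gauss_abs_gt0//.
exact: gauss_abs_ge1.
Qed.

Lemma profile_inv_bounds u : 0 < profile_inv u <= 1.
Proof.
rewrite invr_gt0 polar_profile_gt0 invf_le1 ?polar_profile_gt0//.
exact: polar_profile_ge1.
Qed.

Lemma polar_curvature_sqrt u :
  polar_curvature (Num.sqrt u) = pi / 2 * (conjugate_inv u ^+ 3 * profile_inv u ^+ 2).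
Proof. exact: polar_curvatureE. Qed.

(** The factor 1 / (2 s) from the square root is absorbed by s = [gauss_erf p] / [gauss_exp p], so
    the right-hand side involves only r and w. *)
Lemma is_derive_gauss_abs_sqrt u : 0 < u ->
  is_derive u 1 (fun v => gauss_abs (touching_point (Num.sqrt v)))
    (pi / 4 * (conjugate_inv u * profile_inv u ^+ 2)).
Proof.
move=> u0; have s0 : 0 < Num.sqrt u by rewrite sqrtr_gt0.
apply: (is_derive_cast (is_derive_compose (is_derive_compose (is_derive_gauss_abs _)
   (is_derive_touching_point _)) (is_derive_sqrt u0))).
rewrite /conjugate_inv /profile_inv /polar_profile invrK.
rewrite -[X in (2 * X)^-1]touching_pointK /touching_slope.
have p0 : 0 < touching_point (Num.sqrt u).
  by rewrite -touching_point0 touching_point_lt.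
move: (touching_point _) p0 => p p0.
have e0 := gauss_exp_gt0 p; have a0 := gauss_abs_gt0 p.
have f0 : 0 < gauss_erf p.
  have := touching_slope_lt p0; rewrite /touching_slope gauss_erf0 mul0r.
  by rewrite pmulr_lgt0// invr_gt0.
by move: pi => P; field; rewrite !gt_eqF.
Qed.

Lemma is_derive_polar_profile_sqrt u : 0 < u ->
  is_derive u 1 (fun v => polar_profile (Num.sqrt v))
    (polar_slope (Num.sqrt u) / (2 * Num.sqrt u)).
Proof.
move=> u0.
by apply: (is_derive_compose (is_derive_polar_profile _) (is_derive_sqrt u0)).
Qed.

(** Integrating a * exp (B u) gains a factor 1 / B, the source of the contraction for the norm sup
    |f(u)| exp (- B u). Differentiability is asked for u > 0 only, because of the square root at
    0. *)
Lemma derive_comparison (B a b U : R) (f g df dg : R -> R) : 0 < B -> 0 <= a ->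
  f 0 = g 0 -> {within `[0, U], continuous f} -> {within `[0, U], continuous g} ->
  (forall u, 0 < u <= U -> is_derive u 1 f (df u)) ->
  (forall u, 0 < u <= U -> is_derive u 1 g (dg u)) ->
  (forall u, 0 < u <= U -> `|df u - dg u| <= a * expR (B * u) + b) ->
  forall u, 0 <= u <= U -> `|f u - g u| <= a / B * expR (B * u) + b * u.
Proof.
move=> B0 a0 fg cf cg fdf gdg dfdg u /andP[u0 uU].
have aB0 : 0 <= a / B by rewrite divr_ge0// ltW.
pose E v := a / B * expR (B * v) + b * v.
have E00 : 0 <= E 0 by rewrite /E !mulr0 expR0 mulr1 addr0.
have dE (v : R) : is_derive v 1 E (a * expR (B * v) + b).
  apply: (is_derive_cast (is_derive_add (is_derive_mull (a / B) (is_derive_exp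
    (is_derive_mull B (is_derive_idfun v)))) (is_derive_mull b (is_derive_idfun v)))).
  by field; rewrite gt_eqF.
have cE : continuous E by move=> v; exact: is_derive_continuous (dE v).
have sub : `[0, u] `<=` `[0, U].
  by move=> x /=; rewrite !in_itv/= => /andP[-> /le_trans ->].
have cf' := continuous_subspaceW sub cf.
have cg' := continuous_subspaceW sub cg.
have vU v : 0 < v < u -> 0 < v <= U.
  by move=> /andP[-> /ltW/le_trans->].
have H (k : R -> R) (dk : R -> R) : k 0 = 0 -> {within `[0, u], continuous k} ->
    (forall v, 0 < v <= U -> is_derive v 1 k (dk v)) ->
    (forall v, 0 < v <= U -> dk v <= a * expR (B * v) + b) -> k u <= E u.
  move=> k0 ck kdk dkE; rewrite -subr_ge0.
  suff : E 0 - k 0 <= E u - k u by rewrite k0 subr0; exact: le_trans.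
  apply: (@ge0_is_derive_le _ (fun v => E v - k v)
    (fun v => a * expR (B * v) + b - dk v) 0 u u0).
  - by move=> v /vU vu; exact: is_derive_sub (dE v) (kdk v vu).
  - move=> v; apply: cvgB; last exact: ck.
    by move: v; exact: continuous_subspaceT.
  - by move=> v /vU vu; rewrite subr_ge0 dkE.
rewrite ler_norml; apply/andP; split.
  rewrite lerNl opprB.
  apply: (H (fun v => g v - f v) (fun v => dg v - df v)).
  - by rewrite fg subrr.
  - by move=> v; apply: cvgB; [exact: cg'|exact: cf'].
  - by move=> v vu; apply: is_derive_sub; [exact: gdg|exact: fdf].
  - by move=> v /dfdg; rewrite distrC; apply: le_trans; rewrite ler_norm.
apply: (H (fun v => f v - g v) (fun v => df v - dg v)).
- by rewrite fg subrr.
- by move=> v; apply: cvgB; [exact: cf'|exact: cg'].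
- by move=> v vu; apply: is_derive_sub; [exact: fdf|exact: gdg].
- by move=> v /dfdg; apply: le_trans; rewrite ler_norm.
Qed.

End curvature_exponential_sums.

(** * The contraction and the approximation of F'' by exponential sums *)

Section curvature_iteration.
Context {R : realType}.
Implicit Types (r w : R -> R) (u v e U : R).

(** The Lipschitz constant of r ^ 3 w ^ 2 is 31 here; with pi / 2 <= 2 and the factor 1 / 2 of the
    average, the derivative error is at most 31 e, and 31 / B = 1 / 2. Adding e / 8 for the Riemann
    sum and e / 8 for the geometric series gives the ratio 3 / 4. *)
Let B : R := 62.

(** The bound 2 keeps the Lipschitz constants of the right-hand sides the same at every
    iteration. *)
Definition close_approximation U e r w := forall u, 0 <= u <= U ->
  [/\ 0 <= r u <= 2, 0 <= w u <= 2,
      `|r u - conjugate_inv u| <= e * expR (B * u) &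
      `|w u - profile_inv u| <= e * expR (B * u)].

Let pi_le4 : pi <= 4 :> R.
Proof. have /andP[_] := @pihalf_02 R; lra. Qed.

Let close_square (x a y b d : R) : 0 <= x <= 2 -> 0 <= a <= 2 ->
  0 < y <= 1 -> 0 < b <= 1 -> `|x - y| <= d -> `|a - b| <= d ->
  `|x * a ^+ 2 - y * b ^+ 2| <= 7 * d.
Proof.
move=> /andP[x0 x2] /andP[a0 a2] /andP[y0 y1] /andP[b0 b1] xy ab.
have -> : x * a ^+ 2 - y * b ^+ 2 = a ^+ 2 * (x - y) + y * (a + b) * (a - b).
  by ring.
have -> : 7 * d = 4 * d + 3 * d by ring.
rewrite (le_trans (ler_normD _ _))// lerD// normrM ler_pM//.
  by rewrite ger0_norm ?sqr_ge0//; nra.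
by rewrite ger0_norm ?mulr_ge0 ?addr_ge0//; nra.
Qed.

(** The telescoping factors are at most 4 * 7 and 3, whence 31. *)
Let close_cube (x a y b d : R) : 0 <= x <= 2 -> 0 <= a <= 2 ->
  0 < y <= 1 -> 0 < b <= 1 -> `|x - y| <= d -> `|a - b| <= d ->
  `|x ^+ 3 * a ^+ 2 - y ^+ 3 * b ^+ 2| <= 31 * d.
Proof.
move=> /andP[x0 x2] /andP[a0 a2] /andP[y0 y1] /andP[b0 b1] xy ab.
have -> : x ^+ 3 * a ^+ 2 - y ^+ 3 * b ^+ 2 =
    a ^+ 2 * (x ^+ 2 + x * y + y ^+ 2) * (x - y) + y ^+ 3 * (a + b) * (a - b).
  by ring.
have -> : 31 * d = 28 * d + 3 * d by ring.
rewrite (le_trans (ler_normD _ _))// lerD// normrM ler_pM//.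
  have xyy : 0 <= x ^+ 2 + x * y + y ^+ 2 <= 7 by apply/andP; split; nra.
  have /andP[h1 h2] := xyy.
  rewrite ger0_norm ?mulr_ge0 ?sqr_ge0//.
  have -> : 28 = 4 * 7 :> R by ring.
  by rewrite ler_pM ?sqr_ge0//; nra.
have y3 : 0 <= y ^+ 3 <= 1 by rewrite exprn_ge0 ?exprn_ile1 ?(ltW y0).
have /andP[h1 h2] := y3.
rewrite ger0_norm ?mulr_ge0 ?addr_ge0 ?(ltW b0) ?(ltW y0)//.
by rewrite -[leRHS]mul1r ler_pM ?addr_ge0 ?(ltW b0)//; lra.
Qed.

Lemma close_curvature U e r w : close_approximation U e r w ->
  forall u, 0 <= u <= U ->
    `|pi / 2 * (r u ^+ 3 * w u ^+ 2) - polar_curvature (Num.sqrt u)| <=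
    62 * e * expR (B * u).
Proof.
move=> H u /H[r2 w2 rE wE].
rewrite polar_curvature_sqrt -mulrBr normrM ger0_norm ?divr_ge0 ?pi_ge0//.
have := close_cube r2 w2 (conjugate_inv_bounds u) (profile_inv_bounds u) rE wE.
have : pi / 2 <= 2 :> R by have := pi_le4; lra.
move=> p2 h; have -> : 62 * e * expR (B * u) = 2 * (31 * (e * expR (B * u))).
  by ring.
by rewrite ler_pM ?divr_ge0 ?pi_ge0.
Qed.

Let inv_comparison (h x y d d' : R) : 1 <= x -> 1 <= y -> `|h - x^-1| <= d ->
  `|x - y| <= d' -> `|h - y^-1| <= d + d'.
Proof.
move=> x1 y1 hx xy.
have x0 : 0 < x by lra.
have y0 : 0 < y by lra.
have -> : h - y^-1 = (h - x^-1) + (x^-1 - y^-1) by ring.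
rewrite (le_trans (ler_normD _ _))// lerD//; apply: le_trans xy.
have -> : x^-1 - y^-1 = - (x - y) * (x * y)^-1 by field; rewrite !gt_eqF.
rewrite normrM normrN ler_piMr// ger0_norm ?invr_ge0 ?mulr_ge0 ?(ltW x0) ?(ltW y0)//.
by rewrite invf_le1 ?mulr_gt0//; nra.
Qed.

(** Common to both equations: [k] is the exact solution, [Phi] the primitive of the approximate
    right-hand side [g], and [h] its approximate reciprocal. Both [k] and [Phi] are at least 1,
    where inversion is 1-Lipschitz. *)
Lemma close_step_inv U e (g dg k h Phi : R -> R) (a b : R) : 0 <= U -> 0 < e <= 1 ->
  0 <= a -> a <= 31 * e -> b * U <= e / 8 -> 0 <= b ->
  Phi 0 = 1 -> (forall u : R, is_derive u 1 Phi (g u)) ->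
  (forall u, 0 <= u <= U -> 0 <= g u) ->
  (forall u, 0 <= u <= U -> `|h u - (Phi u)^-1| <= e / 8) ->
  k 0 = 1 -> (forall u, 1 <= k u) -> {within `[0, U], continuous k} ->
  (forall u, 0 < u <= U -> is_derive u 1 k (dg u)) ->
  (forall u, 0 < u <= U -> `|g u - dg u| <= a * expR (B * u) + b) ->
  forall u, 0 <= u <= U -> h u <= 2 /\ `|h u - (k u)^-1| <= 3 / 4 * e * expR (B * u).
Proof.
move=> U0 /andP[e0 e1] a0 a31 bU b0 P0 dP g0 hP k0 k1 ck dk gdg u uU.
have cP : {within `[0, U], continuous Phi}.
  by apply: continuous_subspaceT => x; exact: is_derive_continuous (dP x).
have B0 : 0 < B by [].
have := derive_comparison B0 a0 (etrans P0 (esym k0)) cP ck (fun u _ => dP u) dk gdg uU.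
move=> Pk; have /andP[u0 uU'] := uU.
have P1 : 1 <= Phi u.
  rewrite -P0; apply: (ge0_is_derive_le_everywhere u0).
  by move=> x /andP[x0 xu]; apply: g0; rewrite ltW//= (le_trans (ltW xu)).
have E1 : 1 <= expR (B * u) by rewrite -[leLHS]expR0 ler_expR mulr_ge0// ltW.
split.
  have := hP _ uU; rewrite ler_norml => /andP[_].
  have : (Phi u)^-1 <= 1 by rewrite invf_le1// (lt_le_trans ltr01).
  lra.
apply: le_trans (inv_comparison P1 (k1 u) (hP _ uU) Pk) _.
have : a / B * expR (B * u) <= e / 2 * expR (B * u).
  rewrite ler_wpM2r ?expR_ge0// ler_pdivrMr// /B; lra.
have : b * u <= e / 8 by apply: le_trans bU; rewrite ler_wpM2l.
nra.
Qed.

Lemma close_step U e r w : 0 <= U -> 0 < e <= 1 -> exp_sum r -> exp_sum w ->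
  close_approximation U e r w ->
  exists r' w', [/\ exp_sum r', exp_sum w' &
    close_approximation U (3 / 4 * e) r' w'].
Proof.
move=> U0 e01 hr hw H; have /andP[e0 e1] := e01.
pose p u := pi / 2 * (r u ^+ 3 * w u ^+ 2).
have hp : exp_sum p.
  apply: exp_sum_scale; first by rewrite divr_ge0 ?pi_ge0.
  by apply: exp_sum_mul; exact: exp_sum_exprn.
(* The Riemann error is at most 1 / N in the derivative, hence U / N after integration. *)
have [n nE] : exists n : nat, U / n.+1%:R <= e / 8.
  exists (Num.truncn (8 * U / e)).
  have := ltW (truncnS_gt (8 * U / e)); rewrite !ler_pdivrMr//; lra.
pose N := n.+1.
pose g u := 2^-1 * (N%:R^-1 * \sum_(i < N) p (u * (i.+1%:R / N%:R) ^+ 2)).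
have hg : exp_sum g.
  apply: exp_sum_scale; first by rewrite invr_ge0.
  apply: exp_sum_scale; first by rewrite invr_ge0.
  apply: (exp_sum_sum _ (F := fun i u => p (u * (i.+1%:R / N%:R) ^+ 2))) => i.
  by apply: exp_sum_dilate => //; rewrite exprn_gt0// divr_gt0.
pose q u := pi / 4 * (r u * w u ^+ 2).
have hq : exp_sum q.
  apply: exp_sum_scale; first by rewrite divr_ge0 ?pi_ge0.
  by apply: exp_sum_mul => //; exact: exp_sum_exprn.
have e8 : 0 < e / 8 by rewrite divr_gt0.
have [Pw [w' [Pw0 dPw hw' w'E]]] := exp_sum_inv_primitive hg U0 e8.
have [Pr [r' [Pr0 dPr hr' r'E]]] := exp_sum_inv_primitive hq U0 e8.
exists r', w'; split => //.
have csqrt : {within `[0, U], continuous (@Num.sqrt R)}.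
  by apply: continuous_subspaceT => x; exact: sqrt_continuous.
have Hw : forall u, 0 <= u <= U ->
    w' u <= 2 /\ `|w' u - profile_inv u| <= 3 / 4 * e * expR (B * u).
  apply: (@close_step_inv U e g (fun u => polar_slope (Num.sqrt u) / (2 * Num.sqrt u))
    (fun u => polar_profile (Num.sqrt u)) w' Pw (31 * e) N%:R^-1) => //.
  - by rewrite mulr_ge0// ltW.
  - by rewrite mulrC.
  - by move=> u _; exact: exp_sum_ge0.
  - by rewrite sqrtr0 polar_profile0.
  - by move=> u; exact: polar_profile_ge1.
  - apply: continuous_subspaceT => x; apply: continuous_comp; first exact: sqrt_continuous.
    exact: is_derive_continuous (is_derive_polar_profile _).
  - by move=> u /andP[u0 _]; exact: is_derive_polar_profile_sqrt.
  move=> u /andP[u0 uU]; pose s := Num.sqrt u.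
  have s0 : 0 < s by rewrite sqrtr_gt0.
  have xE i : Num.sqrt (u * (i.+1%:R / N%:R) ^+ 2) = s * (i.+1%:R / N%:R).
    by rewrite sqrtrM ?(ltW u0)// sqrtr_sqr ger0_norm// divr_ge0.
  have := polar_slope_riemann n (ltW s0); rewrite -/N.
  set S := \sum_(i < N) _ => HS.
  (* Splits the error into the one inherited from (r, w) at the sample points and the Riemann error,
     which is (2 s)^-1 * (s / N * (pi / 2)) <= 1 / N. *)
  have -> : g u - polar_slope s / (2 * s) =
      2^-1 * (N%:R^-1 * (\sum_(i < N) (p (u * (i.+1%:R / N%:R) ^+ 2) - 
        polar_curvature (s * (i.+1%:R / N%:R))))) -
      (2 * s)^-1 * (polar_slope s - s / N%:R * S).
    rewrite /g sumrB -/S; move: (\sum_(i < N) p _) => T.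
    have : (N%:R : R) != 0 by rewrite pnatr_eq0.
    have : s != 0 by rewrite gt_eqF.
    move: (s) (polar_slope s) (N%:R : R) => s' ps M s'0 M0.
    by field; rewrite s'0 M0.
  rewrite (le_trans (ler_normB _ _))// lerD//.
    rewrite normrM ger0_norm ?invr_ge0// -ler_pdivlMl// invrK.
    rewrite normrM ger0_norm ?invr_ge0// ler_pdivrMl//.
    rewrite (le_trans (ler_norm_sum _ _ _))//.
    have -> : N%:R * (2 * (31 * e * expR (B * u))) =
        \sum_(i < N) (62 * e * expR (B * u)) :> R.
      by rewrite sumr_const card_ord -[in RHS]mulr_natl; ring.
    apply: ler_sum => i _.
    have iN : 0 <= (i.+1%:R / N%:R : R) ^+ 2 <= 1.
      rewrite sqr_ge0/= exprn_ile1// ?divr_ge0//.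
      by rewrite ler_pdivrMr// mul1r ler_nat.
    have /andP[i0 i1] := iN.
    have iu : u * (i.+1%:R / N%:R) ^+ 2 <= u by rewrite ler_piMr// ltW.
    have := close_curvature H (u := u * (i.+1%:R / N%:R) ^+ 2); rewrite xE => HH.
    apply: (le_trans (HH _)).
      by rewrite mulr_ge0 ?(ltW u0)//= (le_trans iu).
    by rewrite ler_wpM2l ?mulr_ge0 ?(ltW e0)// ler_expR ler_wpM2l.
  rewrite normrM ger0_norm ?invr_ge0 ?mulr_ge0 ?(ltW s0)// ler_pdivrMl ?mulr_gt0//.
  apply: (le_trans HS).
  have -> : 2 * s / N%:R = s / N%:R * 2 by ring.
  rewrite ler_wpM2l ?divr_ge0 ?(ltW s0)//.
  by have := pi_le4; lra.
have Hr : forall u, 0 <= u <= U ->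
    r' u <= 2 /\ `|r' u - conjugate_inv u| <= 3 / 4 * e * expR (B * u).
  apply: (@close_step_inv U e q (fun u => pi / 4 * (conjugate_inv u * profile_inv u ^+ 2))
    (fun u => gauss_abs (touching_point (Num.sqrt u))) r' Pr (7 * e) 0) => //.
  - by rewrite mulr_ge0// ltW.
  - by lra.
  - by rewrite mul0r ltW.
  - by move=> u _; exact: exp_sum_ge0.
  - by rewrite sqrtr0 touching_point0 gauss_abs0.
  - by move=> u; exact: gauss_abs_ge1.
  - apply: continuous_subspaceT => x.
    apply: (@continuous_comp _ _ _ (@Num.sqrt R)
      (fun y => gauss_abs (touching_point y))); first exact: sqrt_continuous.
    apply: is_derive_continuous.
    exact: is_derive_compose (is_derive_gauss_abs _) (is_derive_touching_point _).
  - by move=> u /andP[u0 _]; exact: is_derive_gauss_abs_sqrt.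
  move=> u /andP[u0 uU]; rewrite addr0 /q -mulrBr normrM.
  have [|r2 w2 rE wE] := H u; first by rewrite ltW.
  have := close_square r2 w2 (conjugate_inv_bounds u) (profile_inv_bounds u) rE wE.
  rewrite ger0_norm ?divr_ge0 ?pi_ge0// => h.
  rewrite -[leRHS]mul1r ler_pM ?divr_ge0 ?pi_ge0//; last by rewrite -mulrA.
  by have := pi_le4; lra.
move=> u uU; have [r2 rE] := Hr u uU; have [w2 wE] := Hw u uU.
by rewrite !exp_sum_ge0.
Qed.

Lemma polar_curvature_exp_sum U e : 0 <= U -> 0 < e ->
  exists2 g, exp_sum g &
    forall u, 0 <= u <= U -> `|g u - polar_curvature (Num.sqrt u)| <= e.
Proof.
move=> U0 e0.
have iter n : exists r w, [/\ exp_sum r, exp_sum w &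
    close_approximation U ((3 / 4) ^+ n) r w].
  elim: n => [|n [r [w [hr hw H]]]].
    (* The start exp (- u) is within 1 of both targets, since all values lie in [0, 1]. *)
    pose f (u : R) := 1 * expR (- (1 * u)).
    have hf : exp_sum f by exact: exp_sum_exp.
    exists f, f; split => // u /andP[u0 uU].
    have f01 : 0 <= f u <= 1.
      by rewrite exp_sum_ge0//= /f !mul1r -[leRHS]expR0 ler_expR oppr_le0.
    have /andP[k0 k1] := conjugate_inv_bounds u.
    have /andP[p0 p1] := profile_inv_bounds u.
    have E1 : 1 <= expR (B * u) by rewrite -[leLHS]expR0 ler_expR mulr_ge0.
    have /andP[f0 f1] := f01.
    have f2 : 0 <= f u <= 2 by rewrite f0/= (le_trans f1)// ler1n.
    by split => //; rewrite expr0 mul1r (le_trans _ E1)// ler_norml; lra.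
  rewrite exprS; apply: close_step hr hw H => //.
  by rewrite exprn_gt0//= exprn_ile1//; lra.
(* On [0, U] the weight is at most exp (B U), so the weighted error d becomes the uniform error
   e. *)
pose d := e / (62 * expR (B * U)).
have d0 : 0 < d by rewrite divr_gt0// mulr_gt0// expR_gt0.
have [n nE] : exists n, (3 / 4 : R) ^+ n <= d.
  have z1 : `|3 / 4 : R| < 1 by rewrite ger0_norm//; lra.
  have := cvg_expr z1.
  move=> /cvgrPdist_le/(_ _ d0); case=> n _ /(_ n (leqnn n)) /=.
  by rewrite sub0r normrN ger0_norm ?exprn_ge0// => H; exists n.
have [r [w [hr hw H]]] := iter n.
exists (fun u => pi / 2 * (r u ^+ 3 * w u ^+ 2)).
  apply: exp_sum_scale; first by rewrite divr_ge0 ?pi_ge0.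
  by apply: exp_sum_mul; exact: exp_sum_exprn.
move=> u uU; apply: le_trans (close_curvature H uU) _.
have /andP[u0 uU'] := uU.
apply: (@le_trans _ _ (62 * d * expR (B * U))).
  rewrite ler_pM ?mulr_ge0 ?exprn_ge0 ?expR_ge0//; first by rewrite ler_wpM2l.
  by rewrite ler_expR ler_wpM2l.
have : expR (B * U) != 0 by rewrite gt_eqF// expR_gt0.
by rewrite /d; move: (expR _) => X X0; rewrite le_eqVlt; apply/orP; left; apply/eqP; field.
Qed.

End curvature_iteration.

(** * From exponential sums for F'' to Gaussian mixtures for F *)

Section polar_profile_mixture.
Context {R : realType}.
Implicit Types (s u e : R).

Lemma is_derive_bigsum (T : eqType) (p : seq T) (F : T -> R -> R) (dF : T -> R) u :
  (forall x, x \in p -> is_derive u 1 (F x) (dF x)) ->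
  is_derive u 1 (fun v => \sum_(x <- p) F x v) (\sum_(x <- p) dF x).
Proof.
elim: p => [|x p IH] dp.
  rewrite (_ : (fun _ => _) = fun=> 0); last by apply/funext => v; rewrite big_nil.
  by rewrite big_nil; exact: is_derive_const.
rewrite (_ : (fun _ => _) = fun v => F x v + \sum_(x <- p) F x v); last first.
  by apply/funext => v; rewrite big_cons.
rewrite big_cons; apply: is_derive_add; first exact/dp/mem_head.
by apply: IH => y yp; apply: dp; rewrite inE yp orbT.
Qed.

Let pi_le4 : pi <= 4 :> R.
Proof. have /andP[_] := @pihalf_02 R; lra. Qed.

Let pi_neq0 : (pi : R) != 0. Proof. by rewrite gt_eqF// pi_gt0. Qed.

Definition gauss_scale l : R := Num.sqrt (pi * l).

Lemma gauss_scale_gt0 l : 0 < l -> 0 < gauss_scale l.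
Proof. by move=> l0; rewrite sqrtr_gt0 mulr_gt0 ?pi_gt0. Qed.

Lemma gauss_exp_scale l s : 0 <= l ->
  gauss_exp (gauss_scale l * s) = expR (- (l * s ^+ 2)).
Proof.
move=> l0; rewrite /gauss_exp exprMn sqr_sqrtr ?mulr_ge0 ?pi_ge0//.
by congr (expR (- _)); move: pi_neq0; move: pi => P P0; field.
Qed.

(* The even second antiderivative of [expR (- (l * s ^+ 2))] that is asymptotic
   to a multiple of [`|s|]. *)
Definition mixture_term l s : R := (2 * l)^-1 * gauss_abs (gauss_scale l * s).
Definition mixture_slope l s : R :=
  gauss_scale l / (2 * l) * gauss_erf (gauss_scale l * s).

Lemma is_derive_mixture_term l s :
  is_derive s 1 (mixture_term l) (mixture_slope l s).
Proof.
apply: (is_derive_cast (is_derive_mull (2 * l)^-1 (is_derive_compose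
  (is_derive_gauss_abs _) (is_derive_mull (gauss_scale l) (is_derive_idfun s))))).
by rewrite /mixture_slope; ring.
Qed.

Lemma is_derive_mixture_slope l s : 0 < l ->
  is_derive s 1 (mixture_slope l) (expR (- (l * s ^+ 2))).
Proof.
move=> l0; apply: (is_derive_cast (is_derive_mull (gauss_scale l / (2 * l))
  (is_derive_compose (is_derive_gauss_erf _)
    (is_derive_mull (gauss_scale l) (is_derive_idfun s))))).
rewrite gauss_exp_scale ?ltW// mulr1.
have -> : gauss_scale l / (2 * l) * (2 / pi * expR (- (l * s ^+ 2)) * gauss_scale l) =
  gauss_scale l ^+ 2 / (2 * l) * (2 / pi) * expR (- (l * s ^+ 2)) by ring.
rewrite sqr_sqrtr ?mulr_ge0 ?pi_ge0 ?(ltW l0)//.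
by move: pi_neq0; move: pi => P P0; field; rewrite P0 gt_eqF.
Qed.

Lemma mixture_term0 l : mixture_term l 0 = (2 * l)^-1.
Proof. by rewrite /mixture_term mulr0 gauss_abs0 mulr1. Qed.

Lemma mixture_slope0 l : mixture_slope l 0 = 0.
Proof. by rewrite /mixture_slope mulr0 gauss_erf0 mulr0. Qed.

Lemma mixture_legendre l s : 0 <= l ->
  mixture_term l s - s * mixture_slope l s = (2 * l)^-1 * expR (- (l * s ^+ 2)).
Proof.
move=> l0; rewrite -gauss_exp_scale// /mixture_term /mixture_slope /gauss_abs.
by ring.
Qed.

(** This reads r' = - G / 2, so half the integral of G over [0, U] is 1 - r(U) <= 1; the mass bound
    rests on this. *)
Lemma is_derive_conjugate_inv u : 0 < u ->
  is_derive u 1 conjugate_inv (- (polar_curvature (Num.sqrt u) / 2)).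
Proof.
move=> u0; have a0 : gauss_abs (touching_point (Num.sqrt u)) != 0.
  by rewrite gt_eqF// gauss_abs_gt0.
apply: (is_derive_cast (@is_derive_inv _
  (fun v => gauss_abs (touching_point (Num.sqrt v))) u _ a0 (is_derive_gauss_abs_sqrt u0))).
rewrite polar_curvature_sqrt /conjugate_inv.
by move: pi (profile_inv u) => P W; field.
Qed.

(** Half the integral of g over [0, U] exceeds that of G by at most e U / 2, hence is at most 1 + e
    U / 2. The function [L] below is nonincreasing and encodes this comparison. *)
Lemma mixture_mass (p : seq (R * R)) (g : R -> R) U e : 0 < U -> 0 <= e ->
  (forall x, x \in p -> 0 <= x.1 /\ 0 < x.2) ->
  (forall u, g u = \sum_(x <- p) x.1 * expR (- (x.2 * u))) ->
  (forall u, 0 <= u <= U -> `|g u - polar_curvature (Num.sqrt u)| <= e) ->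
  \sum_(x <- p) x.1 * (2 * (x.2 + U^-1))^-1 <= 1 + e * U / 2.
Proof.
move=> U0 e0 p0 gE gG.
pose L u := conjugate_inv u - e / 2 * u
  + \sum_(x <- p) x.1 / (2 * x.2) * (1 - expR (- (x.2 * u))).
have dL u : 0 < u < U -> is_derive u 1 L
    (- (polar_curvature (Num.sqrt u) / 2) - e / 2 + g u / 2).
  move=> /andP[u0 uU]; apply: is_derive_add.
    apply: (is_derive_cast (is_derive_sub (is_derive_conjugate_inv u0)
      (is_derive_mull (e / 2) (is_derive_idfun u)))).
    by rewrite mulr1.
  rewrite gE mulr_suml; apply: is_derive_bigsum => x /p0[x1 x2].
  apply: (is_derive_cast (is_derive_mull (x.1 / (2 * x.2)) (is_derive_sub
    (is_derive_const u 1) (is_derive_exp (is_derive_opp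
       (is_derive_mull x.2 (is_derive_idfun u))))))).
  by field; rewrite gt_eqF.
have cL : {within `[0, U], continuous L}.
  apply: continuous_subspaceT => x; apply: cvgD.
    apply: cvgB; last by apply: cvgMr; exact: cvg_id.
    apply: cvgV; first by rewrite gt_eqF// gauss_abs_gt0.
    apply: (@continuous_comp _ _ _ (@Num.sqrt R)
      (fun y => gauss_abs (touching_point y))); first exact: sqrt_continuous.
    apply: is_derive_continuous.
    exact: is_derive_compose (is_derive_gauss_abs _) (is_derive_touching_point _).
  apply: is_derive_continuous; apply: is_derive_bigsum => y /p0[y1 y2].
have L0 : L 0 = 1.
  rewrite /L /conjugate_inv sqrtr0 touching_point0 gauss_abs0 invr1 mulr0 subr0.
  rewrite big1 ?addr0// => x _.
  by rewrite mulr0 oppr0 expR0 subrr mulr0.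
have : L U <= L 0.
  rewrite -lerN2.
  apply: (@ge0_is_derive_le _ (fun u => - L u)
    (fun u => - (- (polar_curvature (Num.sqrt u) / 2) - e / 2 + g u / 2)) 0 U (ltW U0)).
  - by move=> u /dL; exact: is_derive_opp.
  - by move=> u; apply: cvgN; exact: cL.
  - move=> u /andP[u0 uU]; have uU' : 0 <= u <= U by rewrite !ltW.
    have := gG u uU'; rewrite ler_norml => /andP[_]; lra.
rewrite L0 /L => HL.
have /andP[k0 _] := conjugate_inv_bounds U.
have -> : 1 + e * U / 2 = 1 + e / 2 * U by ring.
(* With z = x.2 * U, this is z / (1 + z) <= 1 - exp (- z), termwise: the raised rate costs no more
   than truncating the integral at U. *)
suff : \sum_(x <- p) x.1 * (2 * (x.2 + U^-1))^-1 <=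
  \sum_(x <- p) x.1 / (2 * x.2) * (1 - expR (- (x.2 * U))) by lra.
rewrite !big_seq; apply: ler_sum => x /p0[x1 x2].
rewrite -mulrA ler_wpM2l//.
have xU0 : 0 < x.2 * U by rewrite mulr_gt0.
rewrite ler_pdivlMl ?mulr_gt0// ler_pdivrMr ?mulr_gt0 ?addr_gt0 ?invr_gt0//.
have := expR_ge1Dx (x.2 * U); rewrite expRN.
have E0 := expR_gt0 (x.2 * U); move: (expR _) E0 => E E0.
have : x.2 = x.2 * U * U^-1 by rewrite mulfK// gt_eqF.
move: (x.2 * U) xU0 => z z0 -> zE.
have -> : 2 * (z / U) = 2 / U * z by ring.
have -> : (1 - E^-1) * (2 * (z / U + U^-1)) = 2 / U * ((1 - E^-1) * (z + 1)) by ring.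
rewrite ler_wpM2l ?divr_ge0 ?(ltW U0)//.
have : (z + 1) / E <= 1 by rewrite ler_pdivrMr// mul1r addrC.
rewrite mulrBl mul1r (mulrC E^-1); lra.
Qed.

Lemma mean_value_comparison (f g df dg : R -> R) (c x y : R) : x <= y ->
  (forall z, x <= z <= y -> is_derive z 1 f (df z)) ->
  (forall z, x <= z <= y -> is_derive z 1 g (dg z)) ->
  (forall z, x <= z <= y -> `|df z - dg z| <= c) ->
  `|(f y - g y) - (f x - g x)| <= c * (y - x).
Proof.
move=> xy fdf gdg dfdg.
have [||z] := @MVT_segment _ (fun z => f z - g z) (fun z => df z - dg z) _ _ xy.
- move=> z; rewrite in_itv/= => /andP[xz zy].
  by apply: is_derive_sub; [apply: fdf|apply: gdg]; rewrite !ltW.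
- apply/continuous_in_subspaceT => z; rewrite inE/= in_itv/= => xzy.
  exact: is_derive_continuous (is_derive_sub (fdf _ xzy) (gdg _ xzy)).
rewrite in_itv/= => /dfdg dz ->.
by rewrite normrM (ger0_norm (_ : 0 <= y - x)) ?subr_ge0// ler_wpM2r ?subr_ge0.
Qed.

(** On [0, T] the second derivatives are close and are integrated twice; beyond T both slopes are
    nearly constant. The bound relative to 1 + |s| is the one that homogenises to a multiple of the
    Euclidean norm. *)
Lemma polar_profile_mixture e : 0 < e -> exists (k : R) (p : seq (R * R)),
  [/\ 0 <= k, forall x, x \in p -> 0 <= x.1 /\ 0 < x.2 &
    forall s, `|polar_profile s - (k + \sum_(x <- p) x.1 * gauss_abs (x.2 * s))| <=
      e * (1 + `|s|)].
Proof.
wlog e1 : e / e <= 1 => [H e0|e0].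
  have [e1|/ltW e1] := leP e 1; first exact: H.
  have [||k [p [k0 p0 kp]]] := H 1 => //.
  exists k, p; split => // s; apply: (le_trans (kp s)).
  by rewrite ler_wpM2r// addr_ge0.
(* Beyond T the slopes may differ by a further 2 / T <= e / 2. *)
pose T := 4 / e + 1.
have T0 : 0 < T by rewrite addr_gt0 ?divr_gt0.
have T1 : 1 <= T by rewrite lerDr divr_ge0 ?ltW.
have Te : 2 / T <= e / 2.
  rewrite ler_pdivrMr// /T.
  have -> : e / 2 * (4 / e + 1) = 2 + e / 2 by field; rewrite gt_eqF.
  by rewrite lerDl divr_ge0 ?(ltW e0).
clearbody T.
(* Makes 3 * T ^ 4 / U = e / 8, where 3 * T ^ 2 / U bounds the effect of the raised rates on
   [0, T]. *)
pose U := 24 * T ^+ 4 / e.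
have U0 : 0 < U by rewrite divr_gt0// mulr_gt0// exprn_gt0.
have T41 : T ^+ 2 <= T ^+ 4 by rewrite ler_weXn2l.
have T20 : 0 <= T ^+ 2 by rewrite sqr_ge0.
have UT : T ^+ 2 <= U.
  rewrite ler_pdivlMr//; have : T ^+ 2 * e <= T ^+ 2 by rewrite ler_piMr.
  lra.
have U3 : 3 * T ^+ 4 / U = e / 8.
  by rewrite /U; field; rewrite !gt_eqF.
have U1 : 1 <= U by have : 1 <= T ^+ 2 by [rewrite exprn_ege1]; lra.
clearbody U.
(* Makes d * U = e / 8, so that Q 0 exceeds 1 by at most e / 16. *)
pose d := e / (8 * U).
have d0 : 0 < d by rewrite divr_gt0// mulr_gt0.
have dU : d * U = e / 8 by rewrite /d; field; rewrite gt_eqF.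
have d1 : d <= 1 by rewrite /d ler_pdivrMr ?mulr_gt0//; lra.
clearbody d.
have [g [p [p0 gE]] gG] := polar_curvature_exp_sum (ltW U0) d0.
have mass := mixture_mass U0 (ltW d0) p0 gE gG.
have l0 (x : R * R) : x \in p -> 0 < x.2 + U^-1.
  by move=> /p0[_ x2]; rewrite addr_gt0 ?invr_gt0.
pose Q s := \sum_(x <- p) x.1 * mixture_term (x.2 + U^-1) s.
pose Q' s := \sum_(x <- p) x.1 * mixture_slope (x.2 + U^-1) s.
pose Q'' s := \sum_(x <- p) x.1 * expR (- ((x.2 + U^-1) * s ^+ 2)).
have dQ s : is_derive s 1 Q (Q' s).
  by apply: is_derive_bigsum => x xp; apply: is_derive_mull; exact: is_derive_mixture_term.
have dQ' s : is_derive s 1 Q' (Q'' s).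
  apply: is_derive_bigsum => x xp; apply: is_derive_mull.
  by apply: is_derive_mixture_slope; exact: l0.
have Q''E s : Q'' s = expR (- (U^-1 * s ^+ 2)) * g (s ^+ 2).
  rewrite gE mulr_sumr; apply: eq_bigr => x _.
  by rewrite [in RHS]mulrCA -expRD -opprD -mulrDl (addrC U^-1).
have Q0 : Q 0 = \sum_(x <- p) x.1 * (2 * (x.2 + U^-1))^-1.
  by apply: eq_bigr => x _; rewrite mixture_term0.
have Q'0 : Q' 0 = 0 by rewrite /Q' big1// => x _; rewrite mixture_slope0 mulr0.
rewrite -Q0 in mass.
have Qleg s : Q s - s * Q' s =
    \sum_(x <- p) x.1 * ((2 * (x.2 + U^-1))^-1 * expR (- ((x.2 + U^-1) * s ^+ 2))).
  rewrite /Q /Q' mulr_sumr -sumrB big_seq [in RHS]big_seq; apply: eq_bigr => x /l0 xl.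
  by rewrite -mixture_legendre ?(ltW xl)//; ring.
have Qleg_bounds s : 0 <= Q s - s * Q' s <= Q 0.
  rewrite Qleg Q0 !big_seq; apply/andP; split.
    apply: sumr_ge0 => x xp; have [x1 _] := p0 _ xp; have xl := l0 _ xp.
    by rewrite !mulr_ge0 ?invr_ge0 ?expR_ge0 ?mulr_ge0 ?(ltW xl).
  apply: ler_sum => x xp; have [x1 _] := p0 _ xp; have xl := l0 _ xp.
  rewrite ler_wpM2l// ler_piMr ?invr_ge0 ?mulr_ge0 ?(ltW xl)//.
  by rewrite -[leRHS]expR0 ler_expR oppr_le0 mulr_ge0 ?sqr_ge0 ?(ltW xl).
have Q00 : 0 <= Q 0 by have /andP[h1 h2] := Qleg_bounds 0; apply: le_trans h2.
(* Error of the second derivative on [0, T]: d comes from g, the rest from 1 - exp (- s ^ 2 / U) <=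
   T ^ 2 / U and g <= 3. *)
pose b := d + 3 * T ^+ 2 / U.
have b0 : 0 <= b.
  apply: addr_ge0; first exact: ltW.
  by apply: divr_ge0; [exact: mulr_ge0|exact: ltW].
have bT2 : b * T ^+ 2 <= e / 4.
  have -> : b * T ^+ 2 = d * T ^+ 2 + 3 * T ^+ 4 / U by rewrite /b; ring.
  have : d * T ^+ 2 <= e / 8 by rewrite -dU ler_wpM2l// ltW.
  lra.
have g3 u : 0 <= u <= U -> 0 <= g u <= 3.
  move=> uU; apply/andP; split.
    rewrite gE big_seq; apply: sumr_ge0 => x /p0[x1 _].
    by rewrite mulr_ge0// expR_ge0.
  have := gG _ uU; rewrite ler_norml => /andP[_].
  have := polar_curvature_le (lexx 0) (sqrtr_ge0 u); rewrite polar_curvature0.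
  have := pi_le4; lra.
have curv_near s : 0 <= s <= T -> `|polar_curvature s - Q'' s| <= b.
  move=> /andP[s0 sT].
  have sU : 0 <= s ^+ 2 <= U.
    by rewrite sqr_ge0/= (le_trans _ UT)// lerXn2r ?nnegrE// ltW.
  have := gG _ sU; rewrite sqrtr_sqr (ger0_norm s0) => gs.
  have /andP[gs0 gs3] := g3 _ sU.
  rewrite Q''E; set E := expR _.
  have -> : polar_curvature s - E * g (s ^+ 2) =
    (polar_curvature s - g (s ^+ 2)) + (1 - E) * g (s ^+ 2) by ring.
  rewrite (le_trans (ler_normD _ _))// /b lerD//; first by rewrite distrC.
  have sU0 : 0 <= U^-1 * s ^+ 2 by rewrite mulr_ge0 ?sqr_ge0 ?invr_ge0 ?(ltW U0).
  have E1 : 0 <= 1 - E by rewrite subr_ge0 -[leRHS]expR0 ler_expR oppr_le0.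
  rewrite ger0_norm ?mulr_ge0//.
  have -> : 3 * T ^+ 2 / U = T ^+ 2 / U * 3 by ring.
  rewrite ler_pM//.
  have : 1 - U^-1 * s ^+ 2 <= E by rewrite (le_trans _ (expR_ge1Dx _)).
  have : U^-1 * s ^+ 2 <= T ^+ 2 / U.
    by rewrite mulrC ler_wpM2r ?invr_ge0 ?(ltW U0)// lerXn2r ?nnegrE// ltW.
  lra.
have slope_near s : 0 <= s <= T -> `|polar_slope s - Q' s| <= b * s.
  move=> /andP[s0 sT].
  have := @mean_value_comparison polar_slope Q' polar_curvature Q'' b 0 s s0
    (fun z _ => is_derive_polar_slope z) (fun z _ => dQ' z).
  rewrite polar_slope0 Q'0 !subr0; apply => z /andP[z0 zs].
  by apply: curv_near; rewrite z0 (le_trans zs).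
have Q''0 s : 0 <= Q'' s.
  rewrite /Q'' big_seq; apply: sumr_ge0 => x /p0[x1 _].
  by rewrite mulr_ge0// expR_ge0.
have Q'mono s : T <= s -> Q' T <= Q' s.
  move=> Ts; apply: (ge0_is_derive_le_everywhere Ts) => z _; exact: Q''0.
have Q'far s : T <= s -> Q' s <= Q' T + 2 / T.
  (* [J] has derivative Q'' (z / T - 1), nonnegative beyond T. Hence Q' gains there at most T^-1 *
     (Q T - T Q' T) <= Q 0 / T <= 2 / T. *)
  move=> Ts; pose J z : R := - (Q' z + T^-1 * (Q z - z * Q' z)).
  have dJ (z : R) : is_derive z 1 J (Q'' z * (z / T - 1)).
    apply: (is_derive_cast (is_derive_opp (is_derive_add (dQ' z)
      (is_derive_mull T^-1 (is_derive_sub (dQ z)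
         (is_derive_mul (is_derive_idfun z) (dQ' z))))))).
    by ring.
  have : J T <= J s.
    apply: (ge0_is_derive_le_everywhere Ts) => z /andP[Tz _].
    by rewrite mulr_ge0// subr_ge0 ler_pdivlMr// mul1r ltW.
  have /andP[hs _] := Qleg_bounds s; have /andP[_ hT] := Qleg_bounds T.
  have : 0 <= T^-1 * (Q s - s * Q' s) by rewrite mulr_ge0// invr_ge0 ltW.
  have : T^-1 * (Q T - T * Q' T) <= 2 / T.
    rewrite mulrC ler_wpM2r ?invr_ge0 ?(ltW T0)//; lra.
  rewrite /J; lra.
have slope_far s : 0 <= s -> `|polar_slope s - Q' s| <= b * T + 2 / T.
  move=> s0; have T20' : 0 <= 2 / T by rewrite divr_ge0 ?(ltW T0).
  have [sT|/ltW Ts] := leP s T.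
    rewrite (le_trans (slope_near s _)) ?s0// ler_wpDr// ler_wpM2l//.
  (* Beyond T the slope F' lies between 1 - 1 / T and 1, while Q' increases by at most 2 / T. *)
  have TT : 0 <= T <= T by rewrite lexx ltW.
  have := slope_near T TT; rewrite ler_norml => /andP[h1 h2].
  have := Q'mono _ Ts; have := Q'far _ Ts.
  have := polar_slope_ge T0; have := polar_slope_le1 s.
  have : polar_slope T <= polar_slope s.
    have /andP[] := polar_slope_increment (ltW T0) Ts.
    have := polar_curvature_ge0 s => c0 h _; rewrite -subr_ge0 (le_trans _ h)//.
    by rewrite mulr_ge0// subr_ge0.
  have -> : 2 / T = T^-1 + T^-1 by ring.
  have : 0 <= T^-1 by rewrite invr_ge0 ltW.
  rewrite ler_norml; lra.
have bT0 : 0 <= b * T by rewrite mulr_ge0// ltW.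
have bTe : b * T <= e / 4.
  by apply: le_trans bT2; rewrite expr2 mulrA ler_peMr.
have value s : 0 <= s ->
    `|polar_profile s - Q s - (1 - Q 0)| <= e * 3 / 4 * s.
  move=> s0.
  have := @mean_value_comparison polar_profile Q polar_slope Q' (b * T + 2 / T) 0 s s0
    (fun z _ => is_derive_polar_profile z) (fun z _ => dQ z).
  rewrite polar_profile0 subr0 => H; apply: le_trans (H _) _.
    by move=> z /andP[z0 _]; exact: slope_far.
  by rewrite ler_wpM2r//; lra.
(* The values at 0 call for the constant 1 - Q 0, which may be slightly negative; truncation at 0
   costs at most e / 16. *)
exists (Num.max 0 (1 - Q 0)),
  [seq (x.1 / (2 * (x.2 + U^-1)), gauss_scale (x.2 + U^-1)) | x <- p].
split.
- by rewrite le_max lexx.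
- move=> y /mapP[x xp ->]/=; have [x1 x2] := p0 _ xp; have xl := l0 _ xp.
  by rewrite divr_ge0 ?mulr_ge0 ?(ltW xl)// gauss_scale_gt0.
move=> s; wlog s0 : s / 0 <= s => [H|].
  have [/H//|/ltW s0] := leP 0 s.
  have := H (- s); rewrite oppr_ge0 normrN polar_profileN => /(_ s0).
  by under eq_bigr do rewrite mulrN gauss_absN.
rewrite big_map (ger0_norm s0)/=.
rewrite (_ : \sum_(x <- p) _ = Q s); last first.
  by apply: eq_bigr => x _; rewrite /mixture_term mulrA.
have := value _ s0; set V := polar_profile s.
have -> : V - (Num.max 0 (1 - Q 0) + Q s) =
  (V - Q s - (1 - Q 0)) - (Num.max 0 (1 - Q 0) - (1 - Q 0)) by ring.
move=> h; rewrite (le_trans (ler_normB _ _))//.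
have : `|Num.max 0 (1 - Q 0) - (1 - Q 0)| <= e / 16.
  case: (leP 0 (1 - Q 0)) => h'; first by rewrite subrr normr0 divr_ge0 ?(ltW e0).
  by rewrite sub0r normrN ltr0_norm//; lra.
have : 0 <= e * s by rewrite mulr_ge0// ltW.
lra.
Qed.

End polar_profile_mixture.

(** * Integration against a measure with a density *)

Section density.
Local Open Scope ereal_scope.
Context d (T : measurableType d) (R : realType).
Variables (mu nu : {measure set T -> \bar R}) (g : T -> R).
Hypotheses (g0 : forall x, (0 <= g x)%R) (mg : measurable_fun setT g).
Hypothesis nuE : forall A, measurable A -> nu A = \int[mu]_(x in A) (g x)%:E.
Import HBNNSimple.

(** Both sides are monotone limits along simple functions, for which linearity reduces the claim to
    [nuE]. *)
Lemma ge0_integral_density (f : T -> \bar R) : (forall x, 0 <= f x) ->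
  measurable_fun setT f -> \int[nu]_x f x = \int[mu]_x (f x * (g x)%:E).
Proof.
move=> f0 mf; pose h := nnsfun_approx measurableT mf.
have mgE : measurable_fun setT (fun x => (g x)%:E) by exact/measurable_EFinP.
have mh n : measurable_fun setT (EFin \o h n) by exact/measurable_EFinP/measurable_funP.
have -> : \int[nu]_x f x = lim (\int[nu]_x (h n x)%:E @[n --> \oo]).
  rewrite -monotone_convergence//.
  - apply: eq_integral => x _; apply/esym/cvg_lim => //.
    by apply: cvg_nnsfun_approx => // ? _.
  - by move=> n x _; rewrite lee_fin.
  - by move=> x _ a b ab; rewrite lee_fin; exact/lefP/nd_nnsfun_approx.
have -> : \int[mu]_x (f x * (g x)%:E) =
    lim (\int[mu]_x ((h n x)%:E * (g x)%:E) @[n --> \oo]).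
  rewrite -monotone_convergence//.
  - apply: eq_integral => x _; apply/esym/cvg_lim => //.
    apply: cvgeZr => //.
    by apply: cvg_nnsfun_approx => // ? _.
  - by move=> n; apply: emeasurable_funM => //; exact: mh.
  - by move=> n x _; rewrite mule_ge0// lee_fin.
  - move=> x _ a b ab; rewrite lee_wpmul2r ?lee_fin//.
    exact/lefP/nd_nnsfun_approx.
congr (lim (_ @ \oo)); apply/funext => n.
have ind r : measurable_fun setT (fun x => (r * \1_(h n @^-1` [set r]) x)%:E : \bar R).
  by apply/measurable_EFinP/measurable_funM.
transitivity (\int[nu]_x (\sum_(y \in range (h n)) (y * \1_(h n @^-1` [set y]) x)%:E)).
  by apply: eq_integral => t _; rewrite /= fimfunE -fsumEFin.
rewrite ge0_integral_fsum//; last by move=> m y _; exact: nnfun_muleindic_ge0.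
transitivity (\int[mu]_x (\sum_(y \in range (h n))
    (y * \1_(h n @^-1` [set y]) x)%:E * (g x)%:E)); last first.
  apply: eq_integral => x _.
  rewrite -ge0_mule_fsuml => [|y]; last exact: nnfun_muleindic_ge0.
  by rewrite fsumEFin// -(fimfunE _ x).
rewrite ge0_integral_fsum//; last 2 first.
- by move=> y; apply: emeasurable_funM.
- by move=> m y _; rewrite mule_ge0 ?lee_fin//; exact: nnfun_muleindic_ge0.
apply: eq_fsbigr => r rh.
have r0 : (0 <= r)%R by move: rh; rewrite inE => -[x _ <-].
under eq_integral do rewrite EFinM.
under [RHS]eq_integral do rewrite EFinM -muleA.
rewrite ge0_integralZl_EFin//; last exact/measurable_EFinP.
rewrite ge0_integralZl_EFin//; last 2 first.
- by move=> x _; rewrite mule_ge0// lee_fin.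
- by apply: emeasurable_funM => //; exact/measurable_EFinP.
congr (_ * _); rewrite integral_indic// setIT nuE//.
rewrite integral_mkcond; apply: eq_integral => x _.
rewrite patchE indicE; case: ifPn => _; first by rewrite mul1e.
by rewrite mul0e.
Qed.

End density.

(** * Means of absolute values under normal laws on the line *)

Section gaussian_means.
Context {R : realType}.
Implicit Types (c m t y : R).
Local Notation mu := (@lebesgue_measure R).

(** The centered normal density of standard deviation c * sqrt (pi / 2); this unit makes phi appear
    without constants. *)
Definition gauss_pdf c y : R := (pi * c)^-1 * gauss_exp (y / c).

(** The mean of |t + c N| with N centered normal of variance pi / 2, that is, phi made homogeneous;
    c = 0 is the point mass. *)
Definition scaled_gauss_abs c t : R :=
  if c == 0 then `|t| else c * gauss_abs (t / c).

Let pi_neq0 : (pi : R) != 0. Proof. by rewrite gt_eqF// pi_gt0. Qed.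

Lemma gauss_pdf_ge0 c y : 0 < c -> 0 <= gauss_pdf c y.
Proof. by move=> c0; rewrite mulr_ge0 ?expR_ge0// invr_ge0 mulr_ge0 ?pi_ge0 ?(ltW c0). Qed.

Lemma gauss_pdfN c y : gauss_pdf c (- y) = gauss_pdf c y.
Proof. by rewrite /gauss_pdf mulNr gauss_expN. Qed.

Lemma continuous_gauss_pdf c : continuous (gauss_pdf c).
Proof.
move=> y; apply: is_derive_continuous (is_derive_mull _
  (is_derive_compose (is_derive_gauss_exp _)
    (is_derive_mul (is_derive_idfun y) (is_derive_const _ c^-1)))).
Qed.

Let A c t m y : R := - (c / 2) * gauss_exp ((y - m) / c)
  + (t + m) / 2 * gauss_erf ((y - m) / c).

Let dA c t m y : 0 < c -> is_derive y 1 (A c t m) ((y + t) * gauss_pdf c (y - m)).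
Proof.
move=> c0.
have dl : is_derive y 1 (fun y => (y - m) / c) c^-1.
  apply: (is_derive_cast (is_derive_mul (is_derive_sub (is_derive_idfun y)
    (is_derive_const y m)) (is_derive_const y c^-1))).
  by rewrite mulr0 addr0 subr0 mul1r.
apply: (is_derive_cast (is_derive_add
  (is_derive_mull (- (c / 2)) (is_derive_compose (is_derive_gauss_exp _) dl))
  (is_derive_mull ((t + m) / 2) (is_derive_compose (is_derive_gauss_erf _) dl)))).
rewrite /gauss_pdf; move: (gauss_exp _) => E.
by move: pi_neq0; move: pi => P P0; field; rewrite P0 gt_eqF.
Qed.

Lemma gauss_exp_cvg0 : gauss_exp y @[y --> +oo] --> (0 : R).
Proof.
have -> : gauss_exp = fun y : R => gauss_fun (y / Num.sqrt pi).
  apply/funext => y; rewrite /gauss_fun /gauss_exp expr_div_n sqr_sqrtr//.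
  exact: pi_ge0.
apply: (cvg_comp (fun y : R => y / Num.sqrt pi) gauss_fun); last exact: cvg_gauss_fun.
by apply/gt0_cvgMly; [rewrite invr_gt0 sqrtr_gt0 pi_gt0|exact: cvg_id].
Qed.

Let cvg_scale c m : 0 < c -> ((y - m) / c) @[y --> +oo] --> +oo.
Proof.
move=> c0; apply/gt0_cvgMly; first by rewrite invr_gt0.
exact: cvg_addrr.
Qed.

(** The mean of the positive part of y + t, computed with the primitive [A]: half the sum of the
    mean and the mean absolute value. *)
Lemma half_mean c t m : 0 < c ->
  (\int[mu]_(y in `[(- t)%R, +oo[) ((y + t) * gauss_pdf c (y - m))%:E =
   (((t + m) + scaled_gauss_abs c (t + m)) / 2)%:E)%E.
Proof.
move=> c0.
rewrite (@ge0_continuous_FTC2y _ _ (A c t m) _ ((t + m) / 2)).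
- rewrite -EFinB; congr EFin; rewrite /A /scaled_gauss_abs gt_eqF//.
  have -> : (- t - m) / c = - ((t + m) / c) by ring.
  rewrite gauss_expN gauss_erfN /gauss_abs; field.
  by rewrite gt_eqF.
- move=> x tx; rewrite mulr_ge0 ?gauss_pdf_ge0//; lra.
- apply: continuous_subspaceT => x; apply: cvgM.
    by apply: cvgD; [exact: cvg_id|exact: cvg_cst].
  apply: (@continuous_comp _ _ _ (fun y => y - m) (gauss_pdf c)).
    by apply: cvgD; [exact: cvg_id|exact: cvg_cst].
  exact: continuous_gauss_pdf.
- rewrite -[X in _ --> X]add0r -[X in _ --> X + _](mulr0 (- (c / 2))).
  rewrite -[X in _ --> _ + X](mulr1 ((t + m) / 2)).
  apply: cvgD; apply: cvgMr.
    exact: (cvg_comp _ _ (cvg_scale m c0) gauss_exp_cvg0).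
  exact: (cvg_comp _ _ (cvg_scale m c0) (@gauss_erf_cvg R)).
- by move=> x _; have [] := dA t m x c0.
- apply/cvg_at_right_filter; exact: is_derive_continuous (dA t m _ c0).
- by move=> x _; have [_ <-] := dA t m x c0; rewrite derive1E.
Qed.

Lemma ge0_integral_opp (f : R -> \bar R) (D : set R) : measurable D ->
  measurable_fun setT f -> (forall y, 0 <= f y)%E ->
  (\int[mu]_(y in D) f y =
    \int[mu]_(y in (-%R : _ -> measurableTypeR R) @^-1` D) f (- y)%R)%E.
Proof.
move=> mD mf f0.
have mN : measurable_fun setT (-%R : measurableTypeR R -> measurableTypeR R) by [].
rewrite -[RHS](@ge0_integral_pushforward _ _ _ _ R _ mN mu D f)//; last exact: measurable_funTS.
by apply: eq_measure_integral => //= B mB BS; exact/esym/lebesgue_measureN.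
Qed.

(** The negative part of y + t becomes a positive part after y -> - y, so two instances of
    [half_mean] add up. *)
Lemma gauss_abs_mean c t m : 0 < c ->
  (\int[mu]_y (`|y + t| * gauss_pdf c (y - m))%:E =
   (scaled_gauss_abs c (t + m))%:E)%E.
Proof.
move=> c0.
have cf : continuous (fun y => `|y + t| * gauss_pdf c (y - m)).
  move=> x; apply: cvgM.
    apply: cvg_norm; by apply: cvgD; [exact: cvg_id|exact: cvg_cst].
  apply: (@continuous_comp _ _ _ (fun y => y - m) (gauss_pdf c)).
    by apply: cvgD; [exact: cvg_id|exact: cvg_cst].
  exact: continuous_gauss_pdf.
have mf : measurable_fun setT (fun y => (`|y + t| * gauss_pdf c (y - m))%:E).
  by apply/measurable_EFinP; exact: continuous_measurable_fun.
have f0 y : 0 <= `|y + t| * gauss_pdf c (y - m) by rewrite mulr_ge0// gauss_pdf_ge0.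
rewrite -(setUv `]-oo, (- t)[%classic) setCitvl ge0_integral_setU//=.
- rewrite integral_itv_bndo_bndc; last exact: measurable_funTS.
  rewrite (ge0_integral_opp (D := `]-oo, (- t)]%classic))//.
  rewrite (_ : _ @^-1` _ = `[t, +oo[%classic); last first.
    by apply/seteqP; split=> x /=; rewrite !in_itv/= ?andbT lerN2.
  transitivity (((- t - m) + scaled_gauss_abs c (- t - m)) / 2 + 
    ((t + m) + scaled_gauss_abs c (t + m)) / 2)%:E; last first.
    congr EFin; rewrite -opprD /scaled_gauss_abs gt_eqF// mulNr gauss_absN; lra.
  rewrite EFinD; congr (_ + _)%E.
    rewrite -half_mean// opprK; apply: eq_integral => y; rewrite inE/= in_itv/= andbT => ty.
    rewrite -opprD gauss_pdfN opprK (addrC y m); congr ((_ * gauss_pdf c _)%:E).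
    by rewrite addrC distrC ger0_norm// subr_ge0.
  rewrite -half_mean//; apply: eq_integral => y; rewrite inE/= in_itv/= andbT => ty.
  by rewrite ger0_norm//; lra.
- exact: measurable_funTS.
- by move=> x _; rewrite lee_fin.
- by apply/disj_setPS => x /=; rewrite !in_itv/= => -[]; rewrite andbT; lra.
Qed.

End gaussian_means.

(** * Moments and convolutions of normal laws *)

Section gaussian_moments.
Context {R : realType}.
Implicit Types (c m t y a : R).
Local Notation mu := (@lebesgue_measure R).

Let pi_neq0 : (pi : R) != 0. Proof. by rewrite gt_eqF// pi_gt0. Qed.

Lemma measurable_gauss_pdf c : measurable_fun setT (gauss_pdf c).
Proof. by apply: continuous_measurable_fun; exact: continuous_gauss_pdf. Qed.

(** A substitute for the first moment with a nonnegative integrand; it serves to find the mean of an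
    unknown normal law. *)
Lemma gauss_pos_mean c m : 0 < c ->
  (\int[mu]_y ((`|y| + y) * gauss_pdf c (y - m))%:E =
   (m + scaled_gauss_abs c m)%:E)%E.
Proof.
move=> c0; have := half_mean 0 m c0; rewrite oppr0 !add0r => H.
have -> : m + scaled_gauss_abs c m = 2 * ((m + scaled_gauss_abs c m) / 2).
  by rewrite mulrC divfK.
rewrite EFinM -H -ge0_integralZl_EFin//.
- rewrite [RHS]integral_mkcond; apply: eq_integral => y _.
  have [y0|y0] := leP 0 y; rewrite patchE.
    rewrite mem_set/= ?in_itv/= ?y0// ger0_norm// addr0 -EFinM; congr EFin; ring.
  rewrite memNset/= ?in_itv/= ?andbT ?leNgt ?y0//.
  by rewrite ltr0_norm ?addNr ?mul0r.
- by move=> y /=; rewrite in_itv/= andbT => y0; rewrite lee_fin addr0 mulr_ge0// gauss_pdf_ge0.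
- apply/measurable_funTS/measurable_EFinP; apply: measurable_funM.
    exact: measurable_funD.
  apply: (measurableT_comp (measurable_gauss_pdf c)).
  exact: measurable_funB.
Qed.

Lemma normal_pdf_gauss_pdf c m y : 0 < c ->
  normal_pdf m (c * Num.sqrt (pi / 2)) y = gauss_pdf c (y - m).
Proof.
move=> c0; set s := c * _.
have s2 : s ^+ 2 = c ^+ 2 * (pi / 2) by rewrite exprMn sqr_sqrtr// divr_ge0 ?pi_ge0.
have s0 : s != 0 by rewrite mulf_neq0 ?gt_eqF// sqrtr_gt0 divr_gt0 ?pi_gt0.
rewrite normal_pdfE// /normal_peak /normal_fun s2 /gauss_pdf /gauss_exp.
have -> : c ^+ 2 * (pi / 2) * pi *+ 2 = (pi * c) ^+ 2.
  by rewrite -mulr_natr; field.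
rewrite sqrtr_sqr ger0_norm ?mulr_ge0 ?pi_ge0 ?(ltW c0)//; congr (_ * expR _).
by rewrite -(mulr_natr (c ^+ 2 * _)); move: pi_neq0; move: pi => P P0; field; rewrite P0 gt_eqF.
Qed.

Lemma integral_gauss_pdf c m : 0 < c ->
  (\int[mu]_y (gauss_pdf c (y - m))%:E = 1)%E.
Proof.
move=> c0; rewrite -(integral_normal_pdf m (c * Num.sqrt (pi / 2))).
by apply: eq_integral => y _; rewrite normal_pdf_gauss_pdf.
Qed.

Let B c y : R := - (c / 2) * (y * gauss_exp (y / c)) + pi * c ^+ 2 / 4 * gauss_erf (y / c).

Let dB c y : 0 < c -> is_derive y 1 (B c) (y ^+ 2 * gauss_pdf c y).
Proof.
move=> c0.
have dl : is_derive y 1 (fun y => y / c) c^-1.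
  apply: (is_derive_cast (is_derive_mul (is_derive_idfun y) (is_derive_const y c^-1))).
  by rewrite mulr0 addr0 mul1r.
apply: (is_derive_cast (is_derive_add
  (is_derive_mull (- (c / 2)) (is_derive_mul (is_derive_idfun y)
     (is_derive_compose (is_derive_gauss_exp _) dl)))
  (is_derive_mull (pi * c ^+ 2 / 4) (is_derive_compose (is_derive_gauss_erf _) dl)))).
rewrite /gauss_pdf; move: (gauss_exp _) => E.
by move: pi_neq0; move: pi => P P0; field; rewrite P0 gt_eqF.
Qed.

Lemma mul_gauss_exp_cvg0 : (y * gauss_exp y) @[y --> +oo] --> (0 : R).
Proof.
have cpi : (pi / y) @[y --> +oo] --> (0 : R).
  rewrite -[X in _ --> X](mulr0 pi); apply: cvgMr.
  apply/(@gtr0_cvgV0 _ _ _ _ (fun y : R => y)); last exact: cvg_id.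
  by apply: nbhs_pinfty_gt; exact: num_real.
apply: (@squeeze_cvgr _ _ _ _ (fun=> 0) (fun y => pi / y)) => //; last exact: cvg_cst.
near=> y.
have y0 : 0 < y by near: y; apply: nbhs_pinfty_gt; exact: num_real.
rewrite mulr_ge0 ?(ltW y0) ?(ltW (gauss_exp_gt0 _))//=.
have z0 : 0 < y ^+ 2 / pi by rewrite divr_gt0 ?exprn_gt0// pi_gt0.
rewrite /gauss_exp expRN ler_pdivlMr// mulrAC ler_pdivrMr ?expR_gt0//.
rewrite -expr2 mulrC -ler_pdivrMr ?pi_gt0//.
by rewrite (le_trans _ (expR_ge1Dx _))// lerDr.
Unshelve. all: end_near. Qed.

Lemma gauss_second_moment c : 0 < c ->
  (\int[mu]_y (y ^+ 2 * gauss_pdf c y)%:E = (pi / 2 * c ^+ 2)%:E)%E.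
Proof.
move=> c0.
have cf : continuous (fun y => y ^+ 2 * gauss_pdf c y).
  by move=> x; apply: cvgM; [exact: exprn_continuous|exact: continuous_gauss_pdf].
have cvg_scale : (y / c) @[y --> +oo] --> +oo.
  by apply/gt0_cvgMly; [rewrite invr_gt0|exact: cvg_id].
rewrite ge0_symfun_integralT//.
- rewrite (_ : [set x | 0 <= x] = `[0, +oo[%classic); last first.
    by apply/seteqP; split=> x /=; rewrite in_itv/= andbT.
  rewrite (@ge0_continuous_FTC2y _ _ (B c) _ (pi * c ^+ 2 / 4)).
  + by rewrite -EFinB -EFinM; congr EFin; rewrite /B !mul0r mulr0 gauss_erf0; field.
  + by move=> x _; rewrite mulr_ge0 ?sqr_ge0// gauss_pdf_ge0.
  + exact: continuous_subspaceT.
  + rewrite -[X in _ --> X]add0r -[X in _ --> X + _](mulr0 (- (c / 2) * c)).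
    rewrite -[X in _ --> _ + X](mulr1 (pi * c ^+ 2 / 4)).
    apply: cvgD; last first.
      by apply: cvgMr; exact: (cvg_comp _ _ cvg_scale (@gauss_erf_cvg R)).
    rewrite (_ : (fun _ => _) = fun y => - (c / 2) * c * (y / c * gauss_exp (y / c))).
      by apply: cvgMr; exact: (cvg_comp _ _ cvg_scale mul_gauss_exp_cvg0).
    by apply/funext => y; field; rewrite gt_eqF.
  + by move=> x _; have [] := dB x c0.
  + apply/cvg_at_right_filter; exact: is_derive_continuous (dB _ c0).
  + by move=> x _; have [_ <-] := dB x c0; rewrite derive1E.
- by move=> x; rewrite mulr_ge0 ?sqr_ge0// gauss_pdf_ge0.
- by move=> x /=; rewrite sqrrN gauss_pdfN.
Qed.

Let sum_sqr_gt0 a b c : 0 < b -> 0 < b ^+ 2 + a ^+ 2 * c ^+ 2.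
Proof.
move=> b0; apply: ltr_pwDl; first exact: exprn_gt0.
exact: mulr_ge0 (sqr_ge0 _) (sqr_ge0 _).
Qed.

Let gauss_pdf_mul a b c z y (e := Num.sqrt (b ^+ 2 + a ^+ 2 * c ^+ 2)) :
  0 < b -> 0 < c -> gauss_pdf b (y - a * z) * gauss_pdf c z =
  gauss_pdf e y * gauss_pdf (b * c / e) (z - a * c ^+ 2 / e ^+ 2 * y).
Proof.
move=> b0 c0.
have h0 := sum_sqr_gt0 a c b0.
have e0 : 0 < e by rewrite sqrtr_gt0.
have e2 : e ^+ 2 = b ^+ 2 + a ^+ 2 * c ^+ 2 by rewrite sqr_sqrtr// ltW.
rewrite /gauss_pdf /gauss_exp mulrACA [RHS]mulrACA -!expRD; congr (_ * expR _).
  by move: pi_neq0; move: pi => P P0; move: (e) e0 => e' e0'; field; rewrite P0 !gt_eqF.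
have -> : ((z - a * c ^+ 2 / e ^+ 2 * y) / (b * c / e)) ^+ 2 =
  (z - a * c ^+ 2 / e ^+ 2 * y) ^+ 2 * e ^+ 2 / (b * c) ^+ 2.
  by move: (e) e0 => e' e0'; field; rewrite !gt_eqF.
have -> : (y / e) ^+ 2 = y ^+ 2 / e ^+ 2 by rewrite expr_div_n.
rewrite e2; move: pi_neq0; move: pi => P P0.
by field; rewrite P0 exprMn !gt_eqF.
Qed.

(** The left side is the mean of |t + a Z + b N| for independent Z of scale c and N of scale b:
    scales add in squares. When b = 0 the inner law is degenerate and a change of scale suffices. *)
Lemma gauss_abs_convolution a b c t : 0 <= b -> 0 < c ->
  (\int[mu]_z (scaled_gauss_abs b (a * z + t) * gauss_pdf c z)%:E =
   (scaled_gauss_abs (Num.sqrt (b ^+ 2 + a ^+ 2 * c ^+ 2)) t)%:E)%E.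
Proof.
move=> b0 c0; have [->|bn0] := eqVneq b 0.
  rewrite expr0n add0r -exprMn sqrtr_sqr normrM (gtr0_norm c0).
  have [->|a0] := eqVneq a 0.
    rewrite normr0 mul0r /scaled_gauss_abs eqxx.
    under eq_integral do rewrite mul0r add0r EFinM.
    rewrite ge0_integralZl_EFin//.
    - rewrite -[RHS]mule1 -(integral_gauss_pdf 0 c0); congr (_ * _)%E.
      by apply: eq_integral => z _; rewrite subr0.
    - by move=> z _; rewrite lee_fin gauss_pdf_ge0.
    - by apply/measurable_EFinP; exact: measurable_gauss_pdf.
  have aE (z : R) : `|a * z + t| = `|a| * `|z + t / a|.
    by rewrite -normrM; congr `|_|; field.
  have na0 : 0 < `|a| by rewrite normr_gt0.
  transitivity (`|a|%:E * \int[mu]_z (`|z + t / a| * gauss_pdf c (z - 0))%:E)%E.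
    rewrite -ge0_integralZl_EFin//.
    - apply: eq_integral => z _; rewrite -EFinM /scaled_gauss_abs eqxx subr0.
      by rewrite aE -mulrA.
    - by move=> z _; rewrite lee_fin mulr_ge0// gauss_pdf_ge0.
    - apply/measurable_EFinP; apply: measurable_funM.
        by apply: measurableT_comp => //; exact: measurable_funD.
      apply: (measurableT_comp (measurable_gauss_pdf c)); exact: measurable_funB.
  rewrite gauss_abs_mean// addr0 -EFinM; congr EFin.
  rewrite /scaled_gauss_abs !gt_eqF ?mulr_gt0//; rewrite mulrA; congr (_ * _).
  have [a0'|a0'] := leP 0 a; first by rewrite ger0_norm// invfM mulrA.
  by rewrite ltr0_norm// -gauss_absN invfM invrN; congr gauss_abs; ring.
have {bn0} {}b0 : 0 < b by rewrite lt_neqAle eq_sym bn0.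
set e := Num.sqrt _.
have e0 : 0 < e by rewrite sqrtr_gt0 sum_sqr_gt0.
pose F (p : measurableTypeR R * measurableTypeR R) : \bar R :=
  (`|p.2 + t| * (gauss_pdf b (p.2 - a * p.1) * gauss_pdf c p.1))%:E.
have mF : measurable_fun setT F.
  apply/measurable_EFinP; apply: measurable_funM.
    by apply: measurableT_comp => //; apply: measurable_funD => //; exact: measurable_snd.
  apply: measurable_funM.
    apply: (measurableT_comp (measurable_gauss_pdf b)).
    apply: measurable_funB; first exact: measurable_snd.
    by apply: measurable_funM => //; exact: measurable_fst.
  apply: (measurableT_comp (measurable_gauss_pdf c)); exact: measurable_fst.
have F0 p : (0 <= F p)%E by rewrite lee_fin mulr_ge0// mulr_ge0 ?gauss_pdf_ge0.
transitivity (\int[mu]_z \int[mu]_y F (z, y))%E.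
  apply: eq_integral => z _; rewrite EFinM addrC -gauss_abs_mean// muleC.
  rewrite -ge0_integralZl_EFin//.
  - by apply: eq_integral => y _; rewrite /F -EFinM/=; congr EFin; ring.
  - by move=> y _; rewrite lee_fin mulr_ge0// gauss_pdf_ge0.
  - apply/measurable_EFinP; apply: measurable_funM.
      by apply: measurableT_comp => //; exact: measurable_funD.
    apply: (measurableT_comp (measurable_gauss_pdf b)); exact: measurable_funB.
  - exact: gauss_pdf_ge0.
rewrite (fubini_tonelli F)//.
transitivity (\int[mu]_y (`|y + t| * gauss_pdf e (y - 0))%:E)%E; last first.
  by rewrite gauss_abs_mean// addr0.
apply: eq_integral => y _; rewrite subr0 /F/=.
under eq_integral do rewrite gauss_pdf_mul// mulrA EFinM.
rewrite ge0_integralZl_EFin//.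
- by rewrite integral_gauss_pdf ?mule1// divr_gt0// mulr_gt0.
- by move=> z _; rewrite lee_fin gauss_pdf_ge0// divr_gt0// mulr_gt0.
- apply/measurable_EFinP.
  apply: (measurableT_comp (measurable_gauss_pdf _)); exact: measurable_funB.
- by rewrite mulr_ge0// gauss_pdf_ge0.
Qed.

End gaussian_moments.

(** * The Euclidean norm *)

Section euclidean.
Context {R : realType}.

Lemma dot_ge0 k (u : 'rV[R]_k) : 0 <= dot u u.
Proof. by apply: sumr_ge0 => i _; rewrite -expr2 sqr_ge0. Qed.

Lemma enorm_ge0 k (u : 'rV[R]_k) : 0 <= enorm u.
Proof. exact: sqrtr_ge0. Qed.

Lemma sqr_enorm k (u : 'rV[R]_k) : enorm u ^+ 2 = dot u u.
Proof. by rewrite sqr_sqrtr// dot_ge0. Qed.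

Lemma enorm_eq0 k (u : 'rV[R]_k) : (enorm u == 0) = (u == 0).
Proof.
rewrite -sqrf_eq0 sqr_enorm psumr_eq0; last by move=> i _; rewrite -expr2 sqr_ge0.
apply/allP/eqP => [H|-> i _]; last by rewrite mxE mul0r eqxx.
apply/rowP => i; rewrite mxE; have := H i (mem_index_enum i).
by rewrite /= -expr2 sqrf_eq0 => /eqP.
Qed.

End euclidean.

(** * Means under the Gaussian measure on tuples *)

Section gaussian_tuples.
Context {R : realType}.
Local Notation mu := (@lebesgue_measure R).
Implicit Types (l t : R).

Lemma measurable_dot_vec k (x : 'rV[R]_k) :
  measurable_fun setT (fun z : Rtuple R k => dot x (vec z)).
Proof.
rewrite (_ : (fun _ => _) = fun z : Rtuple R k => \sum_(i < k) x 0 i * tnth z i).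
  by apply: measurable_sum => i; apply: measurable_funM => //; exact: measurable_tnth.
by apply/funext => z; apply: eq_bigr => i _; rewrite mxE.
Qed.

Let pi_neq0 : (pi : R) != 0. Proof. by rewrite gt_eqF// pi_gt0. Qed.

Lemma gauss_scaleV_gt0 l : 0 < l -> 0 < (gauss_scale l)^-1.
Proof. by move=> l0; rewrite invr_gt0 gauss_scale_gt0. Qed.

Lemma enorm_vec_cons k y (z : Rtuple R k) :
  enorm (vec (tuple_cons (y, z))) ^+ 2 = y ^+ 2 + enorm (vec z) ^+ 2.
Proof.
rewrite !sqr_enorm /dot big_ord_recl !mxE tnth0 expr2; congr (_ + _).
by apply: eq_bigr => i _; rewrite !mxE !tnthS.
Qed.

Lemma dot_vec_cons k (x : 'rV[R]_k.+1) y (z : Rtuple R k) :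
  dot x (vec (tuple_cons (y, z))) =
  x 0 ord0 * y + dot (\row_(i < k) x 0 (lift ord0 i)) (vec z).
Proof.
rewrite /dot big_ord_recl mxE tnth0; congr (_ + _).
by apply: eq_bigr => i _; rewrite !mxE tnthS.
Qed.

(** One coordinate has density sqrt (l / pi) exp (- l y ^ 2), which is [gauss_pdf] at scale 1 / sqrt
    (pi l). *)
Lemma gaussian_density_cons l k y (z : Rtuple R k) : 0 < l ->
  gaussian_density l (tuple_cons (y, z)) =
  gauss_pdf (gauss_scale l)^-1 y * gaussian_density l z.
Proof.
move=> l0; have lp0 : 0 < l / pi by rewrite divr_gt0// pi_gt0.
rewrite /gaussian_density enorm_vec_cons.
rewrite mulrDr opprD expRD /gauss_pdf mulrACA; congr (_ * _); last first.
  by rewrite invrK (mulrC y) gauss_exp_scale ?(ltW l0).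
rewrite invfM invrK -natr1 mulrDl addrC powRD; last first.
  by apply/implyP => _; rewrite gt_eqF.
congr (_ * _); rewrite div1r powR12_sqrt ?(ltW lp0)//.
rewrite /gauss_scale -[RHS](ger0_norm (_ : 0 <= _)); last first.
  by rewrite mulr_ge0 ?sqrtr_ge0 ?invr_ge0 ?pi_ge0.
rewrite -sqrtr_sqr exprMn sqr_sqrtr ?mulr_ge0 ?pi_ge0 ?(ltW l0)//.
by congr Num.sqrt; move: pi_neq0; move: pi => P P0; field.
Qed.

(** Induction on the dimension: the first coordinate joins the shift t, and integrating it out adds
    its square to the squared norm of the remaining ones. *)
Let density_mean l k (x : 'rV[R]_k) t : 0 < l ->
  (\int[@lebesgue_tuple R k]_z (`|dot x (vec z) + t| * gaussian_density l z)%:E =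
   (scaled_gauss_abs (enorm x / gauss_scale l) t)%:E)%E.
Proof.
move=> l0.
have mf j (y : 'rV[R]_j) r : measurable_fun setT (fun z : Rtuple R j =>
    (`|dot y (vec z) + r| * gaussian_density l z)%:E).
  apply/measurable_EFinP; apply: measurable_funM; last exact: measurable_gaussian_density.
  by apply: measurableT_comp => //; apply: measurable_funD => //; exact: measurable_dot_vec.
have f0 j (y : 'rV[R]_j) r z :
    (0 <= (`|dot y (vec z) + r| * @gaussian_density R l j z)%:E)%E.
  by rewrite lee_fin mulr_ge0// gaussian_density_ge0.
elim: k x t => [|k IH] x t.
  rewrite /lebesgue_tuple integral_dirac//; last exact: mf.
  rewrite diracE mem_set// mul1e.
  rewrite /gaussian_density /enorm /dot !big_ord0 sqrtr0 !mul0r expr0n/= mulr0 oppr0.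
  by rewrite expR0 powRr0 !mulr1 add0r /scaled_gauss_abs; case: ifPn => //; rewrite eqxx.
rewrite /lebesgue_tuple -/(@lebesgue_tuple R k).
rewrite (ge0_integral_pushforward (@measurable_tuple_cons R k))//; last exact: mf.
rewrite preimage_setT fubini_tonelli1//=; last first.
  exact: (measurableT_comp (mf _ x t) (@measurable_tuple_cons R k)).
pose x' := \row_(i < k) x 0 (lift ord0 i).
transitivity (\int[mu]_y (scaled_gauss_abs (enorm x' / gauss_scale l) (x 0 ord0 * y + t)
   * gauss_pdf (gauss_scale l)^-1 y)%:E)%E.
  apply: eq_integral => y _; rewrite EFinM -IH muleC.
  rewrite -ge0_integralZl_EFin//.
  - apply: eq_integral => z _ /=.
    rewrite gaussian_density_cons// dot_vec_cons -EFinM -/x'.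
    by congr EFin; rewrite mulrCA addrA (addrC (dot x' _)).
  - exact: mf.
  - by rewrite gauss_pdf_ge0// gauss_scaleV_gt0.
rewrite gauss_abs_convolution ?gauss_scaleV_gt0//; last first.
  by rewrite divr_ge0 ?enorm_ge0// ltW// gauss_scale_gt0.
congr (scaled_gauss_abs _ _)%:E.
rewrite exprMn -mulrDl addrC sqrtrM ?addr_ge0 ?sqr_ge0//.
rewrite sqrtr_sqr ger0_norm ?(ltW (gauss_scaleV_gt0 _))//; congr (_ * _).
rewrite /enorm; congr Num.sqrt; rewrite -[X in _ + X]/(Num.sqrt _ ^+ 2) sqr_sqrtr ?dot_ge0//.
rewrite /dot big_ord_recl -expr2; congr (_ + _).
by apply: eq_bigr => i _; rewrite !mxE.
Qed.

Lemma gaussian_measure_mean l k (x : 'rV[R]_k) t : 0 < l ->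
  (\int[gaussian_measure l (k := k)]_z (`|dot x (vec z) + t|)%R%:E =
   (scaled_gauss_abs (enorm x / gauss_scale l) t)%:E)%E.
Proof.
move=> l0; rewrite -density_mean//.
rewrite (@ge0_integral_density _ _ _ (@lebesgue_tuple R k) _ (@gaussian_density R l k))//.
- by move=> z; exact: gaussian_density_ge0.
- exact: measurable_gaussian_density.
- apply/measurable_EFinP; apply: measurableT_comp => //.
  by apply: measurable_funD => //; exact: measurable_dot_vec.
Qed.

End gaussian_tuples.

(** * Means of absolute values for the given Gaussian vector *)

Section gaussian_vector_mean.
Context {R : realType} d (T : measurableType d) (P : probability T R).
Variables (k : nat) (X : {RV P >-> Rtuple R k}).
Hypotheses (X_gauss : gaussian_vector X) (X_centered : centered_vector X).
Hypothesis X_cov : has_covariance_matrix X (pi / 2)%:M.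
Local Notation mu := (@lebesgue_measure R).
Implicit Types (a : 'rV[R]_k) (i j : 'I_k).

Let Y a w : R := dot a (vec (X w)).

Let measurable_Y a : measurable_fun setT (Y a : T -> measurableTypeR R).
Proof. exact: (measurableT_comp (measurable_dot_vec a)). Qed.

Let measurable_coord i : measurable_fun setT (fun w => tnth (X w) i : R).
Proof. exact: (measurableT_comp (measurable_tnth i) (measurable_funP X)). Qed.

(** Divides the standard deviation by sqrt (pi / 2) to pass to the scale c of [gauss_pdf], the point
    mass being c = 0. Neither m nor c is known yet. *)
Let gaussian_law a : exists m c : R, 0 <= c /\
  forall f : R -> \bar R, measurable_fun setT f -> (forall y, 0 <= f y)%E ->
    (\int[P]_w f (Y a w) =
     if c == 0%R then f m else \int[mu]_y (f y * (gauss_pdf c (y - m))%:E))%E.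
Proof.
have [m [s [s0 law]]] := X_gauss a.
exists m, (s / Num.sqrt (pi / 2)).
have q0 : 0 < Num.sqrt (pi / 2) :> R by rewrite sqrtr_gt0 divr_gt0 ?pi_gt0.
split; first by rewrite divr_ge0// ltW.
move=> f mf f0.
have -> : (\int[P]_w f (Y a w) =
    \int[pushforward P (Y a : T -> measurableTypeR R)]_y f y)%E.
  by rewrite (ge0_integral_pushforward (measurable_Y a)).
rewrite mulf_eq0 invr_eq0 (gt_eqF q0) orbF; case: ifPn => [/eqP s0'|sn0].
  transitivity (\int[dirac (m : measurableTypeR R)]_y f y)%E.
    apply: eq_measure_integral => A mA _.
    by have := law A mA; rewrite /normal_law s0' eqxx.
  by rewrite integral_dirac// diracE mem_set// mul1e.
have c0 : 0 < s / Num.sqrt (pi / 2) by rewrite divr_gt0// lt_neqAle eq_sym sn0.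
transitivity (\int[normal_prob m s]_y f y)%E.
  apply: eq_measure_integral => A mA _.
  by have := law A mA; rewrite /normal_law (negbTE sn0).
rewrite (@ge0_integral_density _ _ _ mu _ (normal_pdf m s))//.
- apply: eq_integral => y _; congr (_ * _%:E)%E.
  by rewrite -normal_pdf_gauss_pdf// divfK// gt_eqF.
- by move=> y; exact: normal_pdf_ge0.
- exact: measurable_normal_pdf.
Qed.

(** Read off from the covariance before any integrability is known; finiteness of the diagonal
    values then yields square integrability of the coordinates. *)
Let product_moment i j :
  (\int[P]_w (tnth (X w) i * tnth (X w) j)%:E = ((pi / 2)%:M i j)%:E)%E.
Proof.
rewrite -X_cov unlock !X_centered/= unlock.
apply: eq_integral => w _; congr EFin.
by rewrite -[in LHS](subr0 (tnth (X w) i)) -[in LHS](subr0 (tnth (X w) j)).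
Qed.

Let square_integrable i : P.-integrable setT (fun w => (tnth (X w) i ^+ 2)%:E).
Proof.
apply/integrableP; split.
  by apply/measurable_EFinP; exact: (measurable_funX 2 (measurable_coord i)).
under eq_integral do rewrite gee0_abs ?lee_fin ?sqr_ge0// expr2.
by rewrite product_moment ltry.
Qed.

Let product_integrable i j :
  P.-integrable setT (fun w => (tnth (X w) i * tnth (X w) j)%:E).
Proof.
apply: (@le_integrable _ T R P setT measurableT _ (fun w =>
  (tnth (X w) i ^+ 2)%:E + (tnth (X w) j ^+ 2)%:E)%E) => //.
- apply/measurable_EFinP.
  exact: (measurable_funM (measurable_coord i) (measurable_coord j)).
- move=> w _; rewrite -EFinD !abse_EFin lee_fin.
  move: (tnth _ i) (tnth _ j) => x y.
  rewrite [leRHS]ger0_norm ?addr_ge0 ?sqr_ge0// ler_norml.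
  have := sqr_ge0 (x - y); have := sqr_ge0 (x + y).
  have := sqr_ge0 x; have := sqr_ge0 y; rewrite sqrrD sqrrB; lra.
- exact: integrableD.
Qed.

Let coord_integrable i : P.-integrable setT (fun w => (tnth (X w) i)%:E).
Proof.
apply: (@le_integrable _ T R P setT measurableT _ (fun w => cst 1 w + (tnth (X w) i ^+ 2)%:E)%E) => //.
- by apply/measurable_EFinP; exact: measurable_coord.
- move=> w _; rewrite -EFinD !abse_EFin lee_fin.
  move: (tnth _ i) => x.
  rewrite [leRHS]ger0_norm ?addr_ge0 ?sqr_ge0// ler_norml.
  have := sqr_ge0 (x - 1); have := sqr_ge0 (x + 1).
  rewrite sqrrD sqrrB !expr1n !mulr1; lra.
- apply: integrableD => //; exact: finite_measure_integrable_cst.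
Qed.

Lemma gaussian_coord_integrable i :
  P.-integrable setT (fun w => (tnth (X w) i)%:E).
Proof. exact: coord_integrable. Qed.

Let YE a w : Y a w = \sum_(i < k) a 0 i * tnth (X w) i.
Proof. by apply: eq_bigr => i _; rewrite mxE. Qed.

Let Y_integrable a : P.-integrable setT (fun w => (Y a w)%:E).
Proof.
rewrite (_ : (fun _ => _) = fun w => (\sum_(i < k) (a 0 i)%:E * (tnth (X w) i)%:E)%E).
  by apply: integrable_sum => // i _; exact: integrableZl.
by apply/funext => w; rewrite YE -sumEFin.
Qed.

Let Y_mean a : (\int[P]_w (Y a w)%:E = 0)%E.
Proof.
under eq_integral do rewrite YE -sumEFin.
rewrite integral_sum//; last first.
  by move=> i; under eq_fun do rewrite EFinM; exact: integrableZl.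
apply: big1 => i _; under eq_integral do rewrite EFinM.
by have := X_centered i; rewrite unlock integralZl// => ->; rewrite mule0.
Qed.

Let Y_second_moment a : (\int[P]_w (Y a w ^+ 2)%:E = (pi / 2 * enorm a ^+ 2)%:E)%E.
Proof.
have E w : Y a w ^+ 2 = \sum_(i < k) \sum_(j < k) (a 0 i * a 0 j) * (tnth (X w) i * tnth (X w) j).
  rewrite expr2 YE mulr_suml; apply: eq_bigr => i _.
  by rewrite mulr_sumr; apply: eq_bigr => j _; rewrite mulrACA.
under eq_integral do rewrite E -sumEFin.
have intij i j : P.-integrable setT
    (fun w => (a 0 i * a 0 j * (tnth (X w) i * tnth (X w) j))%:E).
  by under eq_fun do rewrite EFinM; exact: integrableZl.
rewrite integral_sum//; last first.
  by move=> i; under eq_fun do rewrite -sumEFin; exact: integrable_sum.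
rewrite sqr_enorm /dot mulr_sumr -sumEFin; apply: eq_bigr => i _.
under eq_integral do rewrite -sumEFin.
rewrite integral_sum// (bigD1 i)//= big1 ?adde0 => [|j ji].
  under eq_integral do rewrite EFinM.
  by rewrite integralZl// product_moment mxE eqxx mulr1n -EFinM mulrC.
under eq_integral do rewrite EFinM.
by rewrite integralZl// product_moment mxE eq_sym (negbTE ji) mulr0n mule0.
Qed.

(** The law of a linear functional is normal with unknown parameters; the first moment forces m = 0
    and the second c = |a|. *)
Lemma gaussian_vector_mean a t :
  ('E_P[fun w => (`|dot a (vec (X w)) + t|)%R] = (scaled_gauss_abs (enorm a) t)%:E)%E.
Proof.
have [m [c [c0 law]]] := gaussian_law a.
have absE s : (\int[P]_w (`|Y a w + s|)%:E = (scaled_gauss_abs c (s + m))%:E)%E.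
  rewrite (law (fun y => (`|y + s|)%:E))//; last first.
    by apply/measurable_EFinP; apply: measurableT_comp => //; exact: measurable_funD.
  case: ifPn => [c00|cn0]; first by rewrite /scaled_gauss_abs c00 addrC.
  have {}c0 : 0 < c by rewrite lt_neqAle eq_sym cn0.
  by rewrite -gauss_abs_mean//; apply: eq_integral => y _; rewrite EFinM.
have posE : (\int[P]_w (`|Y a w| + Y a w)%:E = (m + scaled_gauss_abs c m)%:E)%E.
  rewrite (law (fun y => (`|y| + y)%:E)).
  - case: ifPn => [c00|cn0]; first by rewrite /scaled_gauss_abs c00 addrC.
    have {}c0 : 0 < c by rewrite lt_neqAle eq_sym cn0.
    by rewrite -gauss_pos_mean//; apply: eq_integral => y _; rewrite EFinM.
  - by apply/measurable_EFinP; apply: measurable_funD => //; exact: measurableT_comp.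
  - by move=> y; rewrite lee_fin -lerBlDr sub0r -normrN ler_norm.
(* The mean of |Y| + Y is computed in two ways: from the law, and as the mean of |Y| plus 0. *)
have m0 : m = 0.
  move: posE; under eq_integral do rewrite EFinD.
  rewrite integralD//; last exact: (integrable_abse (Y_integrable a)).
  rewrite Y_mean adde0; under eq_integral do rewrite -[Y a _]addr0.
  by rewrite absE add0r => -[] /eqP; rewrite -subr_eq0 opprD addrCA subrr addr0 oppr_eq0 => /eqP.
have cE : c = enorm a.
  have := Y_second_moment a; rewrite (law (fun y => (y ^+ 2)%:E)).
  - rewrite m0; case: ifPn => [/eqP -> |cn0].
      rewrite expr0n => -[] /esym/eqP; rewrite mulf_eq0 sqrf_eq0.
      rewrite mulf_eq0 invr_eq0 pnatr_eq0 orbF gt_eqF ?pi_gt0//= => /eqP->//.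
    have {}c0 : 0 < c by rewrite lt_neqAle eq_sym cn0.
    under eq_integral do rewrite subr0 -EFinM.
    rewrite gauss_second_moment// => -[] /mulfI.
    rewrite mulf_neq0 ?invr_eq0 ?pnatr_eq0 ?gt_eqF ?pi_gt0// => /(_ isT)/eqP.
    by rewrite eqrXn2 ?(ltW c0) ?enorm_ge0// => /eqP.
  - by apply/measurable_EFinP; exact: measurable_funX.
  - by move=> y; rewrite lee_fin sqr_ge0.
by rewrite unlock -cE absE m0 addr0.
Qed.

End gaussian_vector_mean.

(** * The Laplace representation of F *)

Section laplace_representation.
Context {R : realType}.
Local Notation mu := (@lebesgue_measure R).
Implicit Types (l s r : R).

Let pi_neq0 : (pi : R) != 0. Proof. by rewrite gt_eqF// pi_gt0. Qed.

(* [(r - s) f''(r)] has the primitive [(r - s) f'(r) - f(r)]. *)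
Lemma tail_integral (f df ddf : R -> R) (c s : R) :
  (forall r, 0 <= ddf r) -> continuous ddf ->
  (forall r, is_derive r 1 f (df r)) -> (forall r, is_derive r 1 df (ddf r)) ->
  df r @[r --> +oo] --> c -> (f r - r * df r) @[r --> +oo] --> (0 : R) ->
  (\int[mu]_r (Num.max (r - s) 0 * ddf r)%:E = (f s - s * c)%:E)%E.
Proof.
move=> ddf0 cddf dfE ddfE dfc f0.
pose A r := (r - s) * df r - f r.
have dA r : is_derive r 1 A ((r - s) * ddf r).
  apply: (is_derive_cast (is_derive_sub (is_derive_mul
    (is_derive_sub (is_derive_idfun r) (is_derive_const r s)) (ddfE r)) (dfE r))).
  by ring.
transitivity (\int[mu]_(r in `[s, +oo[) ((r - s) * ddf r)%:E)%E.
  rewrite [RHS]integral_mkcond; apply: eq_integral => r _; rewrite patchE.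
  have [sr|rs] := leP s r.
    by rewrite mem_set/= ?in_itv/= ?sr// max_l// subr_ge0.
  rewrite memNset/= ?in_itv/= ?andbT ?leNgt ?rs// max_r ?mul0r//.
  by rewrite subr_le0 ltW.
rewrite (@ge0_continuous_FTC2y _ _ A _ (- (s * c))).
- by rewrite -EFinB; congr EFin; rewrite /A subrr mul0r sub0r opprK addrC.
- by move=> r sr; rewrite mulr_ge0// subr_ge0.
- apply: continuous_subspaceT => r; apply: cvgM; last exact: cddf.
  by apply: cvgB; [exact: cvg_id|exact: cvg_cst].
- rewrite (_ : A = fun r => - (f r - r * df r) - s * df r); last first.
    by apply/funext => r; rewrite /A; ring.
  rewrite -[X in _ --> X]add0r -[X in _ --> X + _]oppr0.
  by apply: cvgB; [exact: cvgN|exact: cvgMr].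
- by move=> r _; have [] := dA r.
- by apply/cvg_at_right_filter; exact: is_derive_continuous (dA s).
- by move=> r _; have [_ <-] := dA r; rewrite derive1E.
Qed.

Lemma mixture_term_tail l s : 0 < l ->
  (\int[mu]_r (Num.max (r - s) 0 * expR (- (l * r ^+ 2)))%:E =
   (mixture_term l s - s * (gauss_scale l / (2 * l)))%:E)%E.
Proof.
move=> l0.
have gs0 := gauss_scale_gt0 l0.
have cs : (gauss_scale l * r) @[r --> +oo] --> +oo.
  by apply/gt0_cvgMry => //; exact: cvg_id.
have dE r : is_derive r 1 (fun r => expR (- (l * r ^+ 2))) (expR (- (l * r ^+ 2)) * - (l * (r *+ 2))).
  rewrite (_ : (fun _ => _) = fun r => expR (- (l * (r * r)))); last first.
    by apply/funext => x; rewrite expr2.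
  apply: (is_derive_cast (is_derive_exp (is_derive_opp (is_derive_mull l
    (is_derive_mul (is_derive_idfun r) (is_derive_idfun r)))))).
  by rewrite mul1r mulr1 -expr2 mulr2n.
apply: (@tail_integral (mixture_term l) (mixture_slope l)).
- by move=> r; exact: expR_ge0.
- by move=> r; exact: is_derive_continuous (dE r).
- by move=> r; exact: is_derive_mixture_term.
- by move=> r; exact: is_derive_mixture_slope.
- rewrite -[X in _ --> X]mulr1; apply: cvgMr.
  exact: (cvg_comp _ _ cs (@gauss_erf_cvg R)).
- rewrite (_ : (fun r => _ - _) =
      fun r => (2 * l)^-1 * gauss_exp (gauss_scale l * r)); last first.
    by apply/funext => r; rewrite mixture_legendre ?(ltW l0)// gauss_exp_scale ?(ltW l0).
  rewrite -[X in _ --> X](mulr0 (2 * l)^-1); apply: cvgMr.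
  exact: (cvg_comp _ _ cs (@gauss_exp_cvg0 R)).
Qed.

Lemma touching_point_cvgy : touching_point s @[s --> +oo] --> (+oo : set_system R).
Proof.
apply/cvgryPge => M; near=> s.
have Ms : touching_slope M <= s by near: s; apply: nbhs_pinfty_ge; exact: num_real.
by rewrite -[M]touching_slopeK touching_point_le.
Unshelve. all: end_near. Qed.

(** The slope F' tends to 1, and F - r F' = 1 / phi(p) tends to 0 because p goes to infinity with
    r. *)
Lemma polar_profile_tail s :
  (\int[mu]_r (Num.max (r - s) 0 * polar_curvature r)%:E =
   (polar_profile s - s)%:E)%E.
Proof.
rewrite -[X in (_ - X)%:E]mulr1; apply: (@tail_integral polar_profile polar_slope).
- exact: polar_curvature_ge0.
- move=> r; rewrite /polar_curvature.
  have cT := is_derive_continuous (is_derive_touching_point r).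
  apply: cvgMr; apply: cvgM.
    apply: (@continuous_comp _ _ _ (fun r => gauss_exp (touching_point r))
      (fun y => y ^+ 2)); last exact: exprn_continuous.
    apply: (@continuous_comp _ _ _ touching_point gauss_exp _ cT).
    exact: is_derive_continuous (is_derive_gauss_exp _).
  apply: cvgV; first by rewrite gt_eqF// exprn_gt0// gauss_abs_gt0.
  apply: (@continuous_comp _ _ _ (fun r => gauss_abs (touching_point r))
    (fun y => y ^+ 3)); last exact: exprn_continuous.
  apply: (@continuous_comp _ _ _ touching_point gauss_abs _ cT).
  exact: is_derive_continuous (is_derive_gauss_abs _).
- by move=> r; exact: is_derive_polar_profile.
- by move=> r; exact: is_derive_polar_slope.
- have ci : r^-1 @[r --> +oo] --> (0 : R).
    apply/(@gtr0_cvgV0 _ _ _ _ (fun y : R => y)); last exact: cvg_id.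
    by apply: nbhs_pinfty_gt; exact: num_real.
  apply: (@squeeze_cvgr _ _ _ _ (fun r => 1 - r^-1) (fun=> 1)); last 2 first.
  + by rewrite -[X in _ --> X]subr0; apply: cvgB => //; exact: cvg_cst.
  + exact: cvg_cst.
  have rp : \forall r \near +oo, (0 : R) < r.
    by apply: nbhs_pinfty_gt; exact: num_real.
  by apply: filterS rp => r r0; rewrite polar_slope_le1 andbT polar_slope_ge.
- rewrite (_ : (fun r => _ - _) = fun r => (gauss_abs (touching_point r))^-1); last first.
    by apply/funext => r; rewrite polar_profile_legendre.
  apply/(@gtr0_cvgV0 _ _ _ _ (fun r => gauss_abs (touching_point r))).
    by apply: nearW => r; exact: gauss_abs_gt0.
  apply/cvgryPge => M; have /cvgryPge/(_ M) := touching_point_cvgy.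
  apply: filterS => r /le_trans; apply.
  by rewrite (le_trans (ler_norm _))// gauss_abs_ge.
Qed.

Lemma derive1n2_polar_profile s : derive1n 2 polar_profile s = polar_curvature s.
Proof.
have e1 : derive1 polar_profile = polar_slope :> (R -> R).
  apply/funext => r; rewrite derive1E.
  by have [_ ->] := is_derive_polar_profile r.
rewrite -[derive1n 2 _]/(derive1 (derive1 polar_profile)) e1 derive1E.
by have [_ ->] := is_derive_polar_slope s.
Qed.

Variable nu : {measure set (measurableTypeR R) -> \bar R}.
Hypothesis nuE : forall u : R, 0 <= u ->
  ((polar_curvature (Num.sqrt u))%:E =
   \int[nu]_(l in `]0%R, +oo[) (expR (- (l * u)))%:E)%E.

Let D : set (measurableTypeR R) := `]0%R, +oo[%classic.

Let mD : measurable D. Proof. exact: measurable_itv. Qed.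

Let F s (p : measurableTypeR R * measurableTypeR R) : \bar R :=
  (Num.max (p.2 - s) 0 * expR (- (p.1 * p.2 ^+ 2)))%:E.

Let mF s : measurable_fun setT (F s).
Proof.
apply/measurable_EFinP; apply: measurable_funM.
  apply: measurable_maxr => //; apply: measurable_funB => //; exact: measurable_snd.
apply: measurableT_comp => //; apply: measurableT_comp => //.
apply: measurable_funM; first exact: measurable_fst.
by apply: measurable_funX; exact: measurable_snd.
Qed.

Let F0 s p : (0 <= F s p)%E.
Proof. by rewrite lee_fin mulr_ge0 ?expR_ge0// le_max lexx orbT. Qed.

(** The second antiderivative of exp (- l s ^ 2) that vanishes at +oo. Being an integral of a
    nonnegative kernel, it is nonnegative and measurable in l; its even and odd parts in s recover
    [mixture_term] and the weight. *)
Let asym l s : R := mixture_term l s - s * (gauss_scale l / (2 * l)).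

Let asymE l s : l \in D -> (\int[mu]_r F s (l, r) = (asym l s)%:E)%E.
Proof. by rewrite inE /D/= in_itv/= andbT => l0; exact: mixture_term_tail. Qed.

Let asym_ge0 l s : l \in D -> 0 <= asym l s.
Proof.
by move=> lD; rewrite -lee_fin -asymE//; apply: integral_ge0 => r _; exact: F0.
Qed.

Let measurable_asym s :
  measurable_fun D (fun l : measurableTypeR R => (asym l s)%:E).
Proof.
apply: (eq_measurable_fun (fun l : measurableTypeR R => \int[mu]_r F s (l, r))%E).
  by move=> l lD; exact: asymE.
apply: measurable_funTS.
exact: (measurable_fun_fubini_tonelli_F (m2 := mu) (F s) (mF s) (F0 s)).
Qed.

(** Tonelli needs sigma-finiteness. On (0, oo) the mass of [nu] is finite: it is F''(0), by the
    hypothesis at u = 0. *)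
Let restricted : exists m : {sigma_finite_measure set (measurableTypeR R) -> \bar R},
  forall f : measurableTypeR R -> \bar R, measurable_fun setT f -> (forall l, 0 <= f l)%E ->
    (\int[m]_l f l = \int[nu]_(l in D) f l)%E.
Proof.
have sf : sigma_finite setT (mrestr nu mD).
  exists (fun=> setT); first by rewrite bigcup_const.
  move=> i; split => //; rewrite /mrestr setTI.
  have := nuE (lexx 0); under eq_integral do rewrite mulr0 oppr0 expR0.
  by rewrite integral_cst// mul1e => <-; rewrite ltry.
have [m mE] := sigma_finite_measure_of sf.
exists m => f mf f0.
rewrite (@ge0_integral_density _ _ _ nu m \1_D)//.
- rewrite [RHS]integral_mkcond; apply: eq_integral => l _.
  rewrite patchE indicE; case: (l \in D); first by rewrite mule1.
  by rewrite mule0.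
- move=> A mA; transitivity (mrestr nu mD A); first exact: (congr1 (fun g => g A) mE).
  by rewrite integral_indic// setIC.
Qed.

Let asym_integral s : (\int[nu]_(l in D) (asym l s)%:E = (polar_profile s - s)%:E)%E.
Proof.
have [m mE] := restricted.
rewrite -polar_profile_tail.
transitivity (\int[m]_l \int[mu]_r F s (l, r))%E.
  rewrite mE.
  - by apply: eq_integral => l lD; rewrite asymE.
  - exact: (measurable_fun_fubini_tonelli_F (m2 := mu) (F s) (mF s) (F0 s)).
  - by move=> l; apply: integral_ge0 => r _; exact: F0.
rewrite (fubini_tonelli (F s))//.
apply: eq_integral => r _; rewrite /F/=.
under eq_integral do rewrite EFinM.
rewrite ge0_integralZl_EFin//; last 2 first.
- apply/measurable_EFinP; apply: measurableT_comp => //; apply: measurableT_comp => //.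
  exact: measurable_funM.
- by rewrite le_max lexx orbT.
rewrite mE; last 2 first.
- apply/measurable_EFinP; apply: measurableT_comp => //; apply: measurableT_comp => //.
  exact: measurable_funM.
- by move=> l; rewrite lee_fin expR_ge0.
(* The hypothesis at u = r ^ 2 yields F''(|r|), and F'' is even. *)
rewrite -nuE ?sqr_ge0// -EFinM sqrtr_sqr.
have [r0|r0] := leP 0 r; first by rewrite ger0_norm.
by rewrite ltr0_norm// polar_curvatureN.
Qed.

Let asym_sum l s : asym l s + asym l (- s) = 2 * mixture_term l s.
Proof. by rewrite /asym /mixture_term mulrN gauss_absN; ring. Qed.

Let asym_diff l : asym l (- 1) - asym l 1 = 2 * (gauss_scale l / (2 * l)).
Proof. by rewrite /asym /mixture_term mulrN gauss_absN; ring. Qed.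

Lemma measurable_mixture_term s :
  measurable_fun D (fun l : measurableTypeR R => (mixture_term l s)%:E).
Proof.
apply: (eq_measurable_fun
    (fun l : measurableTypeR R => 2^-1%:E * ((asym l s)%:E + (asym l (- s))%:E)))%E.
  by move=> l _; rewrite -EFinD -EFinM asym_sum mulKf.
by apply: measurable_funeM; exact: emeasurable_funD.
Qed.

Lemma measurable_mixture_weight :
  measurable_fun D (fun l : measurableTypeR R => (gauss_scale l / (2 * l))%:E).
Proof.
apply: (eq_measurable_fun
    (fun l : measurableTypeR R => 2^-1%:E * ((asym l (- 1))%:E - (asym l 1)%:E)))%E.
  by move=> l _; rewrite -EFinB -EFinM asym_diff mulKf.
by apply: measurable_funeM; exact: emeasurable_funB.
Qed.

(** Adding the tail identities at s and - s cancels the linear terms and leaves 2 F(s). *)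
Lemma polar_profile_laplace s :
  (\int[nu]_(l in D) (mixture_term l s)%:E = (polar_profile s)%:E)%E.
Proof.
have : (\int[nu]_(l in D) (2%:E * (mixture_term l s)%:E) = 2%:E * (polar_profile s)%:E)%E.
  transitivity (\int[nu]_(l in D) ((asym l s)%:E + (asym l (- s))%:E))%E.
    by apply: eq_integral => l lD; rewrite -EFinM -EFinD asym_sum.
  rewrite ge0_integralD//; last 2 first.
  - by move=> l lD; rewrite lee_fin asym_ge0 ?inE.
  - by move=> l lD; rewrite lee_fin asym_ge0 ?inE.
  rewrite !asym_integral polar_profileN -EFinD -EFinM; congr EFin; ring.
rewrite ge0_integralZl_EFin//; last 2 first.
- move=> l; rewrite /D/= in_itv/= andbT => l0; rewrite lee_fin mulr_ge0 ?invr_ge0 ?mulr_ge0 ?(ltW l0)//.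
  by rewrite ltW// gauss_abs_gt0.
- exact: measurable_mixture_term.
move: (\int[nu]_(l in D) _)%E => [c| |]; rewrite ?gt0_muley ?gt0_muleNy ?lte_fin//.
by rewrite -!EFinM => -[] h; congr EFin; lra.
Qed.

(** Compares the tail identities at -1 and 1, in additive form so as not to subtract integrals. This
    is the integral formula at x = 0, t = 1. *)
Lemma mixture_weight_total :
  (\int[nu]_(l in D) (gauss_scale l / (2 * l))%:E = 1)%E.
Proof.
have mc := measurable_mixture_weight.
have c0 l : D l -> (0 <= (gauss_scale l / (2 * l))%:E)%E.
  rewrite /D/= in_itv/= andbT => l0.
  by rewrite lee_fin divr_ge0 ?sqrtr_ge0 ?mulr_ge0 ?(ltW l0).
have : (\int[nu]_(l in D) (asym l (- 1))%:E = \int[nu]_(l in D) ((asym l 1)%:E + 2%:E * (gauss_scale l / (2 * l))%:E))%E.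
  by apply: eq_integral => l lD; rewrite -EFinM -EFinD -asym_diff addrC subrK.
rewrite ge0_integralD//; last 3 first.
- by move=> l lD; rewrite lee_fin asym_ge0 ?inE.
- by move=> l lD; rewrite mule_ge0// c0.
- exact: measurable_funeM.
rewrite ge0_integralZl_EFin// !asym_integral polar_profileN.
move: (\int[nu]_(l in D) _)%E => [c| |]; rewrite ?gt0_muley ?gt0_muleNy ?lte_fin//.
by rewrite -EFinM -EFinD => -[] h; congr EFin; lra.
Qed.

End laplace_representation.

(** * Nearest points, support functions, zonotopes and Hausdorff distance *)

Lemma continuous_sum {R : realType} {V : topologicalType} {W : normedModType R}
    (I : Type) (s : seq I) (F : I -> V -> W) :
  (forall i, continuous (F i)) -> continuous (fun v => \sum_(i <- s) F i v).
Proof.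
move=> cF; elim: s => [|i s IH].
  by rewrite (_ : (fun _ => _) = fun=> 0);
    [exact: cst_continuous|apply/funext => v; rewrite big_nil].
rewrite (_ : (fun _ => _) = fun v => F i v + \sum_(i <- s) F i v); last first.
  by apply/funext => v; rewrite big_cons.
by move=> v; apply: continuousD; [exact: cF|exact: IH].
Qed.

Section euclidean_geometry.
Context {R : realType} {n : nat}.
Implicit Types (u v y : 'rV[R]_n) (A B K Z : set 'rV[R]_n) (c e : R).

Lemma dotC u v : dot u v = dot v u.
Proof. by apply: eq_bigr => i _; rewrite mulrC. Qed.

Lemma dotDr u v y : dot u (v + y) = dot u v + dot u y.
Proof. by rewrite -big_split/=; apply: eq_bigr => i _; rewrite mxE mulrDr. Qed.

Lemma dotZr c u v : dot u (c *: v) = c * dot u v.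
Proof. by rewrite mulr_sumr; apply: eq_bigr => i _; rewrite mxE mulrCA. Qed.

Lemma dotNr u v : dot u (- v) = - dot u v.
Proof. by rewrite -scaleN1r dotZr mulN1r. Qed.

Lemma dotDl u v y : dot (u + v) y = dot u y + dot v y.
Proof. by rewrite dotC dotDr !(dotC y). Qed.

Lemma dotZl c u v : dot (c *: u) v = c * dot u v.
Proof. by rewrite dotC dotZr dotC. Qed.

Lemma dotNl u v : dot (- u) v = - dot u v.
Proof. by rewrite dotC dotNr dotC. Qed.

Lemma dot_sumr (I : finType) u (F : I -> 'rV[R]_n) :
  dot u (\sum_i F i) = \sum_i dot u (F i).
Proof.
rewrite /dot exchange_big/=; apply: eq_bigr => i _.
by rewrite summxE mulr_sumr.
Qed.

Lemma dot0r u : dot u 0 = 0.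
Proof. by rewrite /dot big1// => i _; rewrite mxE mulr0. Qed.

Lemma sqr_enormB u v :
  enorm (u - v) ^+ 2 = enorm u ^+ 2 - 2 * dot u v + enorm v ^+ 2.
Proof.
rewrite !sqr_enorm dotDl !dotDr !dotNl !dotNr (dotC v u); ring.
Qed.

Lemma cauchy_schwarz u v : dot u v <= enorm u * enorm v.
Proof.
have [->|u0] := eqVneq u 0.
  by rewrite dotC dot0r mulr_ge0 ?enorm_ge0.
have [->|v0] := eqVneq v 0; first by rewrite dot0r mulr_ge0 ?enorm_ge0.
have u1 : 0 < enorm u by rewrite lt_neqAle eq_sym enorm_eq0 u0 enorm_ge0.
have v1 : 0 < enorm v by rewrite lt_neqAle eq_sym enorm_eq0 v0 enorm_ge0.
have := sqr_ge0 (enorm (enorm v *: u - enorm u *: v)).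
rewrite sqr_enormB !sqr_enorm !dotZl !dotZr -!sqr_enorm.
have -> : enorm v * (enorm v * enorm u ^+ 2) - 2 * (enorm v * (enorm u * dot u v))
   + enorm u * (enorm u * enorm v ^+ 2) =
   2 * (enorm u * enorm v) * (enorm u * enorm v - dot u v) by ring.
by rewrite pmulr_rge0 ?subr_ge0// !mulr_gt0.
Qed.

Lemma coord_le_enorm u i : `|u 0 i| <= enorm u.
Proof.
rewrite -sqrtr_sqr ler_sqrt ?dot_ge0// /dot (bigD1 i)//= expr2 lerDl.
by apply: sumr_ge0 => j _; rewrite -expr2 sqr_ge0.
Qed.

Lemma dot_continuous u : continuous (dot u).
Proof.
apply: continuous_sum => i v.
apply: continuousM; [exact: cst_continuous|exact: coord_continuous].
Qed.

Lemma convex_setP A : convex_set (A : set (convex_lmodType 'rV[R]_n)) <->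
  forall x y (l : R), A x -> A y -> 0 <= l <= 1 -> A (l *: x + (1 - l) *: y).
Proof.
split=> [cA x y l Ax Ay /andP[l0 l1]|cA x y l].
  by have := cA x y (Itv01 l0 l1); rewrite !inE => /(_ Ax Ay).
rewrite !inE => Ax Ay; apply: (cA x y l%:num) => //.
by rewrite ge0 le1.
Qed.

(** b minimises the distance to a; the first-order condition along segments of B says that a - b is
    an outer normal of B at b. *)
Lemma nearest_point B a : B !=set0 -> compact B ->
  convex_set (B : set (convex_lmodType 'rV[R]_n)) ->
  exists2 b, B b & forall y, B y -> dot (a - b) y <= dot (a - b) b.
Proof.
move=> B0 cB /convex_setP vB.
(* Equals |y - a| ^ 2 - |a| ^ 2. *)
pose f y := dot y y - 2 * dot a y.
have cf : continuous f.
  move=> v.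
  apply: (@continuousB _ _ _ (fun y => dot y y) (fun y => 2 * dot a y)); last first.
    by apply: continuousM; [exact: cst_continuous|exact: dot_continuous].
  by move: v; apply: continuous_sum => i w; apply: continuousM; exact: coord_continuous.
have fE b z (l : R) :
    f (b - l *: z) = f b + 2 * l * (dot (a - b) z + l / 2 * dot z z).
  by rewrite /f !dotDl !dotDr !dotNl !dotNr !dotZl !dotZr (dotC z b); field.
have [|b] := @compact_EVT_min _ _ f B B0 cB; first exact: continuous_subspaceT.
rewrite inE => Bb bmin; exists b => // y By.
rewrite -subr_ge0 -dotNr -dotDr; set z := b - y.
have key (l : R) : 0 < l <= 1 -> - (l / 2 * dot z z) <= dot (a - b) z.
  move=> /andP[l0 l1].
  have := bmin (l *: y + (1 - l) *: b); rewrite inE => /(_ (vB _ _ _ By Bb _)).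
  rewrite (ltW l0) l1 => /(_ isT).
  have -> : l *: y + (1 - l) *: b = b - l *: z.
    by rewrite /z scalerBr scalerBl scale1r opprB addrCA addrC -addrA addrC.
  rewrite fE lerDl pmulr_rge0; last by rewrite mulr_gt0.
  by rewrite -lerBlDr sub0r.
rewrite leNgt; apply/negP => w0.
move: (dot_ge0 z) w0 key; move: (dot z z) (dot (a - b) z) => Q W Q0 W0 key.
have D0 : 0 < Q - W + 1 by lra.
(* If W < 0, this step length makes the quadratic term too small to compensate W. *)
have := key (- W / (Q - W + 1)).
rewrite divr_gt0 ?oppr_gt0//= ler_pdivrMr// mul1r.
have -> : - W <= Q - W + 1 by lra.
have -> : - (- W / (Q - W + 1) / 2 * Q) = W * (Q / (2 * (Q - W + 1))).
  by field; rewrite gt_eqF.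
move=> /(_ isT); rewrite -[leRHS]mulr1 ler_nM2l// ler_pdivlMr ?mulr_gt0//; lra.
Qed.

Lemma support_function_ge A u y : compact A -> A y -> dot u y <= support_function A u.
Proof.
move=> cA Ay; apply: sup_upper_bound; last by exists y.
split; first by exists (dot u y), y.
have A0 : A !=set0 by exists y.
have [|c _ cE] := @compact_EVT_max _ _ (dot u) A A0 cA.
  by apply: continuous_subspaceT; exact: dot_continuous.
by exists (dot u c) => _ [z Az <-]; apply: cE; rewrite inE.
Qed.

Lemma support_function_le A u c : A !=set0 -> (forall y, A y -> dot u y <= c) ->
  support_function A u <= c.
Proof.
move=> [y Ay] Ac; apply: ge_sup; first by exists (dot u y), y.
by move=> _ [z Az <-]; exact: Ac.
Qed.

(** Membership in the closure of the support functions of zonotopes, uniformly on the Euclidean unit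
    sphere. *)
Definition finite_zonal_sums (h : 'rV[R]_n -> R) : Prop :=
  forall e : R, 0 < e -> exists (N : nat) (v : 'I_N -> 'rV[R]_n),
    forall u, `|h u - \sum_(j < N) `|dot u (v j)| | <= e * enorm u.

(** Take b nearest to a and u = a - b: then h_B(u) <= u.b, so |u| ^ 2 = u.a - u.b <= h_A(u) - h_B(u)
    <= e |u|. *)
Lemma support_function_distance A B e : A !=set0 -> compact A -> compact B -> 0 <= e ->
  convex_set (B : set (convex_lmodType 'rV[R]_n)) -> B !=set0 ->
  (forall u, support_function A u <= support_function B u + e * enorm u) ->
  forall a, A a -> exists2 b, B b & enorm (a - b) <= e.
Proof.
move=> A0 cA cB e0 vB B0 AB a Aa.
have [b Bb bE] := nearest_point a B0 cB vB; exists b => //.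
have h1 := support_function_ge (a - b) cA Aa.
have h2 := support_function_le B0 bE.
have h3 := AB (a - b).
have : enorm (a - b) ^+ 2 <= e * enorm (a - b).
  by rewrite sqr_enorm {2}[a - b]/(a - b) dotDr dotNr; lra.
have [->//|] := eqVneq (enorm (a - b)) 0.
move=> n0; have : 0 < enorm (a - b) by rewrite lt_neqAle eq_sym n0 enorm_ge0.
by move=> p; rewrite expr2 ler_pM2r.
Qed.

Let zonotope_of N (v : 'I_N -> 'rV[R]_n) : set 'rV[R]_n :=
  [set \sum_(j < N) w j |
     w in [set w : 'I_N -> 'rV[R]_n | forall j, segment (v j) (w j)]].

(** Presents the zonotope as a linear image of a cube, from which compactness and convexity
    follow. *)
Lemma zonotope_ofE N (v : 'I_N -> 'rV[R]_n) : zonotope_of v =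
  [set \sum_(j < N) (c : 'rV[R]_N) 0 j *: v j |
     c in [set c : 'rV[R]_N | forall j, `[-1, 1]%classic (c 0 j)]].
Proof.
apply/seteqP; split=> y [w wE <-].
  have cw j : {c : R | -1 <= c <= 1 /\ c *: v j = w j}.
    by apply/cid; have [c c1 cE] := wE j; exists c.
  exists (\row_j sval (cw j)) => [j|].
    by rewrite mxE /= in_itv/=; case: (cw j) => c [].
  by apply: eq_bigr => j _; rewrite mxE; case: (cw j) => c [].
exists (fun j => w 0 j *: v j) => // j.
by exists (w 0 j) => //; have := wE j; rewrite /= in_itv.
Qed.

Lemma zonotope_of_compact N (v : 'I_N -> 'rV[R]_n) : compact (zonotope_of v).
Proof.
rewrite zonotope_ofE; apply: continuous_compact; last first.
  by apply: (@rV_compact R N (fun=> `[-1, 1]%classic)) => j; exact: segment_compact.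
apply: continuous_subspaceT.
apply: (@continuous_sum _ _ _ _ _ (fun j (c : 'rV[R]_N) => c 0 j *: v j)) => j c.
by apply: continuousZr_tmp; exact: coord_continuous.
Qed.

Lemma zonotope_of_convex N (v : 'I_N -> 'rV[R]_n) :
  convex_set (zonotope_of v : set (convex_lmodType 'rV[R]_n)).
Proof.
apply/convex_setP; rewrite zonotope_ofE => _ _ l [c c1 <-] [d d1 <-] /andP[l0 l1].
exists (l *: c + (1 - l) *: d) => [j|].
  have := c1 j; have := d1 j; rewrite /= !in_itv/= !mxE.
  move: (c 0 j) (d 0 j) => x y /andP[y1 y2] /andP[x1 x2]; apply/andP; split; nra.
rewrite !scaler_sumr -big_split/=; apply: eq_bigr => j _.
have -> : (l *: c + (1 - l) *: d) 0 j = l * c 0 j + (1 - l) * d 0 j by rewrite !mxE.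
by rewrite scalerDl !scalerA.
Qed.

Lemma support_function_zonotope N (v : 'I_N -> 'rV[R]_n) u :
  support_function (zonotope_of v) u = \sum_(j < N) `|dot u (v j)|.
Proof.
have W0 : zonotope_of v !=set0.
  by exists (\sum_(j < N) 0), (fun=> 0) => // j; exists 0; rewrite ?scale0r//= oppr_le0 ler01.
apply/eqP; rewrite eq_le; apply/andP; split.
  apply: support_function_le => // _ [w wE <-]; rewrite dot_sumr.
  apply: ler_sum => j _; have [c /andP[c1 c2] <-] := wE j.
  rewrite dotZr (le_trans (ler_norm _))// normrM ler_piMl// ler_norml c1 c2//.
(* The maximum is attained by choosing each sign to match that of u.v_j. *)
pose w j := Num.sg (dot u (v j)) *: v j.
have -> : \sum_(j < N) `|dot u (v j)| = dot u (\sum_j w j).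
  by rewrite dot_sumr; apply: eq_bigr => j _; rewrite dotZr normrEsg.
apply: support_function_ge; first exact: zonotope_of_compact.
exists w => // j; exists (Num.sg (dot u (v j))) => //.
by rewrite /= -ler_norml normr_sg lern1 leq_b1.
Qed.

Lemma zonoid_of_zonal_sums K : convex_body K ->
  finite_zonal_sums (support_function K) -> zonoid K.
Proof.
move=> bK hK; split => //; have [cK vK _ [k0 iK]] := bK.
have K0 : K !=set0 by exists k0; exact: interior_subset.
have /choice[W WE] j : exists W : set 'rV[R]_n, zonotope W /\
    0 <= hausdorff_dist W K <= j.+1%:R^-1.
  have e0 : 0 < j.+1%:R^-1 :> R by rewrite invr_gt0.
  have [N [v vE]] := hK _ e0.
  exists (zonotope_of v); split; first by exists N, v.
  have W0 : zonotope_of v !=set0.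
    by exists (\sum_(j < N) 0), (fun=> 0) => // i; exists 0; rewrite ?scale0r//= oppr_le0 ler01.
  have lb : lbound [set e : R | [/\ 0 <= e,
      (forall a, zonotope_of v a -> exists2 b, K b & enorm (a - b) <= e) &
      (forall b, K b -> exists2 a, zonotope_of v a & enorm (b - a) <= e)]] 0.
    by move=> e [].
  have he : [set e : R | [/\ 0 <= e,
      (forall a, zonotope_of v a -> exists2 b, K b & enorm (a - b) <= e) &
      (forall b, K b -> exists2 a, zonotope_of v a & enorm (b - a) <= e)]] j.+1%:R^-1.
    split; first exact: ltW.
      apply: support_function_distance => //; [exact: zonotope_of_compact|].
      move=> u; rewrite support_function_zonotope; have := vE u.
      by rewrite ler_distl => /andP[]; rewrite lerBlDr.
    apply: support_function_distance => //; [exact: zonotope_of_compact|exact: zonotope_of_convex|].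
    move=> u; rewrite support_function_zonotope; have := vE u.
    by rewrite ler_distlC => /andP[]; rewrite lerBlDr.
  apply/andP; split; first by apply: lb_le_inf => //; exists j.+1%:R^-1.
  by apply: ge_inf => //; exists 0.
exists W; split=> [j|]; first by have [] := WE j.
apply: (@squeeze_cvgr _ _ _ _ (fun=> 0) (fun j => j.+1%:R^-1)).
- by near=> j; have [] := WE j.
- exact: cvg_cst.
- exact: cvg_harmonic.
Unshelve. all: end_near. Qed.

End euclidean_geometry.

(** * Means of |<u, V>| as limits of zonal sums *)

Import HBSimple.
Section mean_of_abs.
Context {R : realType} d (T : measurableType d) (P : probability T R) {n : nat}.
Implicit Types (u : 'rV[R]_n) (e : R).

Let fin_type_sums (J : finType) (v : J -> 'rV[R]_n) :
  exists N (w : 'I_N -> 'rV[R]_n),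
    forall u, \sum_(j : J) `|dot u (v j)| = \sum_(j < N) `|dot u (w j)|.
Proof.
exists #|J|, (v \o enum_val) => u.
by rewrite (@big_enum_val _ _ _ _ [pred j : J | true] (fun j => `|dot u (v j)|)).
Qed.

(** A vector with simple coordinates takes finitely many values c_j, and each probability is
    absorbed into the vector as P(A_j) c_j. *)
Let sfun_mean_abs (g : 'I_n -> {sfun T >-> R}) : exists N (v : 'I_N -> 'rV[R]_n),
  forall u, (\int[P]_w (`|dot u (\row_i (g i w : R))|)%R%:E =
             (\sum_(j < N) `|dot u (v j)|)%:E)%E.
Proof.
have /choice[s sE] i : exists s : seq R, forall w, g i w \in s.
  have /finite_seqP[s sE] := @fimfunP _ _ (g i).
  by exists s => w; change ([set` s] (g i w)); rewrite -sE; exists w.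
(* One duplicate-free list of values for all coordinates, so that different index functions describe
   disjoint events. *)
pose S := undup (flatten [seq s i | i <- enum 'I_n]).
have SE i w : g i w \in S.
  rewrite mem_undup; apply/flattenP; exists (s i) => //.
  by apply/mapP; exists i => //; rewrite mem_enum.
pose J := {ffun 'I_n -> 'I_(size S)}.
pose c (j : J) : 'rV[R]_n := \row_i S`_(j i).
pose A (j : J) := [set w | forall i, g i w = S`_(j i)].
have mA j : measurable (A j).
  rewrite (_ : A j = \bigcap_(i in [set: 'I_n]) (g i @^-1` [set S`_(j i)])).
    apply: fin_bigcap_measurable => // i _; exact: measurable_sfunP.
  by apply/seteqP; split=> w H i; [move=> _|]; exact: H.
have [N [v vE]] := fin_type_sums (fun j => fine (P (A j)) *: c j).
exists N, v => u; rewrite -vE.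
transitivity (\int[P]_w (\sum_(j : J) (`|dot u (c j)|%:E * (\1_(A j) w)%:E)))%E.
  apply: eq_integral => w _.
  have ltS i : (index (g i w) S < size S)%N by rewrite index_mem.
  pose j0 : J := [ffun i => Ordinal (ltS i)].
  have j0E i : S`_(j0 i) = g i w by rewrite ffunE/= nth_index.
  rewrite (bigD1 j0)//= [X in (_ + X)%E]big1 ?adde0 => [|j jj0]; last first.
    rewrite indicE memNset ?mule0// => Aj; case/eqP: jj0.
    apply/ffunP => i; apply/val_inj; rewrite ffunE/= (Aj i) index_uniq//.
    exact: undup_uniq.
  rewrite indicE mem_set ?mule1; last by move=> i; rewrite j0E.
  congr (`|dot u _|%:E).
  by apply/rowP => i; rewrite !mxE j0E.
have mind j : measurable_fun setT (fun w => (\1_(A j) w : R)%:E).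
  by apply/measurable_EFinP; exact: measurable_indic.
rewrite ge0_integral_sum//; last by move=> j; exact: measurable_funeM.
rewrite -sumEFin; apply: eq_bigr => j _.
rewrite ge0_integralZl_EFin//.
rewrite integral_indic// setIT dotZr normrM ger0_norm ?fine_ge0// EFinM.
by rewrite fineK ?fin_num_measure// muleC.
Qed.

(** Coordinates are approximated in L1 by simple functions; the error is at most |u| times the sum
    of the coordinate errors. *)
Lemma mean_abs_finite_zonal_sums (V : 'I_n -> T -> R) :
  (forall i, P.-integrable setT (EFin \o V i)) ->
  finite_zonal_sums (fun u => \int[P]_w `|dot u (\row_i V i w)|).
Proof.
(* Dividing by n + 1 instead of n also covers n = 0. *)
move=> iV e e0; pose e' := e / n.+1%:R.
have e'0 : 0 < e' by rewrite divr_gt0.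
have /choice[g gE] i : exists g : {sfun T >-> R}, P.-integrable setT (EFin \o g) /\
    \int[P]_w `|V i w - g w| <= e'.
  have [g_ [ig _ /fine_fcvg/cvgr_lt]] := approximation_sfun_integrable measurableT (iV i).
  move=> /(_ _ e'0)[m _ /(_ _ (leqnn m))] le; exists (g_ m); split=> //.
  exact: ltW.
have [N [v vE]] := sfun_mean_abs g.
exists N, v => u.
have iD (a : 'I_n -> T -> R) : (forall i, P.-integrable setT (EFin \o a i)) ->
    P.-integrable setT (EFin \o (fun w => `|dot u (\row_i a i w)|)).
  move=> ia; apply: (@integrable_norm _ _ _ P setT).
  rewrite (_ : EFin \o _ = fun w => \sum_(i < n) (u 0 i)%:E * (EFin \o a i) w)%E.
    by apply: integrable_sum => // i _; exact: integrableZl.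
  by apply/funext => w; rewrite /= /dot -sumEFin; apply: eq_bigr => i _; rewrite mxE.
have ig i : P.-integrable setT (EFin \o g i) by have [] := gE i.
have -> : \sum_(j < N) `|dot u (v j)| = \int[P]_w `|dot u (\row_i (g i w : R))|.
  by rewrite /Rintegral vE.
pose D i w := `|V i w - g i w|.
have iB i : P.-integrable setT (EFin \o D i).
  apply: (@integrable_norm _ _ _ P setT (V i \- g i)).
  exact: (integrableB _ (iV i) (ig i)).
have iS : P.-integrable setT (EFin \o (fun w => \sum_(i < n) D i w)).
  rewrite (_ : EFin \o _ = fun w => \sum_(i < n) (EFin \o D i) w)%E.
    by apply: integrable_sum => // i _; exact: iB.
  by apply/funext => w; rewrite /= -sumEFin.
rewrite -RintegralB//; [|exact: iD|exact: iD].
apply: le_trans (le_normr_Rintegral _ _) _ => //.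
  by apply: (integrableB _ (iD _ iV) (iD _ ig)).
apply: (@le_trans _ _ (\int[P]_w (enorm u * \sum_(i < n) D i w))).
  apply: le_Rintegral => // [||w _]; last first.
    rewrite (le_trans (ler_dist_dist _ _))// -dotNr -dotDr mulr_sumr.
  rewrite (le_trans (ler_norm_sum _ _ _))//; apply: ler_sum => i _.
  by rewrite normrM !mxE ler_wpM2r// coord_le_enorm.
  - by apply: (integrableZl _ _ iS).
  - apply: (@integrable_norm _ _ _ P setT).
    by apply: (integrableB _ (iD _ iV) (iD _ ig)).
rewrite RintegralZl//.
rewrite mulrC ler_wpM2r ?enorm_ge0//.
rewrite /Rintegral; under eq_integral do rewrite -sumEFin.
rewrite (integral_sum measurableT iB).
rewrite -sum_fine => [|i _]; last exact: integrable_fin_num (iB i).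
rewrite (@le_trans _ _ (\sum_(i < n) e'))//.
  by apply: ler_sum => i _; have [] := gE i.
rewrite sumr_const card_ord -mulr_natr /e' -mulrA ler_piMr ?(ltW e0)//.
by rewrite mulrC ler_pdivrMr// mul1r ler_nat.
Qed.

End mean_of_abs.

(** * Closure properties of limits of zonal sums *)

Section zonal_sums_closure.
Context {R : realType} {n : nat}.
Implicit Types (h f : 'rV[R]_n -> R) (c e : R).

Lemma finite_zonal_sumsD h f : finite_zonal_sums h -> finite_zonal_sums f ->
  finite_zonal_sums (fun u => h u + f u).
Proof.
move=> hh ff e e0; have e2 : 0 < e / 2 by rewrite divr_gt0.
have [N [v vE]] := hh _ e2; have [M [w wE]] := ff _ e2.
exists (N + M)%N, (fun j => match fintype.split j with inl i => v i | inr i => w i end).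
move=> u; rewrite big_split_ord/=.
have -> : \sum_(i < N) `|dot u (match fintype.split (lshift M i) with
    inl i => v i | inr i => w i end)| = \sum_(i < N) `|dot u (v i)|.
  by apply: eq_bigr => i _; rewrite (unsplitK (inl _)).
have -> : \sum_(i < M) `|dot u (match fintype.split (rshift N i) with
    inl i => v i | inr i => w i end)| = \sum_(i < M) `|dot u (w i)|.
  by apply: eq_bigr => i _; rewrite (unsplitK (inr _)).
rewrite opprD addrACA (le_trans (ler_normD _ _))//.
by rewrite (le_trans (lerD (vE u) (wE u)))// -mulrDl -splitr.
Qed.

Lemma finite_zonal_sumsZ c h : 0 <= c -> finite_zonal_sums h ->
  finite_zonal_sums (fun u => c * h u).
Proof.
move=> c0 hh e e0; have [N [v vE]] := hh (e / (c + 1)) (divr_gt0 e0 (ltr_wpDl c0 ltr01)).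
exists N, (fun j => c *: v j) => u.
under eq_bigr do rewrite dotZr normrM (ger0_norm c0).
rewrite -mulr_sumr -mulrBr normrM (ger0_norm c0).
rewrite (le_trans (ler_wpM2l c0 (vE u)))// mulrA ler_wpM2r ?enorm_ge0//.
by rewrite mulrA ler_pdivrMr ?ltr_wpDl// mulrC ler_pM2l// lerDl.
Qed.

Lemma finite_zonal_sums0 : finite_zonal_sums (fun _ : 'rV[R]_n => 0 : R).
Proof.
move=> e e0; exists 0%N, (fun=> 0) => u.
by rewrite big_ord0 subr0 normr0 mulr_ge0 ?enorm_ge0// ltW.
Qed.

Lemma finite_zonal_sums_sum (I : eqType) (s : seq I) (F : I -> 'rV[R]_n -> R) :
  (forall i, i \in s -> finite_zonal_sums (F i)) ->
  finite_zonal_sums (fun u => \sum_(i <- s) F i u).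
Proof.
elim: s => [_|i s IH hF].
  by rewrite (_ : (fun _ => _) = fun=> 0); [exact: finite_zonal_sums0|
    apply/funext => u; rewrite big_nil].
rewrite (_ : (fun _ => _) = fun u => F i u + \sum_(j <- s) F j u).
  apply: finite_zonal_sumsD; first by apply: hF; rewrite mem_head.
  by apply: IH => j js; apply: hF; rewrite in_cons js orbT.
by apply/funext => u; rewrite big_cons.
Qed.

Lemma finite_zonal_sums_limit h :
  (forall e, 0 < e -> exists2 f, finite_zonal_sums f &
    forall u, `|h u - f u| <= e * enorm u) ->
  finite_zonal_sums h.
Proof.
move=> hh e e0; have e2 : 0 < e / 2 by rewrite divr_gt0.
have [f ff hf] := hh _ e2; have [N [v vE]] := ff _ e2; exists N, v => u.
rewrite (le_trans (ler_distD (f u) _ _))//.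
by rewrite (le_trans (lerD (hf u) (vE u)))// -mulrDl -splitr.
Qed.

End zonal_sums_closure.

Lemma enormZ {R : realType} {n} (c : R) (u : 'rV[R]_n) :
  enorm (c *: u) = `|c| * enorm u.
Proof. by rewrite /enorm dotZl dotZr mulrA -expr2 sqrtrM ?sqr_ge0// sqrtr_sqr. Qed.

(** * Splitting off the last coordinate *)

Section last_coordinate.
Context {R : realType} {k : nat}.
Implicit Types (u v : 'rV[R]_(k + 1)).

Definition last_coord u : R := u 0 (rshift k ord0).

Lemma row_mx_last_coord u : row_mx (lsubmx u) (last_coord u)%:M = u.
Proof.
rewrite -[RHS]hsubmxK; congr row_mx.
by apply/matrixP => i j; rewrite !mxE !ord1 mulr1n.
Qed.

Lemma last_coord_row_mx (x : 'rV[R]_k) t : last_coord (row_mx x t%:M) = t.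
Proof. by rewrite /last_coord row_mxEr mxE mulr1n. Qed.

Lemma dot_last_coord u v :
  dot u v = dot (lsubmx u) (lsubmx v) + last_coord u * last_coord v.
Proof.
rewrite /dot big_split_ord/= big_ord1; congr (_ + _).
by apply: eq_bigr => i _; rewrite !mxE.
Qed.

Lemma dot_row_mx u (x : 'rV[R]_k) t :
  dot u (row_mx x t%:M) = dot (lsubmx u) x + last_coord u * t.
Proof. by rewrite dot_last_coord row_mxKl last_coord_row_mx. Qed.

Lemma enorm_lsubmx_le u : enorm (lsubmx u) <= enorm u.
Proof.
by rewrite ler_sqrt ?dot_ge0// (dot_last_coord u) lerDl -expr2 sqr_ge0.
Qed.

End last_coordinate.

(** * The homogeneous form of F and its slope at infinity *)

Section polar_norm.
Context {R : realType}.
Implicit Types (c t s : R).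

(* The support function of the polar body, as a function of the Euclidean norm
   of [x] and of [t]. *)
Definition polar_norm c t : R := if c == 0 then `|t| else c * polar_profile (t / c).

(** F(s) phi(p) = 1 + s p <= (1 + |s|) phi(p), since phi(p) is at least 1 and |p|. *)
Lemma polar_profile_le1D s : polar_profile s <= 1 + `|s|.
Proof.
have p1 := gauss_abs_ge1 (touching_point s).
have pp := gauss_abs_ge (touching_point s).
rewrite -(ler_pM2r (gauss_abs_gt0 (touching_point s))) -polar_profile_touch.
rewrite mulrDl mul1r lerD// (le_trans (ler_norm _))// normrM.
exact: ler_wpM2l.
Qed.

Let linear_bounded_le0 a b : (forall s, 0 <= s -> a * s <= b) -> a <= 0.
Proof.
move=> ab; rewrite leNgt; apply/negP => a0.
have := ab ((`|b| + 1) / a); rewrite divr_ge0 ?(ltW a0) ?addr_ge0// => /(_ isT).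
rewrite mulrCA divff ?gt_eqF// mulr1 => h.
by have := ler_norm b; lra.
Qed.

(* The slopes at infinity of the two sides agree up to [e]. *)
Lemma mixture_slope_total e k (p : seq (R * R)) : (forall x, x \in p -> 0 <= x.1 /\ 0 < x.2) ->
  (forall s, `|polar_profile s - (k + \sum_(x <- p) x.1 * gauss_abs (x.2 * s))| <=
    e * (1 + `|s|)) ->
  `|1 - \sum_(x <- p) x.1 * x.2| <= e.
Proof.
move=> p0 H; set L := \sum_(x <- p) _; pose C := \sum_(x <- p) x.1.
have lo s : 0 <= s -> L * s <= \sum_(x <- p) x.1 * gauss_abs (x.2 * s).
  move=> s0; rewrite mulr_suml !big_seq; apply: ler_sum => x /p0[x1 x2].
  by rewrite -mulrA ler_wpM2l// (le_trans (ler_norm _))// gauss_abs_ge.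
have hi s : 0 <= s -> \sum_(x <- p) x.1 * gauss_abs (x.2 * s) <= C + L * s.
  move=> s0; rewrite mulr_suml -big_split/= !big_seq; apply: ler_sum => x /p0[x1 x2].
  rewrite -mulrA -[X in X + _]mulr1 -mulrDr ler_wpM2l// (le_trans (gauss_abs_le _))//.
  by rewrite ger0_norm// mulr_ge0// ltW.
rewrite ler_norml; apply/andP; split.
  suff : L - 1 - e <= 0 by lra.
  apply: (@linear_bounded_le0 _ (1 + e - k)) => s s0.
  have := H s; rewrite ler_norml ger0_norm// => /andP[h1 h2].
  by have := lo _ s0; have := polar_profile_le1D s; rewrite ger0_norm//; lra.
suff : 1 - L - e <= 0 by lra.
apply: (@linear_bounded_le0 _ (k + e + C)) => s s0.
have := H s; rewrite ler_norml ger0_norm// => /andP[h1 h2].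
by have := hi _ s0; have := polar_profile_ge s; rewrite ger0_norm//; lra.
Qed.

End polar_norm.

(** * Zonal approximation of the support function of the polar body *)

Section zonal_polar_norm.
Context {R : realType} d (T : measurableType d) (P : probability T R) (k : nat).
Variable X : {RV P >-> Rtuple R k}.
Hypotheses (X_gauss : gaussian_vector X) (X_centered : centered_vector X).
Hypothesis X_cov : has_covariance_matrix X (pi / 2)%:M.
Implicit Types (u : 'rV[R]_(k + 1)).

(** The function is the mean of |<u, V>| for the random vector V = (c X, b). *)
Lemma scaled_gauss_abs_zonal_sums c b : 0 <= c ->
  finite_zonal_sums
    (fun u => scaled_gauss_abs (c * enorm (lsubmx u)) (b * last_coord u)).
Proof.
move=> c0; pose V (i : 'I_(k + 1)) w : R := row_mx (c *: vec (X w)) b%:M 0 i.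
have iV i : P.-integrable setT (EFin \o V i).
  case: (split_ordP i) => j ->.
    rewrite (_ : EFin \o _ = fun w => c%:E * (tnth (X w) j)%:E)%E.
      exact: (integrableZl _ _ (gaussian_coord_integrable X_centered X_cov j)).
    by apply/funext => w; rewrite /= /V row_mxEl !mxE.
  rewrite (_ : EFin \o _ = cst b%:E); first exact: finite_measure_integrable_cst.
  by apply/funext => w; rewrite /= /V row_mxEr !mxE ord1.
rewrite (_ : (fun _ => _) = fun u => \int[P]_w `|dot u (\row_i V i w)|).
  exact: mean_abs_finite_zonal_sums.
apply/funext => u; have := gaussian_vector_mean X_gauss X_centered X_cov
  (c *: lsubmx u) (b * last_coord u).
rewrite unlock enormZ ger0_norm// /Rintegral => H.
rewrite -[LHS]/(fine (_%:E)) -H; congr fine; apply: eq_integral => w _.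
rewrite (_ : \row_i V i w = row_mx (c *: vec (X w)) b%:M).
  by rewrite dot_row_mx dotZl dotZr (mulrC b).
by apply/rowP => i; rewrite mxE.
Qed.

Lemma enorm_zonal_sums : finite_zonal_sums (fun u => enorm (lsubmx u)).
Proof.
rewrite (_ : (fun _ => _) = fun u =>
    scaled_gauss_abs (1 * enorm (lsubmx u)) (0 * last_coord u)).
  exact: scaled_gauss_abs_zonal_sums.
apply/funext => u; rewrite mul0r mul1r /scaled_gauss_abs.
by case: eqP => [->|]; rewrite ?normr0// mul0r gauss_abs0 mulr1.
Qed.

(** Homogenises the mixture: with c = |x|, the term c * phi (l t / c) is l times [scaled_gauss_abs]
    at (c / l, t), and the constant contributes a multiple of |x|. *)
Lemma polar_norm_zonal_sums :
  finite_zonal_sums (fun u => polar_norm (enorm (lsubmx u)) (last_coord u)).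
Proof.
apply: finite_zonal_sums_limit => e e0; have e2 : 0 < e / 2 by rewrite divr_gt0.
have [q [p [q0 p0 H]]] := polar_profile_mixture e2.
exists (fun u => q * enorm (lsubmx u) + \sum_(x <- p) x.1 * x.2 *
    scaled_gauss_abs (x.2^-1 * enorm (lsubmx u)) (1 * last_coord u)).
  apply: finite_zonal_sumsD.
    by apply: finite_zonal_sumsZ => //; exact: enorm_zonal_sums.
  apply: finite_zonal_sums_sum => x /p0[x1 x2].
  apply: finite_zonal_sumsZ; first by rewrite mulr_ge0// ltW.
  by apply: scaled_gauss_abs_zonal_sums; rewrite invr_ge0 ltW.
move=> u; have := enorm_lsubmx_le u; have := coord_le_enorm u (rshift k ord0).
rewrite -/(last_coord u); have := enorm_ge0 (lsubmx u).
move: (enorm (lsubmx u)) (last_coord u) (enorm u) => c t E c0 tE cE.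
(* At x = 0 only slopes at infinity remain; they agree by [mixture_slope_total]. *)
rewrite /polar_norm mul1r; case: eqVneq => [->|cn0].
  rewrite mulr0 add0r.
  rewrite (_ : \sum_(x <- p) _ = (\sum_(x <- p) x.1 * x.2) * `|t|); last first.
    by rewrite mulr_suml; apply: eq_bigr => x _; rewrite mulr0 /scaled_gauss_abs eqxx.
  rewrite -[X in `|X - _|]mul1r -mulrBl normrM normr_id.
  have := mixture_slope_total p0 H; have := normr_ge0 t.
  move: `|t| `|1 - _| tE => a b aE a0 be; nra.
have cp : 0 < c by rewrite lt_neqAle eq_sym cn0.
rewrite (_ : _ - _ = c * (polar_profile (t / c) -
    (q + \sum_(x <- p) x.1 * gauss_abs (x.2 * (t / c))))); last first.
  rewrite mulrBr mulrDr (mulrC q); congr (_ - (_ + _)).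
  rewrite mulr_sumr !big_seq; apply: eq_bigr => x /p0[x1 x2].
  rewrite /scaled_gauss_abs mulf_eq0 invr_eq0 gt_eqF//= (negbTE cn0).
  rewrite (_ : t / (x.2^-1 * c) = x.2 * (t / c)); last by field; rewrite cn0 gt_eqF.
  by field; rewrite gt_eqF.
rewrite normrM gtr0_norm// (le_trans (ler_wpM2l c0 (H _)))//.
rewrite normrM normfV (gtr0_norm cp).
rewrite (_ : c * _ = e / 2 * (c + `|t|)); last by field.
by nra.
Qed.

End zonal_polar_norm.

(** * The polar of a convex body is a convex body *)

Section polar_body.
Context {R : realType} {n : nat}.
Variable K : set 'rV[R]_n.
Hypothesis bK : convex_body K.
Implicit Types u y : 'rV[R]_n.

Let cK : compact K. Proof. by case: bK. Qed.

Let convK x y (l : R) : K x -> K y -> 0 <= l <= 1 -> K (l *: x + (1 - l) *: y).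
Proof. by have [_ /convex_setP H _ _] := bK; exact: H. Qed.

Let symK y : K y -> K (- y). Proof. by case: bK => _ _ H _; exact: H. Qed.

Let neK : K !=set0.
Proof. by case: bK => _ _ _ [y iy]; exists y; exact: interior_subset. Qed.

Lemma polarP u : polar K u <-> forall y, K y -> dot u y <= 1.
Proof.
split=> [Ku y Ky|]; last exact: support_function_le.
exact: le_trans (support_function_ge u cK Ky) Ku.
Qed.

Let polar_convex : convex_set (polar K : set (convex_lmodType 'rV[R]_n)).
Proof.
apply/convex_setP => u v l /polarP Ku /polarP Kv /andP[l0 l1]; apply/polarP => y Ky.
rewrite dotDl !dotZl.
rewrite (le_trans (lerD (ler_wpM2l l0 (Ku _ Ky)) (ler_wpM2l _ (Kv _ Ky)))) ?subr_ge0//.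
by lra.
Qed.

Let polar_sym u : polar K u -> polar K (- u).
Proof.
move=> /polarP Ku; apply/polarP => y Ky; rewrite dotNl -dotNr.
by apply: Ku; exact: symK.
Qed.

Let polar_closed : closed (polar K).
Proof.
rewrite (_ : polar K = \bigcap_(y in K) (dot^~ y @^-1` [set c | c <= 1])).
  apply: closed_bigI => y _; apply: closed_comp; last exact: closed_le.
  by move=> u _; rewrite (_ : dot^~ y = dot y);
    [exact: dot_continuous|apply/funext => v; rewrite dotC].
by apply/seteqP; split=> u => [/polarP Ku y /Ku|Ku]; [|apply/polarP => y /Ku].
Qed.

(** Symmetry and convexity move a ball of K to the origin, so K contains small multiples of the
    coordinate vectors; pairing with them bounds the coordinates of the polar. *)
Let polar_coord_le : exists C : R, forall u i, polar K u -> `|u 0 i| <= C.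
Proof.
have [_ _ _ [y0 /nbhs_ballP[r /= r0 rK]]] := bK.
have Kd i (c : R) : `|c| <= r / 2 -> K (2^-1 *: (c *: delta_mx 0 i)).
  move=> cr; rewrite (_ : _ *: _ =
      2^-1 *: (y0 + c *: delta_mx 0 i) + (1 - 2^-1) *: (- y0)); last first.
    by apply/rowP => j; rewrite !mxE; field.
  apply: convK; [|apply: symK; apply: rK; exact: ballxx|lra].
  apply: rK; split=> // a j; rewrite /ball/= !mxE (ord1 a) opprD addNKr normrN.
  rewrite normrM (le_lt_trans (_ : _ <= r / 2))//; last lra.
  by rewrite (le_trans _ cr)// ler_piMr//; case: (_ && _); rewrite ?normr1 ?normr0.
exists (4 / r) => u i /polarP Ku.
have key (c : R) : `|c| <= r / 2 -> c * u 0 i <= 2.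
  move=> /(Kd i) /Ku; rewrite !dotZr.
  rewrite (_ : dot u (delta_mx 0 i) = u 0 i); last first.
    rewrite /dot (bigD1 i)//= big1 => [|j ji]; last by rewrite !mxE (negbTE ji) andbF mulr0.
    by rewrite !mxE !eqxx mulr1 addr0.
  by lra.
rewrite ler_pdivlMr//.
have := key (r / 2); have := key (- (r / 2)).
rewrite normrN ger0_norm ?divr_ge0 ?(ltW r0)// => /(_ (lexx _)) h1 /(_ (lexx _)) h2.
by case: (ger0P (u 0 i)) => _; nra.
Qed.

Let polar_compact : compact (polar K).
Proof.
have [C CE] := polar_coord_le.
apply: (@subclosed_compact _ _
    [set u : 'rV[R]_n | forall i, `[- C, C]%classic (u 0 i)]) => //.
  by apply: (@rV_compact R n (fun=> `[- C, C]%classic)) => i; exact: segment_compact.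
by move=> u Ku i; rewrite /= in_itv/= -ler_norml CE.
Qed.

Lemma convex_body_polar : convex_body (polar K).
Proof.
split=> //; exists 0.
have csq : continuous (fun y : 'rV[R]_n => dot y y).
  by apply: continuous_sum => i w; apply: continuousM; exact: coord_continuous.
have [|y1 _ y1E] := @compact_EVT_max _ _ (fun y => dot y y) K neK cK.
  exact: continuous_subspaceT.
have D0 : 0 < dot y1 y1 + 1 by rewrite ltr_wpDl ?dot_ge0.
have /cvgr_lt := csq 0; rewrite dot0r => /(_ (dot y1 y1 + 1)^-1).
rewrite invr_gt0 => /(_ D0); apply: filterS => u uD; apply/polarP => y Ky.
rewrite (le_trans (cauchy_schwarz _ _))// -sqrtrM ?dot_ge0// -[leRHS]sqrtr1 ler_sqrt//.
have yD : dot y y <= dot y1 y1 + 1.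
  by rewrite (le_trans (y1E _ _)) ?inE// lerDl.
rewrite (le_trans (ler_wpM2l (dot_ge0 _) yD))//.
by rewrite -ler_pdivlMr// div1r ltW.
Qed.

End polar_body.

(** * The support function of the polar body *)

Section polar_support.
Context {R : realType}.
Implicit Types (a b c t : R).

Let scaled_gauss_abs_ge a b : 0 <= a -> `|b| <= scaled_gauss_abs a b.
Proof.
rewrite le_eqVlt /scaled_gauss_abs => /orP[/eqP<-|a0]; first by rewrite eqxx.
rewrite gt_eqF// mulrC -ler_pdivrMr//.
by rewrite (le_trans _ (gauss_abs_ge _))// normrM normfV (gtr0_norm a0).
Qed.

Let polar_norm_ge c t : 0 <= c -> `|t| <= polar_norm c t.
Proof.
rewrite le_eqVlt /polar_norm => /orP[/eqP<-|a0]; first by rewrite eqxx.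
rewrite gt_eqF// mulrC -ler_pdivrMr//.
by rewrite (le_trans _ (polar_profile_ge _))// normrM normfV (gtr0_norm a0).
Qed.

Let polar_norm_bound a b c t : 0 <= a -> 0 <= c ->
  c * a + t * b <= polar_norm c t * scaled_gauss_abs a b.
Proof.
move=> a0 c0; have [-> |cn0] := eqVneq c 0.
  rewrite mul0r add0r (le_trans (ler_norm _))// normrM /polar_norm eqxx.
  by rewrite ler_wpM2l// scaled_gauss_abs_ge.
have [-> |an0] := eqVneq a 0.
  rewrite mulr0 add0r (le_trans (ler_norm _))// normrM /scaled_gauss_abs eqxx.
  by rewrite ler_wpM2r// polar_norm_ge.
rewrite /polar_norm /scaled_gauss_abs (negbTE an0) (negbTE cn0).
rewrite mulrACA (_ : _ + _ = c * a * (1 + t / c * (b / a))).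
  by rewrite ler_wpM2l ?mulr_ge0// polar_profile_bound.
by field; rewrite an0.
Qed.

(** The upper bound is [polar_norm_bound], the homogeneous form of 1 + s q <= F(s) phi(q), after
    Cauchy-Schwarz in x. Equality needs y parallel to x and the ratio of last coordinate to |y|
    equal to the touching point. *)
Lemma support_function_polar k (Z : set 'rV[R]_(k + 1)) : convex_body Z ->
  (forall x t, support_function Z (row_mx x t%:M) = scaled_gauss_abs (enorm x) t) ->
  forall x t, support_function (polar Z) (row_mx x t%:M) = polar_norm (enorm x) t.
Proof.
move=> bZ hZ x t; have x0 := enorm_ge0 x.
have [cP _ _ [y1 iP]] := convex_body_polar bZ.
apply/eqP; rewrite eq_le; apply/andP; split.
  apply: support_function_le; first by exists y1; exact: interior_subset.
  move=> y; rewrite /polar/= -{1}(row_mx_last_coord y) hZ => yZ.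
  rewrite -{1}(row_mx_last_coord y) dot_row_mx row_mxKl last_coord_row_mx.
  rewrite (le_trans (lerD (cauchy_schwarz _ _) (lexx _)))//.
  rewrite (le_trans (polar_norm_bound _ _ (enorm_ge0 _) x0))// ler_piMr//.
  exact: le_trans (polar_norm_ge _ x0).
have attain y s : scaled_gauss_abs (enorm y) s <= 1 -> 
    polar_norm (enorm x) t = dot x y + t * s ->
    polar_norm (enorm x) t <= support_function (polar Z) (row_mx x t%:M).
  move=> y1' ->; rewrite -[in X in X + _](row_mxKl x t%:M).
  rewrite -[X in _ + X * _](last_coord_row_mx x) -dot_row_mx.
  by apply: support_function_ge => //; rewrite /polar/= hZ.
have [xe0|xn0] := eqVneq (enorm x) 0.
  apply: (attain 0 (Num.sg t)).
    rewrite (_ : enorm 0 = 0); last by apply/eqP; rewrite enorm_eq0.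
    by rewrite /scaled_gauss_abs eqxx normr_sg lern1 leq_b1.
  by rewrite /polar_norm xe0 eqxx dot0r add0r mulrC -normrEsg.
have xp : 0 < enorm x by rewrite lt_neqAle eq_sym xn0.
pose p := touching_point (t / enorm x); pose f := gauss_abs p.
have f0 : 0 < f := gauss_abs_gt0 p.
(* The norm of the first block is 1 / f and the ratio is p, so h_Z there is phi(p) / f = 1. *)
apply: (attain ((f * enorm x)^-1 *: x) (p / f)).
  rewrite enormZ ger0_norm ?invr_ge0 ?mulr_ge0 ?(ltW f0)//.
  have -> : (f * enorm x)^-1 * enorm x = f^-1.
    by rewrite invfM -mulrA mulVf ?mulr1.
  rewrite /scaled_gauss_abs invr_eq0 gt_eqF// invrK divfK ?gt_eqF//.
  by rewrite mulVf// gt_eqF.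
rewrite /polar_norm (negbTE xn0) dotZr -sqr_enorm.
have := polar_profile_touch (t / enorm x); rewrite -/p -/f => touch.
rewrite -(mulfK (_ : f != 0) (polar_profile _)) ?gt_eqF// -touch.
move: (enorm x) f xn0 f0 => c b c0 b0.
by field; rewrite c0 gt_eqF.
Qed.

End polar_support.

(** * The integral formula in homogeneous form *)

Section polar_norm_laplace.
Context {R : realType}.
Implicit Types (l t : R).

(** The inner mean times the weight is |x| * [mixture_term l] (t / |x|), reducing the claim to the
    representation of F; for x = 0 only the total weight 1 remains. *)
Lemma polar_norm_laplace k (nu : {measure set (measurableTypeR R) -> \bar R}) :
  (forall u : R, 0 <= u -> (polar_curvature (Num.sqrt u))%:E =
      (\int[nu]_(l in `]0%R, +oo[) (expR (- (l * u)))%:E)%E) ->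
  forall (x : 'rV[R]_k) t,
    (\int[nu]_(l in `]0%R, +oo[)
      ((\int[gaussian_measure l (k := k)]_z (`|dot x (vec z) + t|)%R%:E) *
       (Num.sqrt pi / (2 * Num.sqrt l))%:E) = (polar_norm (enorm x) t)%:E)%E.
Proof.
move=> nuE x t; rewrite /polar_norm; have x0 := enorm_ge0 x.
have weightE l : 0 < l -> Num.sqrt pi / (2 * Num.sqrt l) = gauss_scale l / (2 * l).
  move=> l0; rewrite /gauss_scale sqrtrM ?pi_ge0// -{3}(sqr_sqrtr (ltW l0)).
  have : 0 < Num.sqrt l by rewrite sqrtr_gt0.
  by move: (Num.sqrt pi) (Num.sqrt l) => a b b0; field; rewrite gt_eqF.
have [xe0|xn0] := eqVneq (enorm x) 0.
  transitivity (\int[nu]_(l in `]0%R, +oo[)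
      (`|t|%:E * (gauss_scale l / (2 * l))%:E))%E.
    apply: eq_integral => l; rewrite inE/= in_itv/= andbT => l0.
    rewrite gaussian_measure_mean// xe0 mul0r /scaled_gauss_abs eqxx.
    by rewrite weightE.
  rewrite ge0_integralZl_EFin//.
  - by rewrite (mixture_weight_total nuE) mule1.
  - move=> l; rewrite /= in_itv/= andbT => l0.
    by rewrite lee_fin divr_ge0 ?sqrtr_ge0 ?mulr_ge0 ?(ltW l0).
  - exact: measurable_mixture_weight.
transitivity (\int[nu]_(l in `]0%R, +oo[)
    ((enorm x)%:E * (mixture_term l (t / enorm x))%:E))%E.
  apply: eq_integral => l; rewrite inE/= in_itv/= andbT => l0.
  have gs0 := gauss_scale_gt0 l0.
  rewrite gaussian_measure_mean// /scaled_gauss_abs mulf_eq0 invr_eq0.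
  rewrite (negbTE xn0) (gt_eqF gs0)/= -!EFinM /mixture_term; congr EFin.
  rewrite (_ : t / (enorm x / gauss_scale l) = gauss_scale l * (t / enorm x)); last first.
    by rewrite invf_div mulrCA.
  rewrite weightE//.
  move: (gauss_abs _) => g; move: (enorm x) (gauss_scale l) xn0 gs0 => c s c0 s0.
  by field; rewrite !gt_eqF.
rewrite ge0_integralZl_EFin//.
- by rewrite (polar_profile_laplace nuE) EFinM.
- move=> l; rewrite /= in_itv/= andbT => l0; rewrite lee_fin /mixture_term.
  by rewrite mulr_ge0 ?invr_ge0 ?mulr_ge0 ?(ltW l0)// (ltW (gauss_abs_gt0 _)).
- exact: measurable_mixture_term.
Qed.

End polar_norm_laplace.

(** * Both claims for the body Z *)

Theorem theorem4p7 (R : realType) (n : nat) (n_ge2 : (2 <= n)%N)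
    (d : measure_display) (T : measurableType d) (P : probability T R)
    (Gam : {RV P >-> Rtuple R n.-1})
    (Gam_gauss : gaussian_vector Gam)
    (Gam_centered : centered_vector Gam)
    (Gam_cov : has_covariance_matrix Gam (pi / 2)%:M)
    (Z : set 'rV[R]_(n.-1 + 1))
    (Z_body : convex_body Z)
    (Z_support : forall (x : 'rV[R]_n.-1) (t : R),
      (support_function Z (row_mx x t%:M))%:E =
      'E_P[fun w => (`|dot x (vec (Gam w)) + t|)%R]%E) :
  zonoid (polar Z) /\
  let e1 : 'rV[R]_n.-1 := \row_i (nat_of_ord i == 0%N)%:R in
  let phi : R -> R := fun s => support_function (polar Z) (row_mx e1 s%:M) in
  forall nu : {measure set (measurableTypeR R) -> \bar R},
    (forall u : R, 0 <= u ->
      (derive1n 2 phi (Num.sqrt u))%:E =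
      (\int[nu]_(l in `]0%R, +oo[) (expR (- (l * u)))%:E)%E) ->
    forall (x : 'rV[R]_n.-1) (t : R),
      (support_function (polar Z) (row_mx x t%:M))%:E =
      (\int[nu]_(l in `]0%R, +oo[)
         ((\int[gaussian_measure l (k := n.-1)]_z (`|dot x (vec z) + t|)%R%:E) *
          (Num.sqrt pi / (2 * Num.sqrt l))%:E))%E.
Proof.
have hZ x t : support_function Z (row_mx x t%:M) = scaled_gauss_abs (enorm x) t.
  by apply: EFin_inj; rewrite Z_support; exact: gaussian_vector_mean.
have hP := support_function_polar Z_body hZ.
split.
  apply: zonoid_of_zonal_sums; first exact: convex_body_polar.
  rewrite (_ : support_function _ =
      fun u => polar_norm (enorm (lsubmx u)) (last_coord u)).
    exact: polar_norm_zonal_sums Gam_gauss Gam_centered Gam_cov.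
  by apply/funext => u; rewrite -{1}(row_mx_last_coord u) hP.
move=> e1 phi nu nuE x t; rewrite hP.
have e1E : enorm e1 = 1.
  rewrite /enorm; apply/eqP; rewrite -(sqrtr1 R); apply/eqP; congr Num.sqrt.
  (* As n >= 2, the first factor has a first coordinate, so e1 is a unit vector and phi is F. *)
  have n1 : (0 < n.-1)%N by rewrite -ltnS prednK// ltnW.
  rewrite /dot (bigD1 (Ordinal n1))//= big1 => [|i i0].
    by rewrite !mxE eqxx mulr1 addr0.
  by rewrite !mxE (_ : (_ == _) = false) ?mulr0//; apply/negbTE.
have phiE : phi = polar_profile.
  apply/funext => s; rewrite /phi hP e1E /polar_norm oner_eq0 mul1r divr1.
  by [].
symmetry; apply: polar_norm_laplace => u u0.
by rewrite -derive1n2_polar_profile -phiE nuE.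
Qed.
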